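(* Let $\pi_2$ be a generator of $\mathrm{LT}[\pi^2]$, let $\alpha\in\mathbf{C}$ satisfy $\alpha^{q^2(q+1)}=\pi_2$, and let $\sigma\in I_F$ be an element fixing $\pi_2$. Write $\sigma(\alpha)=\zeta\alpha$ with $\zeta\in\mu_{q^2(q+1)}$. Then $\sigma$ acts on the reduction $\overline{\mathbf{Y}}^{\pi_2}_{3,1,e_1}$, given by $-x^qy^{q^2}+xy^{q^3}=1$ in the coordinates $x=X_2/\alpha^{q^2}$, $y=Y_2/\alpha$, as $$\sigma:\overline{\mathbf{Y}}^{\pi_2}_{3,1,e_1}\longrightarrow\overline{\mathbf{Y}}^{\pi_2}_{3,1,e_1};\quad (x,y)\mapsto(\zeta^{-q^2}x,\zeta^{-1}y).$$
   Context: $F$ is a non-archimedean local field of equal characteristic $p>0$ with residue field $\mathbb{F}_q$ and uniformizer $\pi$; $\mathbf{C}$ is the completion of an algebraic closure of $F$, $v$ the valuation on $\mathbf{C}$ with $v(\pi)=1$. All spaces are rigid analytic curves considered over $\mathbf{C}$. $\mu_n$ denotes the group of $n$-th roots of unity. For $u\in\mathbf{C}$ with $v(u)>0$ put $[\pi]_u(X)=X^{q^2}+uX^q+\pi X$ and $[\pi^2]_u=[\pi]_u\circ[\pi]_u$. Put $[\pi]_{\mathrm{LT}}(X)=\pi X-X^q$; a generator of $\mathrm{LT}[\pi^2]$ is an element $\pi_2\in\mathbf{C}$ with $[\pi]_{\mathrm{LT}}([\pi]_{\mathrm{LT}}(\pi_2))=0$ and $[\pi]_{\mathrm{LT}}(\pi_2)\neq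 0$; then $v(\pi_2)=\frac{1}{q(q-1)}$. For $X_2,Y_2$ with $[\pi^2]_u(X_2)=[\pi^2]_u(Y_2)=0$ write $X_1=[\pi]_u(X_2)$, $Y_1=[\pi]_u(Y_2)$ and $$\mu_2(X_2,Y_2)=X_1Y_2^q-X_1^qY_2-X_2^qY_1+X_2Y_1^q .$$ $\mathcal{X}^{\pi_2}(\pi^2)$ is the rigid analytic curve with $\mathbf{C}$-points $\{(u,X_2,Y_2): v(u)>0,\ [\pi^2]_u(X_2)=[\pi^2]_u(Y_2)=0,\ \mu_2(X_2,Y_2)=\pi_2\}$. $\mathbf{Y}^{\pi_2}_{3,1,e_1}$ is the subspace of $\mathcal{X}^{\pi_2}(\pi^2)$ defined by $v(u)=\frac1{q+1}$, $v(X_1)=\frac{q}{q^2-1}$, $v(X_2)=v(Y_1)=\frac{1}{q(q^2-1)}$, $v(Y_2)=\frac{1}{q^3(q^2-1)}$. The reduction of a reduced affinoid over $\mathbf{C}$ is $\mathrm{Spec}$ of the ring of power-bounded functions modulo the topologically nilpotent functions. Inertia action: $I_F=\mathrm{Aut}_{\rm cont}(\mathbf{C}/F^{\rm ur})$ acts on the reduction by $\overline{P}\mapsto\overline{P^{\sigma}}$ for points $P$ of the affinoid. Convention: in terms of coordinates, $\sigma$ acts on functions by acting on coefficients, so $u,X_i,Y_i$ are fixed and e.g. $(Y_2/\alpha)^\sigma=Y_2/\sigma(\alpha)$ (equivalently $P^\sigma=\sigma^{-1}(P)$). Roots of unity are identified with their images in the residue field. *)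

(* Defs.v *)
From HB Require Import structures.
From mathcomp Require Import all_boot all_order all_algebra all_field.
From mathcomp Require Import mpoly.
From mathcomp Require Import boolp classical_sets functions cardinality.
From mathcomp Require Import reals constructive_ereal.

Set Implicit Arguments.
Unset Strict Implicit.
Unset Printing Implicit Defensive.

Import Order.TTheory GRing.Theory Num.Theory.
Local Open Scope ring_scope.
Local Open Scope quotient_scope.

Record valuation (R : realType) (K : fieldType) := Valuation {
  valn :> K -> \bar R;
  valn_pinfty : forall x, valn x = +oo%E <-> x = 0;
  valn_ninfty : forall x, valn x <> -oo%E;
  valnM : forall x y, valn (x * y) = (valn x + valn y)%E;
  valnD : forall x y, (Order.min (valn x) (valn y) <= valn (x + y))%E
}.

Section ValuationTheory.
Variables (R : realType) (K : fieldType) (v : valuation R K).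
Implicit Types (x y : K) (r : \bar R).

Lemma valn0 : v 0 = +oo%E. Proof. exact/valn_pinfty. Qed.

Lemma valn_fin x : x != 0 -> v x \is a fin_num.
Proof.
move=> x0; case E: (v x) => [r||] //.
  by move/valn_pinfty: E x0 => ->; rewrite eqxx.
by case: (valn_ninfty E).
Qed.

Lemma valn1 : v 1 = 0%E.
Proof.
have := valnM v 1 1; rewrite mulr1.
have := valn_fin (oner_neq0 K); case: (v 1) => [r||] // _ [] rr.
by congr (_%:E); apply: (addrI r); rewrite addr0.
Qed.

Lemma valnN x : v (- x) = v x.
Proof.
suff -> : v (- x) = (v (-1)%R + v x)%E.
  have := valnM v (-1) (-1); rewrite mulrNN mulr1 valn1.
  have : (-1 : K) != 0 by rewrite oppr_eq0 oner_neq0.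
  move/valn_fin; case: (v (-1)) => [r||] // _ [] /esym/eqP.
  by rewrite -mulr2n mulrn_eq0 /= => /eqP ->; rewrite add0e.
by rewrite -valnM mulN1r.
Qed.

Lemma valn_le_add r x y : (r <= v x)%E -> (r <= v y)%E -> (r <= v (x + y)%R)%E.
Proof.
by move=> rx ry; apply: le_trans (valnD v x y); rewrite le_min rx ry.
Qed.

Lemma valn_le_sum r I (s : seq I) (P : pred I) (F : I -> K) :
  (forall i, P i -> (r <= v (F i))%E) -> (r <= v (\sum_(i <- s | P i) F i)%R)%E.
Proof.
move=> rF; apply: (big_ind (fun x => (r <= v x)%E)) => //.
  by rewrite valn0 leey.
by move=> x y; apply: valn_le_add.
Qed.

Lemma valnV x : x != 0 -> v x^-1 = (- v x)%E.
Proof.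
move=> x0; have := valnM v x x^-1; rewrite divff // valn1.
have := valn_fin x0; have := valn_fin (invr_neq0 x0).
case: (v x) => [a||] //; case: (v x^-1) => [b||] // _ _ [] ab.
by congr (_%:E); apply: (addrI a); rewrite -ab subrr.
Qed.

Definition valn_cvg (u : nat -> K) (l : K) : Prop :=
  forall B : R, exists N : nat, forall n, (N <= n)%N -> (B%:E <= v (u n - l)%R)%E.

Definition valn_cauchy (u : nat -> K) : Prop :=
  forall B : R, exists N : nat,
    forall m n, (N <= m)%N -> (N <= n)%N -> (B%:E <= v (u m - u n)%R)%E.

Definition valn_complete : Prop :=
  forall u, valn_cauchy u -> exists l, valn_cvg u l.

Definition valn_continuous (f : K -> K) : Prop :=
  forall (x : K) (B : R), exists A : R,
    forall y, (A%:E <= v (y - x)%R)%E -> (B%:E <= v (f y - f x)%R)%E.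

End ValuationTheory.

Section ValuationComp.
Variables (R : realType) (K L : fieldType) (i : {rmorphism K -> L}).
Variable v : valuation R L.

Fact valn_comp_pinfty x : v (i x) = +oo%E <-> x = 0.
Proof.
rewrite (valn_pinfty v); split=> [/eqP|->]; last exact: rmorph0.
by rewrite fmorph_eq0 => /eqP.
Qed.

Fact valn_compM x y : v (i (x * y)) = (v (i x) + v (i y))%E.
Proof. by rewrite rmorphM valnM. Qed.

Fact valn_compD x y :
  (Order.min (v (i x)) (v (i y)) <= v (i (x + y)%R))%E.
Proof. by rewrite rmorphD valnD. Qed.

Definition valn_comp : valuation R K :=
  @Valuation R K (fun x => v (i x)) valn_comp_pinfty
    (fun x => @valn_ninfty R L v (i x)) valn_compM valn_compD.

End ValuationComp.

Section ResidueField.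
Variables (R : realType) (K : fieldType) (v : valuation R K).

Definition valn_int : {pred K} := fun x => (0 <= v x)%E.

Fact valn_int_subring : subring_closed valn_int.
Proof.
split=> [|x y|x y]; rewrite ?unfold_in; first by rewrite valn1.
  by move=> xp yp; apply: valn_le_add; rewrite ?valnN.
by move=> xp yp; rewrite valnM; apply: adde_ge0.
Qed.
HB.instance Definition _ := GRing.isSubringClosed.Build K valn_int valn_int_subring.

Record integer := Integer { integer_val :> K; _ : integer_val \in valn_int }.
HB.instance Definition _ := [isSub for integer_val].
HB.instance Definition _ := [Choice of integer by <:].
HB.instance Definition _ := [SubChoice_isSubComNzRing of integer by <:].

Definition max_ideal : {pred integer} := fun x => (0 < v (val x))%E.

Fact max_ideal_closed : idealr_closed max_ideal.
Proof.
split; rewrite ?unfold_in /=; first by rewrite valn0 ltry.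
  by rewrite valn1 ltxx.
move=> a x y; rewrite !unfold_in /= => xp yp.
apply: lt_le_trans (valnD v _ _); rewrite lt_min yp andbT valnM.
apply: (lt_le_trans xp); have := valP a; rewrite unfold_in.
by move=> ap; rewrite leeDr.
Qed.
HB.instance Definition _ := isIdealr.Build integer max_ideal max_ideal_closed.

Definition residue_field : Type := {ideal_quot max_ideal}.
HB.instance Definition _ := GRing.ComNzRing.on residue_field.
HB.instance Definition _ := EqQuotient.on residue_field.

(* The class of x when 0 <= v x, and the junk value 0 otherwise. *)
Definition residue (x : K) : residue_field := \pi_residue_field (insubd 0 x).

Definition residue_inv (x : residue_field) : residue_field :=
  if x == 0 then 0 else residue (val (repr x))^-1.

Fact residue_mulVf x : x != 0 -> residue_inv x * x = 1.
Proof.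
move=> x0; rewrite /residue_inv (negPf x0); move: x0.
rewrite -{1 3}[x]reprK; set a := repr x => a0.
have va : v (val a) = 0%E.
  apply/eqP; rewrite eq_le; have := valP a; rewrite unfold_in => ->.
  rewrite andbT leNgt; apply: contra a0 => pa.
  have : a - 0 \in max_ideal by rewrite subr0.
  rewrite Quotient.idealrBE => /eqP ->.
  by rewrite -[X in _ == X](rmorph0 \pi_residue_field).
have a00 : val a != 0.
  by apply/eqP => /(valn_pinfty v); rewrite va.
have ia : (val a)^-1 \in valn_int by rewrite unfold_in valnV // va oppe0.
rewrite /residue -rmorphM /= -(rmorph1 \pi_residue_field).
by congr (\pi _); apply: val_inj; rewrite /= insubdK // mulVf.
Qed.

Fact residue_inv0 : residue_inv 0 = 0.
Proof. by rewrite /residue_inv eqxx. Qed.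

HB.instance Definition _ :=
  GRing.ComNzRing_isField.Build residue_field residue_mulVf residue_inv0.

End ResidueField.

(* A point set embedded in a closed polydisc by finitely many functions [gen i],
   the i-th of which takes values in the disc v >= wgt i.  It stands for a
   reduced affinoid when the image of [pts] is the whole common zero locus in
   that polydisc of some ideal of its Tate algebra. *)
Record polydisc_subset (R : realType) (K : fieldType) (v : valuation R K) :=
  PolydiscSubset {
    pts : Type;
    ngen : nat;
    gen : 'I_ngen -> pts -> K;
    wgt : 'I_ngen -> R;
    wgtP : forall i P, ((wgt i)%:E <= v (gen i P))%E
  }.

Section Affinoid.
Variables (R : realType) (K : fieldType) (v : valuation R K).
Variable Y : polydisc_subset v.
Local Notation n := (ngen Y).
Local Notation point := (pts Y).
Implicit Types (f g : point -> K) (a b : 'X_{1..n} -> K) (B : R).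

(* Valuation of the monomial with exponent m on the boundary of the polydisc. *)
Definition mwgt (m : 'X_{1..n}) : R := \sum_(i < n) wgt i *+ m i.

Definition tate_null a : Prop :=
  forall B, exists N : nat, forall m, (N <= mdeg m)%N ->
    (B%:E <= v (a m) + (mwgt m)%:E)%E.

Definition tate_ge B a : Prop :=
  forall m, (B%:E <= v (a m) + (mwgt m)%:E)%E.

Definition tate_psum a (N : nat) (P : point) : K :=
  \sum_(m : 'X_{1..n < N}) a m * \prod_(i < n) gen i P ^+ m i.

(* f is the restriction to Y of an element of the Tate algebra of the polydisc
   whose Gauss norm is at most exp(- B).  Letting B vary, these sets are a basis
   of neighbourhoods of 0 for the residue topology of the affinoid algebra. *)
Definition analytic_ge B f : Prop :=
  exists a, [/\ tate_null a, tate_ge B a &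
    forall P, valn_cvg v (fun N => tate_psum a N P) (f P)].

Definition analytic f : Prop := exists B, analytic_ge B f.

Definition power_bounded f : Prop :=
  analytic f /\ exists B, forall k : nat, analytic_ge B (f ^+ k).

Definition top_nilpotent f : Prop :=
  analytic f /\
  forall B, exists N : nat, forall k, (N <= k)%N -> analytic_ge B (f ^+ k).

Definition gauss_ge B (p : {mpoly K[n]}) : Prop := tate_ge B (fun m => p@_m).

Lemma mwgtD m1 m2 : mwgt (m1 + m2)%MM = mwgt m1 + mwgt m2.
Proof.
by rewrite /mwgt -big_split; apply: eq_bigr => i _; rewrite /= mnmDE mulrnDr.
Qed.

Lemma valn_monom m P : ((mwgt m)%:E <= v (\prod_(i < n) gen i P ^+ m i)%R)%E.
Proof.
rewrite /mwgt; apply: (big_ind2 (fun (r : R) x => (r%:E <= v x)%E)).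
- by rewrite valn1.
- by move=> r x s y rx sy; rewrite valnM EFinD; apply: leeD.
move=> i _; elim: (m i) => [|k IH]; first by rewrite mulr0n expr0 valn1.
by rewrite mulrSr exprSr valnM EFinD; apply: leeD => //; apply: wgtP.
Qed.

Lemma gauss_ge_eval B p P : gauss_ge B p -> (B%:E <= v p.@[fun i => gen i P])%E.
Proof.
move=> pB; rewrite mevalE; apply: valn_le_sum => m _.
by rewrite valnM; apply: le_trans (pB m) _; apply: leeD => //; apply: valn_monom.
Qed.

Definition tate_trunc a (N : nat) : {mpoly K[n]} :=
  \sum_(m : 'X_{1..n < N}) a m *: 'X_[m].

Lemma tate_psumE a N P : tate_psum a N P = (tate_trunc a N).@[fun i => gen i P].
Proof.
rewrite /tate_psum /tate_trunc raddf_sum; apply: eq_bigr => m _ /=.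
by rewrite mevalZ mevalX.
Qed.

Lemma tate_truncE a N m : (tate_trunc a N)@_m = if (mdeg m < N)%N then a m else 0.
Proof.
case: ifP => mN; first by rewrite /tate_trunc mcoeff_mpoly.
rewrite /tate_trunc raddf_sum big1 //= => k _; rewrite mcoeffZ mcoeffX.
case: eqP => [km|]; last by rewrite mulr0.
by move: mN; rewrite -km bmdeg.
Qed.

Lemma gauss_ge_trunc B a N : tate_ge B a -> gauss_ge B (tate_trunc a N).
Proof.
move=> aB m; rewrite tate_truncE; case: ifP => _; first exact: aB.
by rewrite valn0 addye // leey.
Qed.

Definition tate_mul a b : 'X_{1..n} -> K := fun m =>
  (tate_trunc a (mdeg m).+1 * tate_trunc b (mdeg m).+1)@_m.

Lemma tate_mulE a b m N : (mdeg m < N)%N ->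
  (tate_trunc a N * tate_trunc b N)@_m = tate_mul a b m.
Proof.
move=> mN; rewrite /tate_mul !(mcoeff_poly_mul _ _ (ltnSn (mdeg m))).
apply: eq_bigr => k _; rewrite !tate_truncE !bmdeg.
by rewrite !(leq_trans (bmdeg _) mN).
Qed.

Lemma tate_mul_ge (A B : R) p q m :
  (forall k1 k2, m = (k1 + k2)%MM ->
    (A%:E <= v p@_k1 + (mwgt k1)%:E)%E /\ (B%:E <= v q@_k2 + (mwgt k2)%:E)%E) ->
  ((A + B)%:E <= v (p * q)@_m + (mwgt m)%:E)%E.
Proof.
move=> pq; rewrite -leeBlDr // mcoeffM; apply: valn_le_sum => k /eqP mk.
rewrite leeBlDr // (congr1 mwgt mk) mwgtD valnM !EFinD addeACA; have [pA qB] := pq _ _ mk.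
exact: leeD.
Qed.

Lemma tate_mul_null a b (A B C : R) (N : nat) m p q :
  tate_ge A a -> tate_ge B b ->
  (forall k, (N <= mdeg k)%N -> ((C - B)%:E <= v (a k) + (mwgt k)%:E)%E) ->
  (forall k, (N <= mdeg k)%N -> ((C - A)%:E <= v (b k) + (mwgt k)%:E)%E) ->
  (N.*2 <= mdeg m)%N ->
  (C%:E <= v (tate_trunc a p * tate_trunc b q)%R@_m + (mwgt m)%:E)%E.
Proof.
move=> aA bB aN bN mN; rewrite mcoeffM -leeBlDr //; apply: valn_le_sum => k /eqP mk.
rewrite leeBlDr // (congr1 mwgt mk) mwgtD valnM !EFinD addeACA.
have [k1N|k1N] := leqP N (mdeg k.1).
  rewrite -(subrK B C) EFinD; apply: leeD.
    rewrite tate_truncE; case: ifP => _; first exact: aN.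
    by rewrite valn0 addye // leey.
  exact: gauss_ge_trunc.
have k2N : (N <= mdeg k.2)%N.
  have mE := congr1 mdeg mk; rewrite mdegD in mE.
  rewrite leqNgt; apply/negP => k2N.
  have : (mdeg m < N.*2)%N by rewrite mE -addnn; apply: leq_add k1N (ltnW k2N).
  by rewrite ltnNge mN.
rewrite -(subrKC A C) EFinD; apply: leeD; first exact: gauss_ge_trunc.
rewrite tate_truncE; case: ifP => _; first exact: bN.
by rewrite valn0 addye // leey.
Qed.

Lemma analytic_ge_bound B f P : analytic_ge B f -> (B%:E <= v (f P))%E.
Proof.
case=> a [_ aB af]; have [N /(_ N (leqnn N))] := af P B.
set s := tate_psum _ _ _ => sf.
rewrite -[f P](subKr s); apply: valn_le_add; last by rewrite valnN.
by rewrite /s tate_psumE; apply: gauss_ge_eval; apply: gauss_ge_trunc.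
Qed.

Lemma analytic_geW A B f : A <= B -> analytic_ge B f -> analytic_ge A f.
Proof.
move=> AB [a [a0 aB af]]; exists a; split=> // m.
by apply: le_trans (aB m); rewrite lee_fin.
Qed.

Lemma analytic_ge0 B : analytic_ge B 0.
Proof.
exists (fun=> 0); split=> [A|m|P A]; try exists 0%N => m _.
- by rewrite valn0 addye // leey.
- by rewrite valn0 addye // leey.
- by rewrite /tate_psum big1 ?subrr ?valn0 ?leey // => i _; rewrite mul0r.
Qed.

Lemma analytic_ge_cst B (c : K) : (B%:E <= v c)%E -> analytic_ge B (fun=> c).
Proof.
move=> cB; pose a (m : 'X_{1..n}) : K := if m == 0%MM then c else 0; exists a; split.
- move=> A; exists 1%N => m; rewrite lt0n mdeg_eq0 /a => /negPf ->.
  by rewrite valn0 addye // leey.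
- move=> m; rewrite /a; case: eqP => [->|_]; last by rewrite valn0 addye // leey.
  by rewrite /mwgt big1 ?adde0 // => i _; rewrite mnm0E mulr0n.
move=> P A; exists 1%N => -[//|N] _; rewrite tate_psumE.
suff -> : tate_trunc a N.+1 = c%:MP by rewrite mevalC subrr valn0 leey.
apply/mpolyP => m; rewrite tate_truncE mcoeffC /a.
case: ifP => mN; first by case: eqP => _; rewrite ?mulr1 ?mulr0.
by case: eqP mN => [->|_]; rewrite ?mdeg0 ?mulr0.
Qed.

Lemma analytic_geD B f g :
  analytic_ge B f -> analytic_ge B g -> analytic_ge B (f + g).
Proof.
move=> [a [a0 aB af]] [b [b0 bB bg]]; exists (fun m => a m + b m).
have dist m A : (A%:E <= v (a m) + (mwgt m)%:E)%E ->
    (A%:E <= v (b m) + (mwgt m)%:E)%E ->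
    (A%:E <= v (a m + b m)%R + (mwgt m)%:E)%E.
  by rewrite -!leeBlDr //; apply: valn_le_add.
split=> [A|m|P A]; last 1 first.
- have [N1 aN] := af P A; have [N2 bN] := bg P A.
  exists (maxn N1 N2) => N; rewrite geq_max => /andP[/aN aN' /bN bN'].
  rewrite (_ : _ - _ = tate_psum a N P - f P + (tate_psum b N P - g P)).
    exact: valn_le_add.
  rewrite addrACA -opprD; congr (_ - _); rewrite /tate_psum -big_split.
  by apply: eq_bigr => m _; rewrite mulrDl.
- have [N1 aN] := a0 A; have [N2 bN] := b0 A; exists (maxn N1 N2) => m.
  by rewrite geq_max => /andP[/aN aN' /bN bN']; apply: dist.
- exact: dist.
Qed.

Lemma valn_cvgM (u w : nat -> K) x y :
  valn_cvg v u x -> valn_cvg v w y -> valn_cvg v (fun k => u k * w k) (x * y).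
Proof.
have bnd z : exists r : R, (r%:E <= v z)%E.
  case E: (v z) => [r||]; first by exists r.
    by exists 0; rewrite leey.
  by case: (valn_ninfty E).
move=> ux wy B; have [r xr] := bnd x; have [s ys] := bnd y.
have [N1 uN] := ux (B - s); have [N1' uN'] := ux 0.
have [N2 wN] := wy B; have [N2' wN'] := wy (B - r).
exists (maxn (maxn N1 N1') (maxn N2 N2')) => k; rewrite !geq_max.
move=> /andP[/andP[/uN u1 /uN' u2] /andP[/wN w1 /wN' w2]].
rewrite (_ : _ - _ = (u k - x) * (w k - y) + x * (w k - y) + (u k - x) * y); last first.
  by rewrite -mulrDl subrK mulrBr mulrBl addrA subrK.
apply: valn_le_add; [apply: valn_le_add|]; rewrite valnM.
- by rewrite -[B]add0r EFinD; apply: leeD.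
- by rewrite -(subrKC r B) EFinD; apply: leeD.
- by rewrite -(subrK s B) EFinD; apply: leeD.
Qed.

Lemma analytic_geM A B f g :
  analytic_ge A f -> analytic_ge B g -> analytic_ge (A + B) (f * g).
Proof.
move=> [a [a0 aA af]] [b [b0 bB bg]]; exists (tate_mul a b); split.
- move=> C; have [N1 aN] := a0 (C - B); have [N2 bN] := b0 (C - A).
  exists (maxn N1 N2).*2 => m mN; rewrite /tate_mul.
  apply: (tate_mul_null _ _ (N := maxn N1 N2) aA bB) => //.
    by move=> k; rewrite geq_max => /andP[/aN].
  by move=> k; rewrite geq_max => /andP[_ /bN].
- by move=> m; apply: tate_mul_ge => k1 k2 _; split; apply: gauss_ge_trunc.
move=> P C; have [N1 fN] := valn_cvgM (af P) (bg P) C.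
have [N2 aN] := a0 (C - B); have [N3 bN] := b0 (C - A).
exists (maxn N1 (maxn N2 N3).*2) => N; rewrite geq_max => /andP[N1N N2N].
rewrite -[_ - _](subrKA (tate_psum a N P * tate_psum b N P)) addrC.
apply: valn_le_add; first exact: fN.
rewrite !tate_psumE -mevalM -mevalB; apply: gauss_ge_eval => m.
rewrite mcoeffB tate_truncE; case: ifP => mN.
  by rewrite (tate_mulE _ _ mN) subrr valn0 addye // leey.
rewrite sub0r valnN; apply: (tate_mul_null _ _ (N := maxn N2 N3) aA bB).
- by move=> k; rewrite geq_max => /andP[/aN].
- by move=> k; rewrite geq_max => /andP[_ /bN].
by apply: leq_trans N2N _; rewrite leqNgt mN.
Qed.

Lemma analytic_geMn B f k : analytic_ge B f -> analytic_ge B (f *+ k).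
Proof.
move=> fB; elim: k => [|k IH]; first exact: analytic_ge0.
by rewrite mulrS; apply: analytic_geD.
Qed.

Lemma analytic_ge_sum B I (s : seq I) (P : pred I) (F : I -> point -> K) :
  (forall i, P i -> analytic_ge B (F i)) ->
  analytic_ge B (\sum_(i <- s | P i) F i).
Proof.
move=> FB; apply: (big_ind (analytic_ge B)) => //; first exact: analytic_ge0.
by move=> f g; apply: analytic_geD.
Qed.

Lemma analytic_ge1 : analytic_ge 0 1.
Proof. by apply: analytic_ge_cst; rewrite valn1. Qed.

Lemma analytic_geN B f : analytic_ge B f -> analytic_ge B (- f).
Proof.
move=> fB; rewrite -[- f]mulN1r -[B]add0r; apply: analytic_geM => //.
rewrite (_ : - 1 = fun=> -1)//.
by apply: analytic_ge_cst; rewrite valnN valn1.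
Qed.

Lemma analyticD f g : analytic f -> analytic g -> analytic (f + g).
Proof.
move=> [A fA] [B gB]; exists (Order.min A B).
apply: analytic_geD; [apply: analytic_geW fA|apply: analytic_geW gB];
by rewrite ge_min lexx ?orbT.
Qed.

Lemma analyticM f g : analytic f -> analytic g -> analytic (f * g).
Proof. by move=> [A fA] [B gB]; exists (A + B); apply: analytic_geM. Qed.

Lemma power_boundedD f g :
  power_bounded f -> power_bounded g -> power_bounded (f + g).
Proof.
move=> [fa [A fA]] [ga [B gB]]; split; first exact: analyticD.
exists (A + B) => k; rewrite exprDn; apply: analytic_ge_sum => i _.
by apply: analytic_geMn; apply: analytic_geM.
Qed.

Lemma power_boundedM f g :
  power_bounded f -> power_bounded g -> power_bounded (f * g).
Proof.
move=> [fa [A fA]] [ga [B gB]]; split; first exact: analyticM.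
by exists (A + B) => k; rewrite exprMn; apply: analytic_geM.
Qed.

Lemma power_boundedN f : power_bounded f -> power_bounded (- f).
Proof.
move=> [[C fC] [A fA]]; split; first by exists C; apply: analytic_geN.
exists A => k; rewrite exprNn; case: (boolP (odd k)) => ko.
  by rewrite -signr_odd ko expr1 mulN1r; apply: analytic_geN.
by rewrite -signr_odd (negPf ko) expr0 mul1r.
Qed.

Lemma power_bounded_cst (c : K) : (0 <= v c)%E -> power_bounded (fun=> c).
Proof.
move=> c0; split; first by exists 0; apply: analytic_ge_cst.
exists 0 => k; elim: k => [|k IH]; first exact: analytic_ge1.
by rewrite exprS -[0]add0r; apply: analytic_geM => //; apply: analytic_ge_cst.
Qed.

Lemma top_nilpotent_power_bounded f : top_nilpotent f -> power_bounded f.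
Proof.
move=> [[A fA] fn]; split; first by exists A.
have [N fN] := fn 0.
suff [B fB] : exists B, forall k, (k < N)%N -> analytic_ge B (f ^+ k).
  exists (Order.min B 0) => k; have [kN|/fN] := ltnP k N.
    by apply: analytic_geW (fB k kN); rewrite ge_min lexx.
  by apply: analytic_geW; rewrite ge_min lexx orbT.
elim: N {fN} => [|N [B IH]]; first by exists 0.
suff [C fC] : exists C, analytic_ge C (f ^+ N).
  exists (Order.min B C) => k; rewrite ltnS leq_eqVlt => /orP[/eqP ->|/IH].
    by apply: analytic_geW fC; rewrite ge_min lexx orbT.
  by apply: analytic_geW; rewrite ge_min lexx.
elim: N {B IH} => [|N [C IH]]; first by exists 0; apply: analytic_ge1.
by exists (A + C); rewrite exprS; apply: analytic_geM.
Qed.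

Lemma top_nilpotentD f g :
  top_nilpotent f -> top_nilpotent g -> top_nilpotent (f + g).
Proof.
move=> ft gt; have [_ [A fA]] := top_nilpotent_power_bounded ft.
have [_ [B gB]] := top_nilpotent_power_bounded gt.
have [[fa fn] [ga gn]] := (ft, gt); split; first exact: analyticD.
move=> C; have [N1 fN] := fn (C - B); have [N2 gN] := gn (C - A).
exists (N1 + N2)%N => k Nk; rewrite exprDn; apply: analytic_ge_sum => i _.
apply: analytic_geMn; have [iN|iN] := leqP N2 i.
  by rewrite -(subrKC A C); apply: analytic_geM => //; apply: gN.
rewrite -(subrK B C); apply: analytic_geM => //; apply: fN.
by rewrite leq_subRL; [rewrite addnC (leq_trans _ Nk) // leq_add2l ltnW|
  rewrite -ltnS].
Qed.

Lemma top_nilpotentMl f g :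
  power_bounded f -> top_nilpotent g -> top_nilpotent (f * g).
Proof.
move=> [fa [A fA]] [ga gn]; split; first exact: analyticM.
move=> C; have [N gN] := gn (C - A); exists N => k Nk.
by rewrite exprMn -(subrKC A C); apply: analytic_geM => //; apply: gN.
Qed.

Definition pb_pred : {pred (point -> K)} := fun f => `[< power_bounded f >].

Fact pb_pred_subring : subring_closed pb_pred.
Proof.
split=> [|f g /asboolP fp /asboolP gp|f g /asboolP fp /asboolP gp]; apply/asboolP.
- by apply: power_bounded_cst; rewrite valn1.
- by apply: power_boundedD => //; apply: power_boundedN.
- exact: power_boundedM.
Qed.
HB.instance Definition _ := GRing.isSubringClosed.Build _ pb_pred pb_pred_subring.

Record pb_fun := PbFun { pb_val :> point -> K; _ : pb_val \in pb_pred }.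
HB.instance Definition _ := [isSub for pb_val].
HB.instance Definition _ := [Choice of pb_fun by <:].
HB.instance Definition _ :=
  GRing.SubChoice_isSubComPzRing.Build _ _ pb_fun pb_pred_subring.

Definition tn_pred : {pred pb_fun} := fun f : pb_fun => `[< top_nilpotent (val f) >].

Lemma tn_predM (f g : pb_fun) : g \in tn_pred -> f * g \in tn_pred.
Proof.
move=> /asboolP gt; apply/asboolP; rewrite rmorphM.
by apply: top_nilpotentMl => //; apply/asboolP; apply: (valP f).
Qed.

Fact tn_pred_zmod : zmod_closed tn_pred.
Proof.
split=> [|f g /asboolP fp /[dup] gt /asboolP gp].
  apply/asboolP; rewrite rmorph0; split; first by exists 0; apply: analytic_ge0.
  by move=> B; exists 1%N => -[//|k] _; rewrite exprS mul0r; apply: analytic_ge0.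
apply/asboolP; rewrite rmorphB; apply: top_nilpotentD => //.
by have /asboolP := tn_predM (-1) gt; rewrite mulN1r rmorphN.
Qed.
HB.instance Definition _ := GRing.isZmodClosed.Build pb_fun tn_pred tn_pred_zmod.

(* The library makes a quotient by an ideal a ring only for proper ideals of
   nontrivial rings; the same construction is carried out here without knowing
   in advance that Y is nonempty. *)
Definition reduction : Type := {ideal_quot tn_pred}.
HB.instance Definition _ := GRing.Zmodule.on reduction.
HB.instance Definition _ := EqQuotient.on reduction.

Definition reduction_one : reduction := \pi_reduction (1 : pb_fun).
Definition reduction_mul (x y : reduction) : reduction :=
  \pi_reduction (repr x * repr y).

Lemma reduction_eqP (f g : pb_fun) :
  reflect (\pi_reduction f = \pi_reduction g) (f - g \in tn_pred).
Proof. by rewrite Quotient.idealrBE; apply: eqP. Qed.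

Fact pi_reductionM : {morph \pi_reduction : f g / f * g >-> reduction_mul f g}.
Proof.
move=> f g; apply/reduction_eqP.
set f' := repr _; set g' := repr _.
have ff' : f - f' \in tn_pred by apply/reduction_eqP; rewrite reprK.
have gg' : g - g' \in tn_pred by apply/reduction_eqP; rewrite reprK.
have -> : f * g - f' * g' = g * (f - f') + f' * (g - g').
  by rewrite !mulrBr addrA [g * f' ]mulrC subrK mulrC.
by apply: rpredD; apply: tn_predM.
Qed.

Fact reduction_mulA : associative reduction_mul.
Proof.
elim/quotW => f; elim/quotW => g; elim/quotW => h.
by rewrite -(pi_reductionM g h) -(pi_reductionM f g) -!pi_reductionM mulrA.
Qed.
Fact reduction_mulC : commutative reduction_mul.
Proof. by move=> x y; rewrite /reduction_mul mulrC. Qed.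
Fact reduction_mul1 : left_id reduction_one reduction_mul.
Proof. by elim/quotW => f; rewrite -(pi_reductionM 1 f) mul1r. Qed.
Fact reduction_mulDl : left_distributive reduction_mul +%R.
Proof.
elim/quotW => f; elim/quotW => g; elim/quotW => h.
rewrite -(pi_reductionM f h) -(pi_reductionM g h) -!(raddfD \pi_reduction).
by rewrite -(pi_reductionM (f + g) h) mulrDl.
Qed.
HB.instance Definition _ := GRing.Zmodule_isComPzRing.Build reduction
  reduction_mulA reduction_mulC reduction_mul1 reduction_mulDl.

(* The class of f when f is power-bounded, and the junk value 0 otherwise. *)
Definition reduce f : reduction := \pi_reduction (insubd 0 f).

(* The structure map making the reduction an algebra over the residue field. *)
Definition reduction_scalar (c : residue_field v) : reduction :=
  reduce (fun=> val (repr c)).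

(* The reduction of the point P: the morphism from the reduction to the residue
   field sending the class of f to the class of f P. *)
Definition reduced_point (P : point) (h : reduction) : residue_field v :=
  residue v (val (repr h) P).

End Affinoid.

Section Presentation.
Variables (R : realType) (K : fieldType) (v : valuation R K).
Variable Y : polydisc_subset v.

(* The reduction is k[x, y] / (G), k the residue field, with coordinates
   x and y; k[x, y] is {poly {poly k}}, where x is the inner variable. *)
Definition plane_presentation (x y : reduction Y)
    (G : {poly {poly residue_field v}}) : Prop :=
  exists Phi : {rmorphism {poly {poly residue_field v}} -> reduction Y},
    [/\ forall c, Phi c%:P%:P = reduction_scalar Y c,
        Phi 'X%:P = x,
        Phi 'X = y,
        forall h, exists p, Phi p = h
      & forall p, Phi p = 0 <-> exists r, p = r * G].

End Presentation.

Section LocalField.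
Variables (R : realType) (F : fieldType).

(* F is complete for a valuation with value group Z, normalized by pi, and has
   characteristic p and residue field with q elements. *)
Definition local_field (p q : nat) (v : valuation R F) (pi : F) : Prop :=
  [/\ prime p, p \in [pchar F],
      valn_complete v,
      v pi = 1%E /\ (forall a, a != 0 -> exists z : int, v a = (z%:~R)%:E)
    & ([set: residue_field v] #= `I_q)%card].

Variables (C : closedFieldType) (iota : {rmorphism F -> C}).
Variable v : valuation R C.

Definition completed_algebraic_closure : Prop :=
  valn_complete v /\
  forall (z : C) (B : R),
    exists w, algebraicOver iota w /\ (B%:E <= v (z - w)%R)%E.

(* The maximal unramified extension inside C: the union of the finite extensions
   of F with ramification index 1.  The residue field of F being finite, residue
   extensions are automatically separable. *)
Definition maximal_unramified (z : C) : Prop :=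
  exists (L : fieldExtType F) (j : {rmorphism L -> C}),
    [/\ forall a : F, j a%:A = iota a,
        forall x : L, x != 0 -> exists a : F, v (j x) = v (iota a)
      & exists x : L, j x = z].

Definition inertia (sigma : {rmorphism C -> C}) : Prop :=
  [/\ bijective sigma, valn_continuous v sigma
    & forall z, maximal_unramified z -> sigma z = z].

End LocalField.

Section LubinTate.
Variables (C : fieldType) (q : nat) (pi : C).

Definition lt_pi (x : C) : C := pi * x - x ^+ q.

Definition lt_generator (x : C) : Prop :=
  lt_pi (lt_pi x) = 0 /\ lt_pi x <> 0.

Definition pi_u (u x : C) : C := x ^+ (q ^ 2) + u * x ^+ q + pi * x.

Record triple := Triple { tu : C; tX2 : C; tY2 : C }.

Definition tX1 (P : triple) : C := pi_u (tu P) (tX2 P).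
Definition tY1 (P : triple) : C := pi_u (tu P) (tY2 P).

Definition mu2 (P : triple) : C :=
  tX1 P * tY2 P ^+ q - tX1 P ^+ q * tY2 P
  - tX2 P ^+ q * tY1 P + tX2 P * tY1 P ^+ q.

Definition map_triple (sigma : C -> C) (P : triple) : triple :=
  Triple (sigma (tu P)) (sigma (tX2 P)) (sigma (tY2 P)).

Variables (R : realType) (v : valuation R C) (pi2 : C).

Definition lt_curve (P : triple) : Prop :=
  [/\ (0 < v (tu P))%E,
      pi_u (tu P) (pi_u (tu P) (tX2 P)) = 0,
      pi_u (tu P) (pi_u (tu P) (tY2 P)) = 0
    & mu2 P = pi2].

Let Q : R := q%:R.

Definition in_Y31e1 (P : triple) : Prop :=
  lt_curve P /\
  [/\ v (tu P) = (1 / (Q + 1))%:E,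
      v (tX1 P) = (Q / (Q ^+ 2 - 1))%:E,
      v (tX2 P) = (1 / (Q * (Q ^+ 2 - 1)))%:E,
      v (tY1 P) = (1 / (Q * (Q ^+ 2 - 1)))%:E
    & v (tY2 P) = (1 / (Q ^+ 3 * (Q ^+ 2 - 1)))%:E].

Definition Y31e1_point : Type := {P : triple | in_Y31e1 P}.

(* Each condition v(h) = r is encoded, as usual, by the two generators h of
   weight r and 1/h of weight - r. *)
Definition Y31e1_functions (P : triple) : seq C :=
  [:: tu P; tX1 P; tX2 P; tY1 P; tY2 P].
Definition Y31e1_valuations : seq R :=
  [:: 1 / (Q + 1); Q / (Q ^+ 2 - 1); 1 / (Q * (Q ^+ 2 - 1));
      1 / (Q * (Q ^+ 2 - 1)); 1 / (Q ^+ 3 * (Q ^+ 2 - 1))].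

Definition Y31e1_gen (i : 'I_10) (P : Y31e1_point) : C :=
  let h := Y31e1_functions (sval P) in (h ++ [seq z^-1 | z <- h])`_i.
Definition Y31e1_wgt (i : 'I_10) : R :=
  let r := Y31e1_valuations in (r ++ [seq - x | x <- r])`_i.

Fact Y31e1_wgtP i P : ((Y31e1_wgt i)%:E <= v (Y31e1_gen i P))%E.
Proof.
have inv (z : C) (r : R) : v z = r%:E -> ((- r)%:E <= v (z^-1)%R)%E.
  move=> zr; have z0 : z != 0 by apply/eqP => /(valn_pinfty v); rewrite zr.
  by rewrite valnV // zr.
case: P => P /= HP; rewrite /Y31e1_gen /Y31e1_wgt /=.
case: HP => _ [u_ X1_ X2_ Y1_ Y2_].
case: i => [[|[|[|[|[|[|[|[|[|[|i]]]]]]]]]] //= _];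
  first [by rewrite ?u_ ?X1_ ?X2_ ?Y1_ ?Y2_ | exact: inv].
Qed.

Definition Y31e1 : polydisc_subset v := PolydiscSubset Y31e1_wgtP.

Definition x_coord (alpha : C) (P : pts Y31e1) : C :=
  tX2 (sval P) / alpha ^+ (q ^ 2).
Definition y_coord (alpha : C) (P : pts Y31e1) : C := tY2 (sval P) / alpha.

(* P' = P^sigma, that is, sigma maps P' to P. *)
Definition point_conj (sigma : C -> C) (P P' : pts Y31e1) : Prop :=
  map_triple sigma (sval P') = sval P.

(* g = f^sigma: sigma acts on the coefficients of f and fixes the coordinates. *)
Definition function_conj (sigma : C -> C) (f g : pts Y31e1 -> C) : Prop :=
  forall P P', point_conj sigma P P' -> g P = sigma (f P').

(* tau is the comorphism of the endomorphism of the reduction that sends the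
   reduction of P to the reduction of P^sigma; it sends the class of f to the
   class of f^sigma. *)
Definition reduction_action (sigma : C -> C)
    (tau : {rmorphism reduction Y31e1 -> reduction Y31e1}) : Prop :=
  [/\ forall P, exists P', point_conj sigma P P',
      forall P P', point_conj sigma P P' ->
        forall h, reduced_point P (tau h) = reduced_point P' h
    & forall f, power_bounded f ->
        exists g, [/\ power_bounded g, function_conj sigma f g
                    & tau (reduce f) = reduce g]].

Definition reduced_equation : {poly {poly residue_field v}} :=
  - ('X%:P) ^+ q * 'X ^+ (q ^ 2) + 'X%:P * 'X ^+ (q ^ 3) - 1.

End LubinTate.

(* Main.v *)
From HB Require Import structures.
From mathcomp Require Import all_boot all_order all_algebra all_field.
From mathcomp Require Import mpoly finmap.
From mathcomp Require Import boolp classical_sets functions cardinality.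
From mathcomp Require Import reals constructive_ereal.
From mathcomp Require Import ring lra zify.
Require Import Defs.

(** Dividing each coordinate by the power of alpha of the same valuation gives
    units U, A, x, B, y proportional to u, X1, X2, Y1, Y2. Modulo alpha the torsion
    equations and the equation mu2 = pi2 become
      U A^(q-1) = -1,  U = - B^(q^2-q),  A = x^(q^2) + U x^q,  B = y^(q^2),
      - x^q B + x B^q = 1.
    They express all the generators of the affinoid algebra, and their inverses,
    as polynomials in x and y, and the last one becomes the equation of the reduced
    curve. So every function with an expansion of norm at most 1 is a polynomial in
    x and y modulo alpha (approx_all).

    To conclude that the reduction is the coordinate ring of the curve, one has to
    know that power-bounded functions have expansions of norm at most 1
    (sup_norm_ge0) and that a polynomial in x and y is topologically nilpotent only
    if its reduction is a multiple of the equation (evalf_nilpotent). Both follow by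
    evaluating at points, from two facts.
    - Every point of the reduced curve is the reduction of a point of the affinoid
      (lift_point). Approximate roots of polynomials over C are near exact ones, and
      this gives X2, Y2 with mu2 close to pi2. Now mu2 takes values in the torsion of
      the Lubin-Tate group (mu2_torsion), so the error is a pi-torsion point, and
      adding a suitable multiple of Y1 to Y2 removes it (correct_mu2).
    - A polynomial of degree less than q in x that vanishes on the curve is zero,
      because the equation is separable of degree q in x for each nonzero y
      (small_vanish); and modulo the curve, where y is invertible, every polynomial
      can be brought to this form.

    An inertia element sigma preserves the valuation (inertia_val) and acts trivially
    on the residue field (inertia_residue): an integral element is congruent to an
    algebraic one, hence to 0 or to a root of unity of order prime to p, and the latter
    generates an unramified extension of F. Therefore the map sending f to f^sigma
    induces an endomorphism of the reduction that fixes the scalars and is compatible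
    with the action on points. It multiplies x = X2 / alpha^(q^2) by zeta^(-q^2) and
    y = Y2 / alpha by zeta^(-1), as only the denominators move. *)

Set Implicit Arguments.
Unset Strict Implicit.
Unset Printing Implicit Defensive.

Import Order.TTheory GRing.Theory Num.Theory.
Local Open Scope ring_scope.
Local Open Scope quotient_scope.

(** * Valuations and residues *)

Section Valuation.
Variables (R : realType) (K : fieldType) (v : valuation R K).
Implicit Types (x y : K) (r s : R).

Lemma valn_neq0 x r : v x = r%:E -> x != 0.
Proof. by move=> xr; apply/eqP => /(valn_pinfty v); rewrite xr. Qed.

Lemma valnE x : x != 0 -> exists r, v x = r%:E.
Proof. by move/(valn_fin v); case: (v x) => [r||] // _; exists r. Qed.

Lemma valnM_fin x y r s : v x = r%:E -> v y = s%:E -> v (x * y) = (r + s)%:E.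
Proof. by move=> xr ys; rewrite valnM xr ys. Qed.

Lemma valnX_fin x r n : v x = r%:E -> v (x ^+ n) = (r *+ n)%:E.
Proof.
move=> xr; elim: n => [|n IH]; first by rewrite expr0 mulr0n valn1.
by rewrite exprS mulrS; apply: valnM_fin.
Qed.

Lemma valnV_fin x r : v x = r%:E -> v x^-1 = (- r)%:E.
Proof. by move=> xr; rewrite valnV ?xr // (valn_neq0 xr). Qed.

Lemma valnM_ge x y r s :
  (r%:E <= v x)%E -> (s%:E <= v y)%E -> ((r + s)%:E <= v (x * y)%R)%E.
Proof. by move=> rx sy; rewrite valnM EFinD; apply: leeD. Qed.

Lemma valnX_ge x r n : (r%:E <= v x)%E -> ((r *+ n)%:E <= v (x ^+ n)%R)%E.
Proof.
move=> rx; elim: n => [|n IH]; first by rewrite expr0 mulr0n valn1.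
by rewrite exprS mulrS; apply: valnM_ge.
Qed.

Lemma valnX_ge0 x n : (0 <= v x)%E -> (0 <= v (x ^+ n)%R)%E.
Proof. by move/(@valnX_ge x 0 n); rewrite mul0rn. Qed.

Lemma valnM_ge0 x y : (0 <= v x)%E -> (0 <= v y)%E -> (0 <= v (x * y)%R)%E.
Proof. by move=> rx sy; rewrite valnM adde_ge0. Qed.

Lemma valnB_ge (r : \bar R) x y :
  (r <= v x)%E -> (r <= v y)%E -> (r <= v (x - y)%R)%E.
Proof. by move=> rx ry; apply: valn_le_add; rewrite ?valnN. Qed.

Lemma valnD_gt (r : \bar R) x y :
  (r < v x)%E -> (r < v y)%E -> (r < v (x + y)%R)%E.
Proof. by move=> rx ry; apply: lt_le_trans (valnD v x y); rewrite lt_min rx. Qed.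

Lemma valnB_gt (r : \bar R) x y :
  (r < v x)%E -> (r < v y)%E -> (r < v (x - y)%R)%E.
Proof. by move=> rx ry; apply: valnD_gt; rewrite ?valnN. Qed.

Lemma valnD_gtr x y : (v x < v y)%E -> v (x + y) = v x.
Proof.
move=> xy; apply/eqP; rewrite eq_le; apply/andP; split; last first.
  by apply: le_trans (valnD v x y); rewrite le_min lexx ltW.
rewrite leNgt; apply/negP => xxy.
by have := valnB_gt xxy xy; rewrite addrK ltxx.
Qed.

Lemma valn_eq_close x y : (v x < v (x - y)%R)%E -> v y = v x.
Proof. by move=> xy; rewrite -[y](subKr x) (@valnD_gtr x) // valnN. Qed.

Lemma valn_gt0_ge x : (0 < v x)%E -> exists2 r, 0 < r & (r%:E <= v x)%E.
Proof.
case E: (v x) => [r||] // xr; first by exists r; rewrite ?lee_fin.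
by exists 1; rewrite ?leey.
Qed.

Lemma valnX_gt0 x n : (0 < n)%N -> (0 < v (x ^+ n)%R)%E = (0 < v x)%E.
Proof.
move=> n0; have [->|/valnE[r xr]] := eqVneq x 0; first by rewrite expr0n gtn_eqF.
by rewrite (valnX_fin n xr) xr !lte_fin pmulrn_lgt0.
Qed.

Lemma valn_pow_eq0 x n : (0 < n)%N -> v (x ^+ n) = 0%E -> v x = 0%E.
Proof.
move=> n0; have [->|/valnE[r xr]] := eqVneq x 0; first by rewrite expr0n gtn_eqF.
rewrite (valnX_fin n xr) xr => -[] /eqP; rewrite mulrn_eq0 gtn_eqF //=.
by move/eqP->.
Qed.

(** The valuation of x is both unchanged and multiplied by n. This turns
    congruences between elements fixed by Frobenius into equalities. *)
Lemma valn_expr_fixed x n :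
  (1 < n)%N -> x ^+ n = x -> x != 0 -> v x = 0%E.
Proof.
move=> n1 xn x0; have [r xr] := valnE x0.
have := valnX_fin n xr; rewrite xn xr => -[] /esym/eqP.
rewrite -subr_eq0 -{2}[r]mulr1n -mulrnBr; last exact: ltnW.
by rewrite mulrn_eq0 subn_eq0 leqNgt n1 /= => /eqP ->.
Qed.

Lemma valn_min_coef (p : {poly K}) : p != 0 ->
  exists2 i, p`_i != 0 & forall j, (v p`_i <= v p`_j)%E.
Proof.
move=> p0; have lp0 : p`_(size p).-1 != 0 by rewrite -lead_coefE lead_coef_eq0.
have sp : ((size p).-1 < size p)%N by rewrite prednK // lt0n size_poly_eq0.
pose i0 := Ordinal sp.
case: (@Order.TotalTheory.arg_minP _ _ _ i0 xpredT (fun i : 'I_(size p) => v p`_i)) => //.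
move=> i _ imin; exists i.
  apply: contra lp0 => /eqP pi0; have := imin i0 isT.
  by rewrite pi0 valn0 leye_eq => /eqP/(valn_pinfty v)/eqP.
move=> j; have [jp|/(nth_default 0) ->] := ltnP j (size p).
  exact: (imin (Ordinal jp)).
by rewrite valn0 leey.
Qed.

End Valuation.

Section CloseRoot.
Variables (R : realType) (C : closedFieldType) (v : valuation R C).

(** If the value of a monic polynomial at w is small, then w is close to a root,
    because the value is the product of the distances to the roots. *)
Lemma exists_close_root (p : {poly C}) (w : C) (s : R) :
  p \is monic -> ((s *+ (size p).-1)%:E < v p.[w])%E ->
  exists2 z, root p z & (s%:E < v (w - z)%R)%E.
Proof.
move=> /monicP pm; have [rs] := closed_field_poly_normal p.
rewrite pm scale1r => -> {pm p}; rewrite size_prod_XsubC /=.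
elim: rs => [|z rs IH]; first by rewrite big_nil hornerC valn1 mulr0n ltxx.
rewrite big_cons hornerM !hornerE /= valnM => H.
have [wz|wz] := ltP s%:E (v (w - z)%R).
  by exists z; rewrite // rootM root_XsubC eqxx.
have [|y py wy] := IH; last by exists y; rewrite // rootM py orbT.
rewrite ltNge; apply/negP => H'; move: H; rewrite ltNge => /negP; apply.
by rewrite mulrS EFinD; apply: leeD.
Qed.

End CloseRoot.

Section Residue.
Variables (R : realType) (K : fieldType) (v : valuation R K).
Local Notation O := (integer v).
Local Notation k := (residue_field v).

(** A name for the quotient map, so that it can be rewritten as a ring
    morphism. *)
Definition integer_res (a : O) : k := \pi_k a.
Local Notation res := integer_res.

Fact integer_res_zmod : zmod_morphism res.
Proof. by move=> a b; rewrite /res raddfB. Qed.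
Fact integer_res_monoid : monoid_morphism res.
Proof. by split=> [|a b]; rewrite /res ?rmorphM ?rmorph1. Qed.
HB.instance Definition _ := GRing.isZmodMorphism.Build O k res integer_res_zmod.
HB.instance Definition _ := GRing.isMonoidMorphism.Build O k res integer_res_monoid.

Lemma integer_resK (c : k) : res (repr c) = c.
Proof. exact: reprK. Qed.

Lemma integer_ge0 (a : O) : (0 <= v (val a))%E.
Proof. by have := valP a; rewrite unfold_in. Qed.

Lemma mk_integer (x : K) : (0 <= v x)%E -> {a : O | val a = x}.
Proof. by move=> x0; exists (Integer (x0 : x \in valn_int v)). Qed.

Lemma res_eq (a b : O) : res a = res b <-> (0 < v (val a - val b)%R)%E.
Proof.
split=> [/eqP|ab]; first by rewrite -Quotient.idealrBE unfold_in.
by apply/eqP; rewrite -Quotient.idealrBE unfold_in.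
Qed.

Lemma res_eq0 (a : O) : res a = 0 <-> (0 < v (val a))%E.
Proof. by rewrite -(rmorph0 res) res_eq rmorph0 subr0. Qed.

Lemma res_neq0 (a : O) : res a != 0 <-> v (val a) = 0%E.
Proof.
split=> [/eqP|a0]; last by apply/eqP/res_eq0; rewrite a0 ltxx.
move=> H; apply/eqP; rewrite eq_le integer_ge0 andbT leNgt.
by apply/negP => /res_eq0.
Qed.

Lemma residueE (a : O) : residue v (val a) = res a.
Proof. by rewrite /residue valKd. Qed.

Lemma residue_eq x y : (0 <= v x)%E -> (0 <= v y)%E ->
  residue v x = residue v y <-> (0 < v (x - y)%R)%E.
Proof.
by move=> /mk_integer[a <-] /mk_integer[b <-]; rewrite !residueE; apply: res_eq.
Qed.

Lemma residueM x y : (0 <= v x)%E -> (0 <= v y)%E ->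
  residue v (x * y) = residue v x * residue v y.
Proof.
move=> /mk_integer[a <-] /mk_integer[b <-].
by rewrite -rmorphM !residueE rmorphM.
Qed.

Lemma residueX x n : (0 <= v x)%E -> residue v (x ^+ n) = residue v x ^+ n.
Proof. by move=> /mk_integer[a <-]; rewrite -rmorphXn !residueE rmorphXn. Qed.

Lemma residue1 : residue v 1 = 1.
Proof. by rewrite -(rmorph1 (val : O -> K)) residueE rmorph1. Qed.

Lemma residueV x : v x = 0%E -> residue v x^-1 = (residue v x)^-1.
Proof.
move=> x0; have xn : x != 0 by apply: (valn_neq0 x0).
have x1 : (0 <= v x^-1%R)%E by rewrite valnV // x0 oppe0.
have xx : residue v x * residue v x^-1 = 1.
  by rewrite -residueM ?x0 // divff // residue1.
have rx : residue v x != 0.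
  by apply: contraTneq (oner_neq0 k) => r0; rewrite -xx r0 mul0r eqxx.
by apply: (mulfI rx); rewrite xx divff.
Qed.

End Residue.

Section ClosedResidue.
Variables (R : realType) (C : closedFieldType) (v : valuation R C).
Local Notation O := (integer v).
Local Notation k := (residue_field v).
Local Notation res := (@integer_res R C v).

(** A root of a monic polynomial with integral coefficients is integral, so
    roots can be found in the residue field by lifting the polynomial. *)
Fact residue_field_closed : GRing.closed_field_axiom k.
Proof.
move=> n P n0; have [x xP] := @GRing.solve_monicpoly C n (fun i => val (repr (P i))) n0.
have x0 : (0 <= v x)%E.
  rewrite leNgt; apply/negP => xn.
  have x_n0 : x != 0 by apply: contraTneq xn => ->; rewrite valn0.
  have [r xr] := valnE v x_n0; move: xn; rewrite xr lte_fin => r0.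
  suff : ((r *+ n.-1)%:E <= v (x ^+ n)%R)%E.
    rewrite (valnX_fin n xr) lee_fin; case: n n0 {P xP} => // n _ /=.
    by rewrite mulrSr lerDl leNgt r0.
  rewrite xP; apply: valn_le_sum => i _; rewrite -[_ *+ _]add0r.
  apply: valnM_ge; first exact: integer_ge0.
  rewrite (valnX_fin i xr) lee_fin; apply: ler_wnMn2l; first exact: ltW.
  by rewrite -ltnS prednK // ltn_ord.
have [a ax] := mk_integer x0; exists (res a).
have aP : a ^+ n = \sum_(i < n) repr (P i) * a ^+ i.
  apply: val_inj; rewrite rmorphXn rmorph_sum /= ax xP.
  by apply: eq_bigr => i _; rewrite /= -ax -rmorphXn.
rewrite -rmorphXn aP rmorph_sum; apply: eq_bigr => i _.
by rewrite rmorphM rmorphXn; congr (_ * _); apply: integer_resK.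
Qed.

HB.instance Definition _ := Field_isAlgClosed.Build k residue_field_closed.

End ClosedResidue.

Lemma card_full_seq (T : finType) (s : seq T) :
  uniq s -> (forall x, x \in s) -> #|T| = size s.
Proof. by move=> /card_uniqP <- ss; apply: eq_card => x; rewrite !inE ss. Qed.

(** The cardinality makes k a finite field, to which Fermat's little theorem and
    the structure of its additive group as a p-group apply. *)
Lemma finite_field_expf (k : fieldType) (p q : nat) :
  ([set: k] #= `I_q)%card -> p \in [pchar k] ->
  [/\ forall x : k, x ^+ q = x, (1 < q)%N, [pchar k].-nat q
    & exists2 s : seq k, uniq s & size s = q].
Proof.
move=> kq pk; have : finite_set [set: k] by apply/finite_setP; exists q.
case/finite_seqP => s0 s0P; pose s := undup s0.
have ss x : x \in s.
  by rewrite mem_undup; move: (congr1 (fun A : set k => A x) s0P) => /= <-.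
have su : uniq s by apply: undup_uniq.
have sax : Finite.axiom s by move=> x; rewrite count_uniq_mem // ss.
have spc : pcancel (fun x => index x s) (fun i => Some (nth 0 s i)).
  by move=> x; rewrite nth_index.
pose kf : finFieldType := HB.pack k (isCountable.Build k spc) (isFinite.Build k sax).
have sq : size s = q.
  rewrite -(size_seq_fset tt); apply/card_eq_fsetP.
  suff -> : [set` finmap.seq_fset tt s0]%classic = [set: k]%classic by [].
  by apply/seteqP; split=> x //= _; have := ss x; rewrite mem_undup -(seq_fsetE tt).
have kc : #|kf| = q by rewrite -sq; apply: (card_full_seq (T := kf) su ss).
split.
- by move=> x; rewrite -{1}kc; apply: (@expf_card kf x).
- by rewrite -kc; apply: (@finNzRing_gt1 kf).
- have := @pprimeChar_pgroup p kf pk; rewrite pgroup.pgroupE cardsT -kc.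
  by apply: sub_in_pnat => i _ /eqP ->.
- by exists s.
Qed.

(** * Frobenius and inertia *)

Lemma archi_mulrn (R : realType) (r B : R) : 0 < r ->
  exists N, forall n, (N <= n)%N -> B <= r *+ n.
Proof.
move=> r0; exists (Num.Def.archi_bound `|B / r|) => n Nn.
have : `|B / r| < n%:R.
  by apply: lt_le_trans (Num.Theory.archi_boundP (normr_ge0 _)) _; rewrite ler_nat.
move/(le_lt_trans (ler_norm _)); rewrite ltr_pdivrMr // => /ltW.
by rewrite mulr_natl.
Qed.

Section Frobenius.
Variables (K : fieldType) (q : nat).
Hypothesis Kq : [pchar K].-nat q.

Lemma exprB_pchar (x y : K) : (x - y) ^+ q = x ^+ q - y ^+ q.
Proof. by apply/eqP; rewrite eq_sym subr_eq -exprDn_pchar ?subrK. Qed.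

Lemma expr_pchar_inj : injective (fun x : K => x ^+ q).
Proof.
move=> x y /= xy; apply/eqP; rewrite -subr_eq0.
have /eqP := exprB_pchar x y; rewrite xy subrr expf_eq0.
by case/andP.
Qed.

Lemma pchar_natX n : [pchar K].-nat (q ^ n)%N.
Proof. by rewrite pnatX Kq. Qed.

Lemma expr_fixed_iter (x : K) n : x ^+ q = x -> x ^+ (q ^ n) = x.
Proof. by move=> xq; elim: n => [|n IH]; rewrite ?expr1 // expnS exprM xq. Qed.

End Frobenius.

Definition frob (K : fieldType) (q : nat) of [pchar K].-nat q :=
  fun x : K => x ^+ q.

Section FrobeniusMorphism.
Variables (K : fieldType) (q : nat) (Kq : [pchar K].-nat q).

Fact frob_is_zmod : zmod_morphism (frob Kq).
Proof. by move=> x y; apply: exprB_pchar. Qed.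
HB.instance Definition _ := GRing.isZmodMorphism.Build K K (frob Kq) frob_is_zmod.
Fact frob_is_monoid : monoid_morphism (frob Kq).
Proof. by split=> [|x y]; rewrite /frob ?expr1n ?exprMn. Qed.
HB.instance Definition _ := GRing.isMonoidMorphism.Build K K (frob Kq) frob_is_monoid.

Lemma map_frob_id (p : {poly K}) :
  (forall i, p`_i ^+ q = p`_i) -> map_poly (frob Kq) p = p.
Proof. by move=> pq; apply/polyP => i; rewrite coef_map; apply: pq. Qed.

Lemma horner_frob (p : {poly K}) (x : K) n :
  (forall i, p`_i ^+ q = p`_i) -> p.[x ^+ (q ^ n)] = p.[x] ^+ (q ^ n).
Proof.
move=> pq; elim: n => [|n IH]; first by rewrite !expr1.
rewrite expnSr !exprM -IH; have /= := horner_map (frob Kq) p (x ^+ (q ^ n)).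
by rewrite (map_frob_id pq).
Qed.

Lemma pow_orbit_uniq (x : K) f : (0 < f)%N ->
  (forall m, (0 < m)%N -> x ^+ (q ^ m) = x -> (f <= m)%N) ->
  uniq (mkseq (fun i => x ^+ (q ^ i)) f).
Proof.
move=> f0 fmin; apply/negPn/negP => /(uniqPn 0)[i [j [ij]]].
rewrite size_mkseq => jf; rewrite !nth_mkseq ?(ltn_trans ij) // => xij.
suff /fmin : x ^+ (q ^ (j - i)) = x.
  by rewrite subn_gt0 => /(_ ij); rewrite leqNgt (leq_ltn_trans (leq_subr _ _) jf).
apply: (expr_pchar_inj (pchar_natX Kq i)).
by rewrite /= -exprM -expnD subnK ?(ltnW ij).
Qed.

End FrobeniusMorphism.

Section LocalField.
Variables (R : realType) (p q : nat) (F : fieldType) (C : closedFieldType).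
Variables (iota : {rmorphism F -> C}) (v : valuation R C) (pi : F).
Hypothesis hF : local_field p q (valn_comp iota v) pi.
Local Notation w := (valn_comp iota v).
Local Notation kF := (residue_field w).

Lemma local_field_finite :
  [/\ [pchar F].-nat q, (1 < q)%N,
      forall a, (0 <= w a)%E -> (0 < w (a ^+ q - a)%R)%E
    & exists2 s : seq kF, uniq s & size s = q].
Proof.
case: hF => p_pr pF _ _ kq.
have pO : p \in [pchar (integer w)].
  rewrite inE p_pr /=; apply/eqP/val_inj; rewrite rmorph_nat rmorph0.
  by rewrite (pcharf0 pF).
have pk : p \in [pchar kF] by apply: (rmorph_pchar (@integer_res R F w)).
have [xq q1 pq s] := finite_field_expf kq pk; split=> //.
  apply: sub_in_pnat pq => i _ ik; have := pcharf_prime ik.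
  by move: ik; rewrite (pcharf_eq pk) => /eqP ->.
move=> a /mk_integer[b <-]; rewrite -rmorphXn -rmorphB; apply/(res_eq0 (v := w)).
by apply/eqP; rewrite rmorphB rmorphXn /= xq subrr.
Qed.

Let Fq : [pchar F].-nat q. Proof. by case: local_field_finite. Qed.
Let q1 : (1 < q)%N. Proof. by case: local_field_finite. Qed.

Lemma local_field_pchar : [pchar C].-nat q.
Proof. by rewrite (eq_pnat _ (fmorph_pchar iota)). Qed.
Let Cq := local_field_pchar.

(** Hensel's lemma for X ^ q - X: the powers a ^ (q ^ n) form a Cauchy sequence,
    since consecutive differences are q ^ n-th powers of a small element. *)
Lemma teichmuller (a : F) : (0 <= w a)%E ->
  exists t, t ^+ q = t /\ (0 < w (t - a)%R)%E.
Proof.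
move=> a0; have [_ _ /(_ a a0) da _] := local_field_finite.
have [r r0 rd] := valn_gt0_ge da.
have step n : ((r *+ n)%:E <= w (a ^+ (q ^ n.+1) - a ^+ (q ^ n))%R)%E.
  rewrite expnS exprM -(exprB_pchar (pchar_natX Fq n)).
  apply: le_trans (valnX_ge (q ^ n) rd); rewrite lee_fin.
  by rewrite ler_pMn2l //; apply/ltnW/ltn_expl.
have far n j : ((r *+ n)%:E <= w (a ^+ (q ^ (n + j)) - a ^+ (q ^ n))%R)%E.
  elim: j => [|j IH]; first by rewrite addn0 subrr valn0 leey.
  rewrite -[_ - _](subrKA (a ^+ (q ^ (n + j)))); apply: valn_le_add => //.
  rewrite addnS; apply: le_trans (step _).
  by rewrite lee_fin ler_pMn2l // leq_addr.
have far0 j : (r%:E <= w (a ^+ (q ^ j) - a)%R)%E.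
  elim: j => [|j IH]; first by rewrite expr1 subrr valn0 leey.
  rewrite -[_ - _](subrKA (a ^+ (q ^ j))); apply: valn_le_add => //.
  rewrite expnS exprM -(exprB_pchar (pchar_natX Fq j)).
  apply: le_trans (valnX_ge (q ^ j) rd); rewrite lee_fin.
  by rewrite -{1}[r]mulr1n ler_pMn2l // expn_gt0 ltnW.
have [t ta] : exists t, valn_cvg w (fun n => a ^+ (q ^ n)) t.
  case: hF => _ _ wc _ _; apply: wc => B; have [N BN] := archi_mulrn B r0.
  exists N => m n Nm Nn; rewrite -[_ - _](subrKA (a ^+ (q ^ N))).
  apply: valn_le_add; last rewrite -opprB valnN.
    by have := far N (m - N)%N; rewrite subnKC //; apply: le_trans; rewrite lee_fin BN.
  by have := far N (n - N)%N; rewrite subnKC //; apply: le_trans; rewrite lee_fin BN.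
  have tq : t ^+ q = t.
    apply/eqP; rewrite -subr_eq0; apply/eqP/(valn_pinfty w).
    case E: (w _) => [s||] //; last by case: (valn_ninfty E).
    have B0 : 0 <= `|s| + 1 :> R by apply: addr_ge0.
    have [N NP] := ta (`|s| + 1).
    have : ((`|s| + 1)%:E <= w (t ^+ q - t)%R)%E.
      rewrite -[_ - t](subrKA (a ^+ (q ^ N.+1))); apply: valn_le_add; last first.
        exact: NP.
      rewrite expnSr exprM -(exprB_pchar Fq).
      have := NP N (leqnn _); rewrite -opprB valnN => /(valnX_ge q).
      apply: le_trans; rewrite lee_fin -{1}[_ + 1]mulr1n.
      by apply: ler_wpMn2l => //; apply: ltnW.
    by rewrite E lee_fin leNgt (le_lt_trans (ler_norm s)) // ltrDl.
exists t; split=> //; have [N NP] := ta r.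
apply: (@lt_le_trans _ _ r%:E); first by rewrite lte_fin.
rewrite -[_ - a](subrKA (a ^+ (q ^ N))); apply: valn_le_add => //.
by rewrite -opprB valnN; apply: NP.
Qed.

(** The Teichmuller lifts of the q residue classes already exhaust the q roots
    of X ^ q - X in C. *)
Lemma fixed_in_base (c : C) : c ^+ q = c -> exists t, iota t = c.
Proof.
move=> cq; have [_ _ _ [s su sq]] := local_field_finite.
have /choice[T TP] (x : kF) :
    exists t : F, t ^+ q = t /\ residue w t = x /\ (0 <= w t)%E.
  have [t [tq ta]] := teichmuller (integer_ge0 (repr x)).
  have t0 : (0 <= w t)%E.
    rewrite -[t](subrK (val (repr x))); apply: valn_le_add; last exact: integer_ge0.
    exact: ltW.
  exists t; split=> //; split=> //; rewrite -[RHS]integer_resK -residueE.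
  by apply/residue_eq => //; apply: integer_ge0.
apply: contrapT => nc; pose P : {poly C} := 'X^q - 'X.
have sP : size P = q.+1 by rewrite size_polyDl ?size_polyXn // size_polyN size_polyX.
have rP x : root P x = (x ^+ q == x) by rewrite rootE !hornerE subr_eq0.
have : (size (c :: map (iota \o T) s) < size P)%N.
  apply: max_poly_roots.
  - by rewrite -size_poly_eq0 sP.
  - apply/allP => x; rewrite rP inE => /predU1P[->|/mapP[y _ ->]]; first exact/eqP.
    by rewrite /= -rmorphXn; have [-> _] := TP y.
  - rewrite /= map_inj_uniq ?su ?andbT.
      by apply/negP => /mapP[y _ yc]; apply: nc; exists (T y).
    move=> x y /= /fmorph_inj xy; have [_ [<- _]] := TP x.
    by have [_ [<- _]] := TP y; rewrite xy.
by rewrite sP /= size_map sq ltnn.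
Qed.

(** A polynomial over F, scaled to be primitive, agrees modulo the maximal ideal
    with a polynomial whose coefficients are fixed by Frobenius. *)
Lemma teichmuller_poly (g0 : {poly F}) : g0 != 0 ->
  exists (a : F) (g : {poly C}), [/\ a != 0, g != 0 /\ (size g <= size g0)%N,
    forall j, g`_j ^+ q = g`_j
    & forall z, (0 <= v z)%E ->
        (0 < v ((iota a)^-1 * (map_poly iota g0).[z] - g.[z])%R)%E].
Proof.
move=> g00; have [i gi0 gmin] := valn_min_coef w g00.
have ci j : (0 <= w ((g0`_i)^-1 * g0`_j)%R)%E.
  have [r ri] := valnE w gi0; have := gmin j; rewrite valnM (valnV_fin ri) ri.
  by rewrite EFinN addeC sube_ge0 // orbT.
have /choice[T TP] j := teichmuller (ci j).
pose g := \poly_(j < size g0) iota (T j).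
have igs : (i < size g0)%N.
  by rewrite ltnNge; apply: contra gi0 => /(nth_default 0) ->.
have gE j : (0 < v (iota ((g0`_i)^-1) * iota g0`_j - g`_j)%R)%E.
  rewrite coef_poly; case: ltnP => [jg|/(nth_default 0) ->].
    by rewrite -rmorphM -opprB valnN -rmorphB; have [_] := TP j.
  by rewrite rmorph0 mulr0 subr0 valn0 ltry.
exists g0`_i, g; split=> //.
- split; last exact: size_poly.
  have := gE i; apply: contraTneq => ->; rewrite coef0 subr0 -rmorphM mulVf //.
  by rewrite rmorph1 valn1 ltxx.
- move=> j; rewrite coef_poly; case: ifP => _; last by rewrite expr0n gtn_eqF // ltnW.
  by rewrite -rmorphXn; have [-> _] := TP j.
move=> z z0; rewrite -fmorphV (@horner_coef_wide _ (size g0) g) ?size_poly //.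
rewrite (@horner_coef_wide _ (size g0) (map_poly iota g0)) ?size_map_poly //.
rewrite mulr_sumr -sumrB.
apply: (big_ind (fun x => (0 < v x)%E)) => [|x y|j _]; first by rewrite valn0 ltry.
  exact: valnD_gt.
rewrite coef_map mulrA -mulrBl valnM.
by apply: lt_le_trans (gE j) _; rewrite leeDl // valnX_ge0.
Qed.

(** An integral element algebraic over F is close to a root of unity, or to 0:
    modulo the maximal ideal it is a root of a polynomial over the field with q
    elements, and Frobenius permutes the roots of such a polynomial. *)
Lemma algebraic_close_fixed (z : C) : algebraicOver iota z -> (0 <= v z)%E ->
  exists (t : C) (m : nat), [/\ (0 < m)%N, t ^+ (q ^ m) = t & (0 < v (z - t)%R)%E].
Proof.
case=> g0 g00 /rootP gz z0; have [a [g [a0 [gn0 _] gq gE]]] := teichmuller_poly g00.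
have := gE z z0; rewrite gz mulr0 sub0r valnN => gz0.
have lc0 : lead_coef g != 0 by rewrite lead_coef_eq0.
have vlc : v (lead_coef g) = 0%E.
  by apply: (valn_expr_fixed v q1) => //; rewrite lead_coefE gq.
pose g1 := (lead_coef g)^-1 *: g.
have [||t] := @exists_close_root _ _ v g1 z 0.
- by rewrite monicE lead_coefZ mulVf.
- by rewrite mul0rn hornerZ valnM valnV // vlc oppe0 add0e.
rewrite rootE hornerZ mulf_eq0 invr_eq0 (negPf lc0) /= => gt zt.
pose s := mkseq (fun i => t ^+ (q ^ i)) (size g).
have : ~~ uniq s.
  apply: contraTN isT => su; have : (size s < size g)%N.
    apply: max_poly_roots => //; apply/allP => x /mapP[i _ ->].
    by rewrite rootE (horner_frob Cq) // (eqP gt) expr0n gtn_eqF // expn_gt0 ltnW.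
  by rewrite size_mkseq ltnn.
move=> nu; exists t; apply: contrapT => nt; move/negP: nu; apply.
apply: (pow_orbit_uniq Cq); first by rewrite size_poly_gt0.
by move=> m m0 tm; exfalso; apply: nt; exists m.
Qed.

Section Unramified.
Variables (t : C) (f : nat).
Hypothesis f0 : (0 < f)%N.
Hypothesis tf : t ^+ (q ^ f) = t.
Hypothesis fmin : forall m, (0 < m)%N -> t ^+ (q ^ m) = t -> (f <= m)%N.

Let qf1 : (1 < q ^ f)%N.
Proof. by apply: leq_trans q1 _; rewrite -{1}[q]expn1 leq_pexp2l // ltnW. Qed.

Lemma fixed_ge0 : (0 <= v t)%E.
Proof.
have [->|t0] := eqVneq t 0; first by rewrite valn0 leey.
by rewrite (valn_expr_fixed v qf1 tf).
Qed.

(** Scaled to be primitive, a polynomial of degree less than the orbit length f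
    takes a unit value at t: otherwise the polynomial with Frobenius-fixed
    coefficients that it is congruent to would vanish at the f conjugates
    of t. *)
Lemma unramified_value (g0 : {poly F}) : g0 != 0 -> (size g0 <= f)%N ->
  exists2 a, a != 0 & v (map_poly iota g0).[t] = v (iota a).
Proof.
move=> g00 gf; have [a [g [a0 [gn0 gs] gq gE]]] := teichmuller_poly g00.
exists a => //; have := gE t fixed_ge0; set b := _^-1 * _ => bg.
have gt : g.[t] ^+ (q ^ f) = g.[t] by rewrite -(horner_frob Cq t f gq) tf.
have [gt0|gt0] := eqVneq g.[t] 0.
  have : (size (mkseq (fun i => t ^+ (q ^ i)) f) < size g)%N.
    apply: max_poly_roots => //; last exact: (pow_orbit_uniq Cq).
    apply/allP => x /mapP[i _ ->].
    by rewrite rootE (horner_frob Cq) // gt0 expr0n gtn_eqF // expn_gt0 ltnW.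
  by rewrite size_mkseq ltnNge (leq_trans gs).
have gv : v g.[t] = 0%E by apply: (valn_expr_fixed v qf1 gt gt0).
have : v b = 0%E by rewrite -gv; apply: valn_eq_close; rewrite gv -opprB valnN.
rewrite /b; set c := (map_poly _ _).[_] => bv.
have ia : iota a != 0 by rewrite fmorph_eq0.
by rewrite -[c](mulVKf ia) valnM bv adde0.
Qed.

(** Frobenius permutes the factors, so it fixes the coefficients, which
    therefore lie in F. *)
Lemma fixed_poly : exists2 h : {poly F},
  map_poly iota h = \prod_(i < f) ('X - (t ^+ (q ^ i))%:P) & size h = f.+1.
Proof.
pose h := \prod_(i < f) ('X - (t ^+ (q ^ i))%:P).
have hfix : map_poly (frob Cq) h = h.
  rewrite rmorph_prod; under eq_bigr => i _.
    rewrite rmorphB /= map_polyX map_polyC /= -[frob Cq _]/(_ ^+ q) -exprM -expnSr.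
    over.
  rewrite /h; case: (f) f0 tf => // n _ tn.
  by rewrite big_ord_recr big_ord_recl /= tn expr1 mulrC; congr (_ * _).
have /choice[T TP] j : exists c, iota c = h`_j.
  by apply: fixed_in_base; rewrite -{2}hfix coef_map.
have sh : size h = f.+1.
  by rewrite /h size_prod_XsubC /index_enum -enumT size_enum_ord.
exists (\poly_(j < f.+1) T j).
  apply/polyP => j; rewrite coef_map coef_poly; case: ltnP => jf; first exact: TP.
  by rewrite [LHS](rmorph0 iota) nth_default // sh.
rewrite size_poly_eq // -(fmorph_eq0 iota) TP.
by rewrite -[f]/(f.+1.-1) -sh -lead_coefE lead_coef_eq0 -size_poly_eq0 sh.
Qed.

(** By unramified_value, the polynomial h of fixed_poly is the minimal polynomial
    of t, and F(t) takes its values in the value group of F. *)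
Lemma fixed_unramified_min : maximal_unramified iota v t.
Proof.
have [h hE hs] := fixed_poly.
have ht : root (map_poly iota h) t.
  by rewrite hE; case: (f) f0 => // n _; rewrite big_ord_recl rootM expr1 root_XsubC eqxx.
have h0 : h != 0 by rewrite -size_poly_eq0 hs.
have hmin (g : {poly F}) : root (map_poly iota g) t -> g != 0 -> (size h <= size g)%N.
  move=> gt g0; rewrite leqNgt hs ltnS; apply/negP => /(unramified_value g0)[a a0].
  rewrite (eqP gt) valn0 => /esym/(valn_pinfty v)/eqP.
  by rewrite fmorph_eq0 (negPf a0).
have hirr := (subfx_irreducibleP ht h0).1 hmin.
pose L := SubFieldExtType ht hirr.
pose j : {rmorphism L -> C} := @subfx_inj F C iota t h.
exists L, j; split.
- by move=> a; apply: (subfx_inj_base ht h0 a).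
- move=> x x0; have [g xg] := subfxE x.
  have jx : j x = (map_poly iota (g %% h)).[t].
    rewrite xg /j /= subfx_inj_eval // {1}(divp_eq g h) rmorphD rmorphM /=.
    by rewrite !hornerE (eqP ht) mulr0 add0r.
  have gh0 : g %% h != 0.
    apply: contra x0 => /eqP gh; rewrite -(fmorph_eq0 j) jx gh rmorph0 horner0.
    exact: eqxx.
  rewrite jx; have [|a _ av] := unramified_value gh0; last by exists a.
  by rewrite -ltnS -hs ltn_modp.
exists (subfx_root iota t h); exact: (subfx_inj_root ht h0).
Qed.

End Unramified.

Lemma fixed_unramified (t : C) (m : nat) : (0 < m)%N -> t ^+ (q ^ m) = t ->
  maximal_unramified iota v t.
Proof.
move=> m0 tm; have ex : exists m, (0 < m)%N && (t ^+ (q ^ m) == t).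
  by exists m; rewrite m0 tm /=.
case: (ex_minnP ex) => f /andP[f0 /eqP tf] fmin.
apply: (fixed_unramified_min f0 tf) => n n0 tn.
by apply: fmin; rewrite n0 tn /=.
Qed.

Lemma base_unramified (a : F) : maximal_unramified iota v (iota a).
Proof.
exists F^o, iota; split; last by exists a.
  by move=> b; rewrite -[b%:A]/(b * 1) mulr1.
by move=> x _; exists x.
Qed.

Lemma v_pi : v (iota pi) = 1%:E.
Proof. by case: hF => _ _ _ []. Qed.

Section Inertia.
Hypothesis hC : completed_algebraic_closure iota v.
Variable sigma : {rmorphism C -> C}.
Hypothesis hsigma : inertia iota v sigma.

Lemma inertia_base a : sigma (iota a) = iota a.
Proof. by case: hsigma => _ _; apply; apply: base_unramified. Qed.

Let sigma_pi n : sigma (iota pi ^+ n) = iota pi ^+ n.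
Proof. by rewrite rmorphXn inertia_base. Qed.

(** Topologically nilpotent elements are those of positive valuation, and a
    continuous morphism preserves them. *)
Lemma inertia_gt0 x : (0 < v x)%E -> (0 < v (sigma x))%E.
Proof.
move=> /valn_gt0_ge[r r0 rx]; case: hsigma => _ /(_ 0 1)[A AP] _.
have [n nP] := archi_mulrn A r0.
have {AP}/AP : (A%:E <= v (x ^+ n.+1 - 0)%R)%E.
  by rewrite subr0; apply: le_trans (valnX_ge _ rx); rewrite lee_fin nP.
rewrite rmorph0 subr0 rmorphXn => sx.
by rewrite -(@valnX_gt0 _ _ v _ n.+1) //; apply: lt_le_trans sx; rewrite lte_fin ltr01.
Qed.

Let inertia_aux x r s :
  v x = r%:E -> v (sigma x) = s%:E -> 0 <= s -> r <= s.
Proof.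
move=> xr sxs s0; rewrite leNgt; apply/negP => sr.
have rs0 : 0 < r - s by rewrite subr_gt0.
have [m /(_ m (leqnn m))] := archi_mulrn 2%:R rs0.
(* The integer n lies strictly between s m and r m. *)
pose n := (Num.Def.truncn (s *+ m)).+1 => mP.
have /andP[n1 n2] : (Num.Def.truncn (s *+ m))%:R <= s *+ m < n%:R.
  by apply: Num.Theory.truncn_itv; rewrite mulrn_wge0.
have nS : n%:R = (Num.Def.truncn (s *+ m))%:R + 1 :> R by rewrite natr1.
have npi : v (iota pi ^- n) = (- n%:R)%:E.
  by apply: valnV_fin; rewrite (valnX_fin n v_pi).
have := @inertia_gt0 (x ^+ m / iota pi ^+ n).
rewrite rmorphM fmorphV rmorphXn sigma_pi.
rewrite (valnM_fin (valnX_fin m xr) npi) (valnM_fin (valnX_fin m sxs) npi).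
rewrite !lte_fin !subr_gt0 => H.
suff /H : n%:R < r *+ m by rewrite ltNge ltW.
rewrite nS; apply: (@le_lt_trans _ _ (s *+ m + 1)); first by rewrite lerD2r.
apply: lt_le_trans (_ : s *+ m + 2%:R <= _); first by rewrite ltrD2l ltr1n.
by rewrite -lerBrDl -mulrnBl.
Qed.

(** Continuity yields the comparison of v and v o sigma up to a factor, and the
    fixed element pi normalises that factor to 1. *)
Lemma inertia_val x : v (sigma x) = v x.
Proof.
have [->|x0] := eqVneq x 0; first by rewrite rmorph0.
suff le_v y r s : v y = r%:E -> v (sigma y) = s%:E -> r <= s.
  have [r xr] := valnE v x0.
  have [s sxs] : exists s, v (sigma x) = s%:E by apply: valnE; rewrite fmorph_eq0.
  have := le_v x^-1 (- r) (- s); rewrite fmorphV (valnV_fin xr) (valnV_fin sxs).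
  move=> /(_ erefl erefl); rewrite lerN2 => sr.
  by rewrite xr sxs; congr (_%:E); apply/le_anti; rewrite sr (le_v x).
move=> yr sys; have [k /(_ k (leqnn k)) kP] := archi_mulrn (- s) (@ltr01 R).
have pk : v (iota pi ^+ k) = (1 *+ k)%:E := valnX_fin k v_pi.
have := @inertia_aux (y * iota pi ^+ k) (r + 1 *+ k) (s + 1 *+ k).
rewrite rmorphM sigma_pi (valnM_fin yr pk) (valnM_fin sys pk) lerD2r; apply=> //.
by rewrite -lerBlDl sub0r.
Qed.

(** Every integral element is congruent to an algebraic one, hence to a root of
    unity or 0 in an unramified extension, which inertia fixes. *)
Lemma inertia_residue z : (0 <= v z)%E -> (0 < v (sigma z - z)%R)%E.
Proof.
move=> z0; case: hC => _ /(_ z 1)[y [yalg zy]].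
have {}zy : (0 < v (z - y)%R)%E by apply: lt_le_trans zy; rewrite lte_fin ltr01.
have y0 : (0 <= v y)%E.
  by rewrite -[y](subKr z); apply: valnB_ge => //; apply: ltW.
have [t [m [m0 tm yt]]] := algebraic_close_fixed yalg y0.
have zt : (0 < v (z - t)%R)%E.
  by rewrite -[z - t](subrKA y); apply: valnD_gt.
have st : sigma t = t.
  by case: hsigma => _ _; apply; apply: fixed_unramified tm.
rewrite -[_ - z](subrKA t); apply: valnD_gt; last by rewrite -opprB valnN.
by rewrite -st -rmorphB inertia_val.
Qed.

End Inertia.

End LocalField.

(** * Analytic functions on a subset of a polydisc *)

Section Analytic.
Variables (R : realType) (K : fieldType) (v : valuation R K).
Variable Y : polydisc_subset v.
Local Notation n := (ngen Y).
Implicit Types (f g : pts Y -> K) (B s : R).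

Lemma analytic_ge_gen (i : 'I_n) : analytic_ge (wgt i) (gen i : pts Y -> K).
Proof.
have wU : mwgt U_(i)%MM = wgt i.
  rewrite /mwgt (bigD1 i) //= mnm1E eqxx mulr1n big1 ?addr0 // => j ji.
  by rewrite mnm1E eq_sym (negPf ji) mulr0n.
exists (fun m => if m == U_(i)%MM then 1 else 0); split.
- move=> B; exists 2%N => m; case: eqP => [->|_]; first by rewrite mdeg1.
  by rewrite valn0 addye // leey.
- move=> m; case: eqP => [->|_]; last by rewrite valn0 addye // leey.
  by rewrite valn1 add0e wU.
move=> P A; exists 2%N => N N2; rewrite tate_psumE.
suff -> : tate_trunc (Y := Y) (fun m => if m == U_(i)%MM then 1 else 0) N = 'X_i.
  by rewrite mevalXU subrr valn0 leey.
apply/mpolyP => m; rewrite tate_truncE mcoeffX.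
case: (eqVneq m U_(i)%MM) => [->|mi]; first by rewrite mdeg1 N2 ?eqxx.
by rewrite if_same.
Qed.

Lemma analytic_geZ B s (c : K) f : (s%:E <= v c)%E -> analytic_ge B f ->
  analytic_ge (s + B) (fun P => c * f P).
Proof.
move=> cs fB; rewrite [X in analytic_ge _ X]/((fun=> c) * f).
by apply: analytic_geM => //; apply: analytic_ge_cst.
Qed.

Lemma analytic_geB B f g :
  analytic_ge B f -> analytic_ge B g -> analytic_ge B (f - g).
Proof. by move=> fB gB; apply: analytic_geD => //; apply: analytic_geN. Qed.

Lemma analytic_geX f k : analytic_ge 0 f -> analytic_ge 0 (f ^+ k).
Proof.
move=> f0; elim: k => [|k IH]; first exact: analytic_ge1.
by rewrite exprS -[0]addr0; apply: analytic_geM.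
Qed.

Lemma analytic_geMl B f g : analytic_ge 0 f -> analytic_ge B g -> analytic_ge B (f * g).
Proof. by move=> f0 gB; rewrite -[B]add0r; apply: analytic_geM. Qed.

Lemma analytic_ge_trunc B s f : analytic_ge B f -> exists a N,
  tate_ge B a /\ analytic_ge s (f - tate_psum (Y := Y) a N).
Proof.
case=> a [a0 aB af]; have [N NP] := a0 s; exists a, N; split=> //.
exists (fun m => if (mdeg m < N)%N then 0 else a m); split.
- move=> A; have [N' N'P] := a0 A; exists N' => m /N'P.
  by case: ifP => // _ _; rewrite valn0 addye // leey.
- move=> m; case: ltnP => [_|/NP //]; by rewrite valn0 addye // leey.
move=> P A; have [N1 N1P] := af P A; exists (maxn N N1) => M.
rewrite geq_max => /andP[NM /N1P H].
suff -> : tate_psum (fun m => if (mdeg m < N)%N then 0 else a m) M P =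
    tate_psum a M P - tate_psum a N P.
  by rewrite -[(f - _) P]/(f P - tate_psum a N P) opprB addrA subrK.
rewrite !tate_psumE -mevalB; congr (_.@[_]).
apply/mpolyP => m; rewrite mcoeffB !tate_truncE; case: (ltnP (mdeg m) N) => mN.
  by rewrite (leq_trans mN NM) subrr.
by rewrite subr0.
Qed.

(** Polynomials in the generators with coefficients of Gauss valuation at least
    0 are built by ring operations from integral constants and the generators
    divided by constants of the same weight. *)
Lemma tate_psum_ind (S : (pts Y -> K) -> Prop) (c : 'I_n -> K) :
  (forall i, v (c i) = (wgt i)%:E) ->
  (forall x, (0 <= v x)%E -> S (fun=> x)) ->
  (forall f g, S f -> S g -> S (f + g)) ->
  (forall f g, S f -> S g -> S (f * g)) ->
  (forall i, S (fun P => (c i)^-1 * gen i P)) ->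
  forall a N, tate_ge (Y := Y) 0 a -> S (tate_psum a N).
Proof.
move=> cw Sc SD SM Sg a N a0.
pose h (m : 'X_{1..n < N}) : pts Y -> K := (fun=> a m * \prod_i c i ^+ m i) *
  \prod_(i < n) (fun P => (c i)^-1 * gen i P) ^+ m i.
have -> : tate_psum a N = \sum_m h m.
  apply/funext => P; rewrite fct_sumE /tate_psum; apply: eq_bigr => m _.
  rewrite /h fctE fct_prodE -mulrA -big_split /=; congr (_ * _).
  apply: eq_bigr => i _; rewrite exprfctE exprMn mulrA -exprMn divff ?expr1n ?mul1r //.
  exact: valn_neq0 (cw i).
have S1 : S 1 by apply: (Sc 1); rewrite valn1.
have S0 : S 0 by apply: (Sc 0); rewrite valn0 leey.
have SX f k : S f -> S (f ^+ k).
  by move=> Sf; elim: k => [|k IH]; rewrite ?expr0 // exprS; apply: SM.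
apply: (big_ind S) => [||m _]; [exact: S0|exact: SD|apply: (SM)].
  apply: Sc; have := a0 m; rewrite valnM.
  suff -> : v (\prod_i c i ^+ m i) = (mwgt m)%:E by [].
  rewrite /mwgt; apply: (big_ind2 (fun x (r : R) => v x = r%:E)) => //.
  - exact: valn1.
  - by move=> x r y t; apply: valnM_fin.
  - by move=> i _; apply: valnX_fin.
by apply: (big_ind S) => [||i _]; [exact: S1|exact: SM|exact: SX].
Qed.

Lemma power_bounded_ge0 f : analytic_ge 0 f -> power_bounded f.
Proof. by move=> f0; split; [exists 0|exists 0 => k; apply: analytic_geX]. Qed.

Lemma top_nilpotent_ge s f : 0 < s -> analytic_ge s f -> top_nilpotent f.
Proof.
move=> s0 fs; split; first by exists s.
move=> B; have [N NP] := archi_mulrn B s0; exists N => k kN.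
suff fk : analytic_ge (s *+ k) (f ^+ k) by apply: analytic_geW fk; apply: NP.
elim: k {kN} => [|k IH]; first exact: analytic_ge1.
by rewrite exprS mulrS; apply: analytic_geM.
Qed.

Lemma power_bounded_value f P : power_bounded f -> (0 <= v (f P))%E.
Proof.
case=> _ [B fB]; have fk k : (B%:E <= v (f P ^+ k)%R)%E.
  by have := analytic_ge_bound P (fB k); rewrite exprfctE.
have [->|/(valnE v)[r rE]] := eqVneq (f P) 0; first by rewrite valn0 leey.
rewrite rE lee_fin leNgt; apply/negP => r0.
have r0' : 0 < - r by rewrite oppr_gt0.
have [k /(_ k.+1 (leqnSn k))] := archi_mulrn (1 - B) r0'.
have := fk k.+1; rewrite (valnX_fin _ rE) lee_fin mulNrn => h1 h2.
by move: h1 h2; move: (r *+ k.+1) => z; lra.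
Qed.

Lemma top_nilpotent_value f P : top_nilpotent f -> (0 < v (f P))%E.
Proof.
case=> _ /(_ 1)[N /(_ N.+1 (leqnSn N))] /(analytic_ge_bound P).
rewrite exprfctE => h; rewrite -(@valnX_gt0 _ _ v _ N.+1) //.
by apply: lt_le_trans h; rewrite lte_fin ltr01.
Qed.

End Analytic.

(** * Classes in the reduction *)

Section Reduction.
Variables (R : realType) (K : fieldType) (v : valuation R K).
Variable Y : polydisc_subset v.
Implicit Types (f g : pts Y -> K) (h : reduction Y).

Lemma mk_pb_fun f : power_bounded f -> {F : pb_fun Y | val F = f}.
Proof. by move=> fb; exists (PbFun (asboolT fb : f \in @pb_pred _ _ _ Y)). Qed.

Lemma reduceE (F : pb_fun Y) : reduce (val F) = \pi_(reduction Y) F.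
Proof. by rewrite /reduce valKd. Qed.

Lemma reduce_surj h : exists2 f, power_bounded f & reduce f = h.
Proof.
exists (val (repr h)); first by apply/asboolP; apply: (valP (repr h)).
by rewrite reduceE reprK.
Qed.

Lemma reduce_eq f g : power_bounded f -> power_bounded g ->
  reduce f = reduce g <-> top_nilpotent (f - g).
Proof.
move=> /mk_pb_fun[F <-] /mk_pb_fun[G <-]; rewrite !reduceE.
split=> [/reduction_eqP/asboolP|]; first by rewrite rmorphB.
by move=> H; apply/reduction_eqP/asboolP; rewrite rmorphB.
Qed.

Lemma reduceB f g : power_bounded f -> power_bounded g ->
  reduce (f - g) = reduce f - reduce g.
Proof.
move=> /mk_pb_fun[F <-] /mk_pb_fun[G <-]; rewrite -rmorphB !reduceE.
exact: (raddfB \pi_(reduction Y)).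
Qed.

Lemma reduceM f g : power_bounded f -> power_bounded g ->
  reduce (f * g) = reduce f * reduce g.
Proof.
move=> /mk_pb_fun[F <-] /mk_pb_fun[G <-]; rewrite -rmorphM !reduceE.
exact: pi_reductionM.
Qed.

Lemma reduce1 : reduce (1 : pts Y -> K) = 1.
Proof. by rewrite -(rmorph1 (val : pb_fun Y -> _)) reduceE. Qed.

Lemma reduced_pointE P f : power_bounded f ->
  reduced_point P (reduce f) = residue v (f P).
Proof.
move=> fb; have [F FE] := mk_pb_fun fb.
have rb : power_bounded (val (repr (reduce f))) by apply/asboolP; apply: (valP (repr (reduce f))).
have := (reduce_eq rb fb).1; rewrite {1}reduceE reprK => /(_ erefl) nil.
apply/residue_eq; try exact: power_bounded_value.
exact: (top_nilpotent_value P nil).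
Qed.

Lemma reduction_scalarE (c : K) : (0 <= v c)%E ->
  reduction_scalar Y (residue v c) = reduce (fun=> c).
Proof.
move=> c0; apply/reduce_eq; try by apply: power_bounded_cst => //; apply: integer_ge0.
have : (0 < v (val (repr (residue v c)) - c)%R)%E.
  by apply/residue_eq => //; [apply: integer_ge0|rewrite residueE integer_resK].
move=> /valn_gt0_ge[s s0 sc]; apply: (top_nilpotent_ge s0).
rewrite (_ : _ - _ = (fun=> val (repr (residue v c)) - c)) //.
exact: (analytic_ge_cst _ sc).
Qed.

End Reduction.

(** * The reduced curve *)

Section CurveEquation.
Variable q : nat.
Hypothesis q1 : (1 < q)%N.
Let q0 : (0 < q)%N. Proof. exact: ltnW. Qed.

(** The equation of the reduced curve as a polynomial in x over polynomials
    in y: for a fixed nonzero y it is an additive polynomial in x minus 1. *)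
Definition curve_eq (A : comNzRingType) : {poly {poly A}} :=
  - 'X^q * ('X^(q ^ 2))%:P + 'X * ('X^(q ^ 3))%:P - 1.

Lemma map_curve_eq (A A' : comNzRingType) (f : {rmorphism A -> A'}) :
  map_poly (map_poly f) (curve_eq A) = curve_eq A'.
Proof.
by rewrite /curve_eq !(rmorphD, rmorphM, rmorphN, rmorphXn, rmorph1) /=
  !map_polyC /= ?map_polyX ?map_polyXn.
Qed.

Lemma horner_curve_eq (A : comNzRingType) (x y : A) :
  (curve_eq A).[x%:P].[y] = - x ^+ q * y ^+ (q ^ 2) + x * y ^+ (q ^ 3) - 1.
Proof. by rewrite /curve_eq !hornerE. Qed.

(** Division takes place in powers of x, whereas the presentation of the reduction
    has x as its inner variable. *)
Lemma swap_curve_eq (A : comNzRingType) :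
  swapXY (- ('X%:P) ^+ q * 'X ^+ (q ^ 2) + 'X%:P * 'X ^+ (q ^ 3) - 1) = curve_eq A.
Proof.
rewrite /curve_eq rmorphB rmorphD !rmorphM rmorphN !rmorphXn rmorph1 /=.
by rewrite !swapXY_X !swapXY_Y.
Qed.

Lemma swap_multiple (A : comNzRingType) (p G : {poly {poly A}}) :
  swapXY G = curve_eq A ->
  (exists s : {poly {poly A}}, swapXY p = s * curve_eq A) <->
  exists s, p = s * G.
Proof.
move=> GE; split=> [[s ps]|[s ->]]; last by exists (swapXY s); rewrite rmorphM /= GE.
exists (swapXY s); apply: (can_inj (@swapXYK _)).
by rewrite ps rmorphM /= swapXYK GE.
Qed.

(** The leading coefficient in x is a power of y up to sign, hence the power
    of y. *)
Lemma curve_eq_division (A : comNzRingType) (p : {poly {poly A}}) :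
  exists N Q T,
    ('X^N)%:P * p = Q * curve_eq A + T /\ (size T <= q)%N.
Proof.
pose D : {poly {poly A}} := - curve_eq A.
pose c : {poly A} := 'X^(q ^ 2).
have DE : D = c *: 'X^q + (1 - 'X * ('X^(q ^ 3))%:P).
  by rewrite /D /curve_eq -mul_polyC /c; ring.
have creg : GRing.lreg c by apply/monic_lreg/monicXn.
have s1 : size (c *: 'X^q : {poly {poly A}}) = q.+1.
  by rewrite lreg_size // size_polyXn.
have s2 : (size (1 - 'X * ('X^(q ^ 3))%:P : {poly {poly A}})%R < q.+1)%N.
  apply: leq_ltn_trans (size_polyD _ _) _; rewrite size_polyN size_poly1.
  by rewrite size_XmulC -?size_poly_eq0 ?size_polyXn.
have lD : lead_coef D = c.
  by rewrite DE lead_coefDl ?s1 // lead_coef_lreg // lead_coefXn mulr1.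
have sD : size D = q.+1 by rewrite DE size_polyDl ?s1.
have D0 : D != 0 by rewrite -size_poly_eq0 sD.
have := Pdiv.RingComRreg.rdivp_eq (mulrC D (lead_coef D)%:P) p.
have := Pdiv.Ring.ltn_rmodpN0 p D0; rewrite sD ltnS lD => sT pE.
exists (q ^ 2 * Pdiv.Ring.rscalp p D)%N, (- Pdiv.Ring.rdivp p D), (Pdiv.Ring.rmodp p D).
split=> //; rewrite exprM mulrC -/c pE /D; ring.
Qed.

(** The curve has the equation y w = 1 for some polynomial w, which makes y
    invertible modulo the curve. *)
Lemma curve_eq_unit (A : comNzRingType) N : exists W S : {poly {poly A}},
  W * ('X^N)%:P = 1 + S * curve_eq A.
Proof.
pose w : {poly {poly A}} :=
  - 'X^q * ('X^((q ^ 2).-1))%:P + 'X * ('X^((q ^ 3).-1))%:P.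
have wE : w * 'X%:P = 1 + curve_eq A.
  have e n : 'X^(q ^ n.+1) = 'X^((q ^ n.+1).-1) * 'X :> {poly A}.
    by rewrite -exprSr prednK // expn_gt0 q0.
  by rewrite /curve_eq !e !polyCM /w; ring.
elim: N => [|N [W [S WS]]]; first by exists 1, 0; rewrite expr0 polyC1; ring.
exists (W * w), (1 + S + S * curve_eq A).
rewrite exprS polyCM; have -> : W * w * ('X%:P * ('X^N)%:P) =
  (W * ('X^N)%:P) * (w * 'X%:P) by ring.
by rewrite wE WS; ring.
Qed.

Section Zeros.
Variable k : closedFieldType.
Hypothesis kq : [pchar k].-nat q.

Definition on_curve (x y : k) : Prop :=
  - x ^+ q * y ^+ (q ^ 2) + x * y ^+ (q ^ 3) = 1.

(** Over each y <> 0 the equation is separable in x and has q distinct roots, more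
    than T has unless its leading coefficient vanishes at y. *)
Lemma small_vanish (T : {poly {poly k}}) : (size T <= q)%N ->
  (forall x y, on_curve x y -> T.[x%:P].[y] = 0) -> T = 0.
Proof.
move=> sT Tv; apply/eqP; apply: contraT => T0.
pose c := lead_coef T; have c0 : c != 0 by rewrite lead_coef_eq0.
(* Where c y + 1 = 0, neither y nor c vanishes. *)
have [y /rootP] : exists y, root (c * 'X + 1%:P) y.
  by apply/closed_rootP; rewrite size_MXaddC (negPf c0) /= eqSS size_poly_eq0.
rewrite !hornerE mulrC => yc.
have y0 : y != 0.
  by apply: contra_eqN yc => /eqP ->; rewrite mul0r add0r oner_neq0.
have cy0 : c.[y] != 0.
  by apply: contra_eqN yc => /eqP ->; rewrite mulr0 add0r oner_neq0.
pose a := y ^+ (q ^ 2); pose b := y ^+ (q ^ 3).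
have a0 : a != 0 by rewrite expf_neq0.
have b0 : b != 0 by rewrite expf_neq0.
pose g : {poly k} := - a *: 'X^q + (b *: 'X - 1).
have sg : size g = q.+1.
  rewrite size_polyDl size_scale ?oppr_eq0 // size_polyXn // ltnS.
  apply: leq_trans (size_polyD _ _) _; rewrite size_polyN size_poly1 geq_max q0 andbT.
  by rewrite size_scale // size_polyX.
have gd : g^`() = b%:P.
  have q_0 : q%:R = 0 :> k.
    have qp : pdiv q \in \pi(q) by rewrite pi_pdiv.
    by apply/eqP; rewrite -(dvdn_pcharf (pnatPpi kq qp)) pdiv_dvd.
  rewrite /g derivD derivZ derivXn derivB derivZ derivX -polyC1 derivC subr0.
  by rewrite -scaler_nat q_0 scale0r scaler0 add0r alg_polyC.
have gsep : separable_poly g.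
  by rewrite unlock gd -(mulr1 b%:P) mul_polyC coprimepZr ?coprimep1.
have [rs rsE] := closed_field_poly_normal g.
have g0 : g != 0 by rewrite -size_poly_eq0 sg.
have lg0 : lead_coef g != 0 by rewrite lead_coef_eq0.
have rsu : uniq rs.
  rewrite -separable_prod_XsubC -(eqp_separable (p := g)) //.
  by rewrite {1}rsE eqp_scale.
have rss : size rs = q.
  by apply: succn_inj; rewrite -(size_prod_XsubC rs id) -(size_scale _ lg0) -rsE.
pose Ty := map_poly (horner_eval y) T.
have Ty0 : Ty = 0.
  apply/eqP; apply: contraT => nTy; suff : (size rs < q)%N by rewrite rss ltnn.
  apply: leq_trans (leq_trans (size_poly _ _) sT).
  apply: (max_poly_roots nTy _ rsu); apply/allP => z zrs.
  have gz : g.[z] = 0.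
    apply/eqP; rewrite rsE hornerZ mulf_eq0; apply/orP; right.
    by rewrite -[_ == 0]/(root _ z) root_prod_XsubC.
  have -> : root Ty z = (T.[z%:P].[y] == 0).
    by rewrite rootE -[X in Ty.[X]](hornerC z y) (horner_map (horner_eval y)).
  have gE : g.[z] = - a * z ^+ q + (b * z - 1) by rewrite /g !hornerE.
  apply/eqP; apply: Tv; rewrite /on_curve; move: gz; rewrite gE => gz.
  apply/eqP; rewrite -subr_eq0 -[X in _ == X]gz /a /b; apply/eqP; ring.
have := congr1 (fun p : {poly k} => p`_(size T).-1) Ty0.
by rewrite coef0 coef_map /= -lead_coefE => /eqP; rewrite -/c /horner_eval (negPf cy0).
Qed.

(** A power of y times p is congruent to a polynomial of degree less than q in x,
    which vanishes; the power of y can be inverted modulo the curve. *)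
Lemma curve_nullstellensatz (p : {poly {poly k}}) :
  (forall x y, on_curve x y -> p.[x%:P].[y] = 0) ->
  exists s, p = s * curve_eq k.
Proof.
move=> pv; have [N [Q [T [pE sT]]]] := curve_eq_division p.
have T0 : T = 0.
  apply: small_vanish sT _ => x y xy.
  have -> : T = ('X^N)%:P * p - Q * curve_eq k by rewrite pE addrAC subrr add0r.
  rewrite 2!hornerD 2!hornerN 4!hornerM pv // horner_curve_eq xy.
  by rewrite subrr !mulr0 subr0.
have [W [S WS]] := curve_eq_unit k N; exists (W * Q - S * p).
have : W * (('X^N)%:P * p) = W * Q * curve_eq k by rewrite pE T0; ring.
rewrite mulrA WS => E; apply/eqP; rewrite mulrBl -E -subr_eq0; apply/eqP; ring.
Qed.

End Zeros.

End CurveEquation.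

Section ResiduePolynomials.
Variables (R : realType) (K : fieldType) (v : valuation R K).
Local Notation O := (integer v).
Local Notation k := (residue_field v).
Local Notation res := (@integer_res R K v).

Definition red2 (p : {poly {poly O}}) : {poly {poly k}} :=
  map_poly (map_poly res) p.

Fact red2_zmod : zmod_morphism red2.
Proof. by move=> p p'; rewrite /red2 rmorphB. Qed.
Fact red2_monoid : monoid_morphism red2.
Proof. by split=> [|p p']; rewrite /red2 ?rmorph1 ?rmorphM. Qed.
HB.instance Definition _ := GRing.isZmodMorphism.Build _ _ red2 red2_zmod.
HB.instance Definition _ := GRing.isMonoidMorphism.Build _ _ red2 red2_monoid.

Lemma horner_red2 (p : {poly {poly O}}) (a b : O) :
  (red2 p).[(res a)%:P].[res b] = res p.[a%:P].[b].
Proof.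
have := horner_map (map_poly res) p a%:P; rewrite /= map_polyC /= /red2 => ->.
exact: (horner_map res).
Qed.

Lemma swap_red2C a : swapXY (red2 a%:P%:P) = (res a)%:P%:P.
Proof. by rewrite /red2 !map_polyC /= map_polyC swapXY_polyC map_polyC. Qed.
Lemma swap_red2X : swapXY (red2 'X) = 'X%:P.
Proof. by rewrite /red2 map_polyX swapXY_X. Qed.
Lemma swap_red2Y : swapXY (red2 'X%:P) = 'X.
Proof. by rewrite /red2 map_polyC /= map_polyX swapXY_Y. Qed.

Lemma red2_curve_congr q (p p' : {poly {poly O}}) :
  red2 p = red2 p' * curve_eq q k -> red2 (p - p' * curve_eq q O) = 0.
Proof.
by move=> pE; rewrite rmorphB rmorphM /= [red2 (curve_eq _ _)]map_curve_eq pE subrr.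
Qed.

Lemma red2_surj (p : {poly {poly k}}) : exists p', red2 p' = p.
Proof.
exists (\poly_(i < size p) \poly_(j < size p`_i) repr p`_i`_j).
apply/polyP => i; rewrite coef_map coef_poly.
case: ltnP => [_|/(nth_default 0) ->]; last by rewrite [LHS]map_poly0.
apply/polyP => j; rewrite coef_map coef_poly.
case: ltnP => [_|/(nth_default 0) ->]; last by rewrite [LHS](rmorph0 res).
exact: integer_resK.
Qed.

Lemma integer_div (c a : O) : c != 0 -> (v (val c) <= v (val a))%E ->
  exists b, a = c * b.
Proof.
move=> c0 ca; have vc0 : val c != 0 by rewrite -(inj_eq val_inj) rmorph0 in c0.
have [b bE] : {b : O | val b = val a / val c}.
  apply: mk_integer; rewrite valnM valnV // sube_ge0 //.
  by rewrite (valn_fin v vc0).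
by exists b; apply: val_inj; rewrite rmorphM /= bE mulrC divfK.
Qed.

(** A coefficient of minimal valuation divides all others. *)
Lemma primitive_part (p : {poly {poly O}}) : p != 0 ->
  exists c p', [/\ c != 0, p = c%:P%:P * p', red2 p' != 0 & (size p' <= size p)%N].
Proof.
move=> p0; pose pC i := map_poly (integer_val (v := v)) p`_i.
have pCE i j : (pC i)`_j = val p`_i`_j by rewrite coef_map_id0 // -(rmorph0 val).
have /choice[J JP] i : exists j, forall j', (v (val p`_i`_j) <= v (val p`_i`_j'))%E.
  have [pi0|pi0] := eqVneq (pC i) 0.
    exists 0%N => j'; rewrite -!pCE pi0 !coef0; exact: lexx.
  have [j _ jP] := valn_min_coef v pi0; exists j => j'.
  by have := jP j'; rewrite !pCE.
pose P := \poly_(i < size p) val p`_i`_(J i).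
have PE i : P`_i = val p`_i`_(J i).
  rewrite coef_poly; case: ltnP => // /(nth_default 0) ->.
  by rewrite coef0 rmorph0.
have P0 : P != 0.
  apply: contra p0 => /eqP P0; apply/eqP/polyP => i; apply/polyP => j.
  rewrite !coef0; apply/val_inj/(valn_pinfty v)/eqP; rewrite -leye_eq.
  by have := JP i j; rewrite -PE P0 coef0 valn0.
have [i Pi0 iP] := valn_min_coef v P0; pose c := p`_i`_(J i).
have c0 : c != 0 by rewrite -(inj_eq val_inj) rmorph0 /c -PE.
have cP i' j' : (v (val c) <= v (val p`_i'`_j'))%E.
  by rewrite /c -PE; apply: le_trans (iP i') _; rewrite PE.
have /choice[D DP] ij : exists b, p`_(ij.1)`_(ij.2) = c * b.
  exact: integer_div.
pose p' := \poly_(i < size p) \poly_(j < size p`_i) D (i, j).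
have p'E : p = c%:P%:P * p'.
  apply/polyP => i'; apply/polyP => j'; rewrite coefCM coefCM coef_poly.
  case: ltnP => [_|/(nth_default 0) ->]; last by rewrite !coef0 mulr0.
  rewrite coef_poly; case: ltnP => [_|/(nth_default 0) ->]; last by rewrite mulr0.
  exact: (DP (i', j')).
exists c, p'; split=> //; last exact: size_poly.
apply/eqP => /(congr1 (fun P : {poly {poly k}} => P`_i`_(J i))).
rewrite !coef_map /= !coef0 => /res_eq0.
have cc : c * p'`_i`_(J i) = c.
  by have := congr1 (fun P : {poly {poly O}} => P`_i`_(J i)) p'E; rewrite !coefCM.
have vc0 : val c != 0 by rewrite -(inj_eq val_inj) rmorph0 in c0.
have -> : val p'`_i`_(J i) = 1.
  by apply: (mulfI vc0); rewrite mulr1 -rmorphM cc.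
by rewrite valn1 ltxx.
Qed.

End ResiduePolynomials.

(** * Lubin-Tate torsion *)

Section LubinTate.
Variables (K : fieldType) (q : nat) (pi : K).
Hypothesis Kq : [pchar K].-nat q.

Let exprD (x y : K) : (x + y) ^+ q = x ^+ q + y ^+ q.
Proof. exact: exprDn_pchar. Qed.
Let exprB (x y : K) : (x - y) ^+ q = x ^+ q - y ^+ q.
Proof. exact: exprB_pchar. Qed.

Lemma lt_piB (x y : K) : lt_pi q pi (x - y) = lt_pi q pi x - lt_pi q pi y.
Proof. by rewrite /lt_pi exprB; ring. Qed.

Lemma pi_uD (u x y : K) : pi_u q pi u (x + y) = pi_u q pi u x + pi_u q pi u y.
Proof.
by rewrite /pi_u exprD (exprDn_pchar x y (pchar_natX Kq 2)); ring.
Qed.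

Lemma pi_uZ (u c x : K) : c ^+ q = c -> pi_u q pi u (c * x) = c * pi_u q pi u x.
Proof.
by move=> cq; rewrite /pi_u !exprMn (expr_fixed_iter 2 cq) cq; ring.
Qed.

(** The Moore determinant of two pi-torsion points; mu2 is its analogue for points
    of level pi^2. *)
Definition moore (x y : K) : K := x * y ^+ q - x ^+ q * y.

(** Frobenius multiplies the determinant by pi, since x ^ (q ^ 2) and y ^ (q ^ 2)
    are combinations of x ^ q, x and of y ^ q, y with the same coefficients. *)
Lemma moore_torsion (u x y : K) : pi_u q pi u x = 0 -> pi_u q pi u y = 0 ->
  lt_pi q pi (moore x y) = 0.
Proof.
have expq z : pi_u q pi u z = 0 -> z ^+ (q ^ 2) = - (u * z ^+ q + pi * z).
  by move/eqP; rewrite /pi_u -addrA addr_eq0 => /eqP.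
move=> /expq xq /expq yq; rewrite /lt_pi /moore exprB !exprMn -!exprM.
by rewrite -[(q * q)%N]/(q ^ 2)%N xq yq; ring.
Qed.

(** The same computation with [pi]_u X2 = X1 and [pi]_u Y2 = Y1 leaves the
    determinant of X1 and Y1 as a correction term. *)
Lemma mu2_torsion (P : triple K) :
  pi_u q pi (tu P) (tX1 q pi P) = 0 -> pi_u q pi (tu P) (tY1 q pi P) = 0 ->
  lt_pi q pi (mu2 q pi P) = moore (tX1 q pi P) (tY1 q pi P).
Proof.
have expq u z w : pi_u q pi u z = w -> z ^+ (q ^ 2) = w - (u * z ^+ q + pi * z).
  by move=> <-; rewrite /pi_u; ring.
rewrite /lt_pi /mu2 /moore; case: P => u X2 Y2 /=.
have : pi_u q pi u X2 = tX1 q pi (Triple u X2 Y2) by [].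
have : pi_u q pi u Y2 = tY1 q pi (Triple u X2 Y2) by [].
move: (tX1 _ _ _) (tY1 _ _ _) => X1 Y1 /expq Y2q /expq X2q /expq X1q /expq Y1q.
rewrite exprD !exprB !exprMn -!exprM -[(q * q)%N]/(q ^ 2)%N X2q Y2q X1q Y1q.
by ring.
Qed.

End LubinTate.

Section Congruence.
Variables (R : realType) (K : fieldType) (v : valuation R K) (s : R).

Lemma valn_congX (x y : K) n : (0 <= v x)%E -> (0 <= v y)%E ->
  (s%:E <= v (x - y)%R)%E -> (s%:E <= v (x ^+ n - y ^+ n)%R)%E.
Proof.
move=> x0 y0 xy; rewrite subrXX -[s]addr0; apply: valnM_ge => //.
by apply: valn_le_sum => i _; apply: valnM_ge0; apply: valnX_ge0.
Qed.

End Congruence.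

Section Uniformizers.
Variables (R : realType) (C : fieldType) (v : valuation R C) (q : nat).
Variables (pi pi2 alpha : C).
Hypotheses (q1 : (1 < q)%N) (Cq : [pchar C].-nat q) (v_pi : v pi = 1%:E).
Hypothesis hpi2 : lt_generator q pi pi2.
Hypothesis halpha : alpha ^+ (q ^ 2 * (q + 1)) = pi2.

Local Notation r := q.-1.
Local Notation Q := (q%:R : R).

(** The valuation of alpha, of which all the valuations that occur are integer
    multiples. *)
Definition alpha_val : R := 1 / (Q ^+ 3 * (Q ^+ 2 - 1)).

Let Q1 : 1 < Q. Proof. by rewrite ltr1n. Qed.
Let r0 : (0 < r)%N. Proof. by case: (q) q1 => [|[]]. Qed.
Let qr : q = r.+1. Proof. by rewrite prednK // ltnW. Qed.
Let rE : r%:R = Q - 1. Proof. by rewrite [in RHS]qr -natr1 addrK. Qed.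
Let Q21 : Q ^+ 2 - 1 > 0. Proof. by rewrite subr_gt0 exprn_egt1. Qed.
Let Q0 : 0 < Q. Proof. by apply: lt_trans Q1. Qed.

Lemma alpha_val_gt0 : 0 < alpha_val.
Proof. by rewrite divr_gt0 // mulr_gt0 // exprn_gt0. Qed.

Lemma alpha_val_mulrn n (x : R) :
  n%:R = x * (Q ^+ 3 * (Q ^+ 2 - 1)) -> alpha_val *+ n = x.
Proof.
move=> nx; rewrite -mulr_natr nx /alpha_val div1r mulrC mulfK //.
by rewrite gt_eqF // mulr_gt0 // exprn_gt0.
Qed.

Lemma alpha_val_u : alpha_val *+ (q ^ 3 * r) = 1 / (Q + 1).
Proof.
apply: alpha_val_mulrn; rewrite natrM natrX rE; field.
by rewrite gt_eqF // addr_gt0.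
Qed.
Lemma alpha_val_X1 : alpha_val *+ q ^ 4 = Q / (Q ^+ 2 - 1).
Proof. by apply: alpha_val_mulrn; rewrite natrX; field; rewrite gt_eqF. Qed.
Lemma alpha_val_X2 : alpha_val *+ q ^ 2 = 1 / (Q * (Q ^+ 2 - 1)).
Proof. by apply: alpha_val_mulrn; rewrite natrX; field; rewrite !gt_eqF. Qed.
Lemma alpha_val_pi : alpha_val *+ (q ^ 3 * (r * (q + 1))) = 1.
Proof. by apply: alpha_val_mulrn; rewrite natrM natrX natrM natrD rE; ring. Qed.
Lemma alpha_val_pi2 : alpha_val *+ (q ^ 2 * (q + 1)) = 1 / (Q * (Q - 1)).
Proof.
apply: alpha_val_mulrn; rewrite natrM natrX natrD; field.
by rewrite !gt_eqF // subr_gt0.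
Qed.

Local Notation pi1 := (lt_pi q pi pi2).

Lemma pi1_pow : pi1 ^+ r = pi.
Proof.
case: hpi2 => /eqP; rewrite {1}/lt_pi subr_eq0 => /eqP H /eqP pi1n0.
by apply: (mulIf pi1n0); rewrite -exprSr -qr H.
Qed.

Let pi2_neq0 : pi2 != 0.
Proof.
case: hpi2 => _ /eqP; apply: contraNneq => ->.
by rewrite /lt_pi mulr0 expr0n gtn_eqF ?subrr // ltnW.
Qed.

(** Let pi1 = pi pi2 - pi2 ^ q. If pi pi2 had valuation at most that of pi2 ^ q,
    then v pi2 >= v pi1 >= 1 + v pi2, which is absurd; so pi2 ^ q dominates. *)
Lemma v_pi2 : v pi2 = (1 / (Q * (Q - 1)))%:E.
Proof.
have pi1_neq0 : pi1 != 0 by case: hpi2 => _ /eqP.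
have [a pi1a] := valnE v pi1_neq0; have [b pi2b] := valnE v pi2_neq0.
have Q10 : 0 < Q - 1 by rewrite subr_gt0.
have aE : a * (Q - 1) = 1.
  rewrite -rE mulr_natr; apply: EFin_inj.
  by rewrite -(valnX_fin r pi1a) pi1_pow v_pi.
have qb : v (pi2 ^+ q) = (b * Q)%:E by rewrite mulr_natr; apply: valnX_fin.
have pb : v (pi * pi2) = (1 + b)%:E by apply: valnM_fin.
have [bq|bq] := ltP (b * Q) (1 + b).
  suff bQ : b * Q = a.
    rewrite pi2b; congr (_%:E); apply: (canRL (mulfK _)).
      by rewrite mulf_neq0 // gt_eqF.
    by rewrite mulrA bQ.
  apply: EFin_inj; rewrite -qb -pi1a /lt_pi -opprB valnN.
  by apply/esym/valnD_gtr; rewrite valnN qb pb lte_fin.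
have : ((1 + b)%:E <= v pi1)%E by apply: valnB_ge; rewrite ?pb ?qb ?lee_fin.
rewrite pi1a lee_fin => ab.
have : a <= b by rewrite -(ler_pM2r Q10) aE mulrBr mulr1 lerBrDr.
by move/(le_trans ab); rewrite gerDr leNgt ltr01.
Qed.

Let alpha_exp_gt0 : (0 < q ^ 2 * (q + 1))%N.
Proof. by rewrite muln_gt0 expn_gt0 addn1 ltnW. Qed.

Lemma alpha_neq0 : alpha != 0.
Proof.
apply: contraNneq pi2_neq0 => a0.
by rewrite -halpha a0 expr0n gtn_eqF.
Qed.

Lemma v_alpha : v alpha = alpha_val%:E.
Proof.
have [a va] := valnE v alpha_neq0; rewrite va; congr (_%:E).
have := valnX_fin (q ^ 2 * (q + 1)) va; rewrite halpha v_pi2 -alpha_val_pi2 => -[] /eqP.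
by rewrite eqr_pMn2r // => /eqP.
Qed.

Lemma v_alphaX n : v (alpha ^+ n) = (alpha_val *+ n)%:E.
Proof. exact: valnX_fin v_alpha. Qed.

Lemma sign_pchar : (-1) ^+ r = 1 :> C.
Proof.
apply: (mulIf (oner_neq0 C)); apply: oppr_inj; rewrite -[LHS]mulrN -exprSr -qr.
have := exprB_pchar Cq 0 1; rewrite sub0r expr1n expr0n gtn_eqF ?sub0r //=.
  by rewrite mulr1.
exact: ltnW.
Qed.

(** The unit by which pi differs from the power of alpha of the same valuation. It
    is congruent to 1, because pi = pi1 ^ (q - 1) and pi1 agrees with - pi2 ^ q
    to first order. *)
Definition varpi : C := pi / alpha ^+ (q ^ 3 * (r * (q + 1))).

Lemma varpiE : pi = alpha ^+ (q ^ 3 * (r * (q + 1))) * varpi.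
Proof. by rewrite mulrC divfK // expf_neq0 // alpha_neq0. Qed.

Lemma v_varpi : v varpi = 0%E.
Proof.
have := valnM_fin v_pi (valnV_fin (v_alphaX (q ^ 3 * (r * (q + 1))))).
by rewrite alpha_val_pi subrr.
Qed.

(** In units of pi2 the Lubin-Tate endomorphism is - z ^ q up to a small linear
    term, whose coefficient is this ratio. *)
Definition lt_ratio : C := pi / pi2 ^+ r.

Lemma lt_pi_scale z : lt_pi q pi (pi2 * z) = pi2 ^+ q * (lt_ratio * z - z ^+ q).
Proof.
have p2r : pi2 ^+ r != 0 by rewrite expf_neq0.
have pq : pi2 ^+ q = pi2 * pi2 ^+ r by rewrite -exprS -qr.
by rewrite /lt_pi exprMn /lt_ratio pq; field.
Qed.

Lemma v_lt_ratio : (alpha_val%:E <= v lt_ratio)%E.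
Proof.
rewrite /lt_ratio (valnM_fin v_pi (valnV_fin (valnX_fin r v_pi2))) lee_fin.
have -> : 1 - (1 / (Q * (Q - 1))) *+ r = (Q - 1) / Q.
  by rewrite -mulr_natr rE; field; rewrite !gt_eqF // subr_gt0.
have Q2 : 1 <= Q - 1 by rewrite lerBrDr -[1 + 1]/(2%:R : R) ler_nat.
have Q22 : 1 <= Q ^+ 2 - 1.
  by apply: le_trans Q2 _; rewrite lerD2r ler_eXnr // ltW.
apply: (@le_trans _ _ (1 / Q)); last by rewrite ler_pM2r // invr_gt0.
rewrite /alpha_val !div1r lef_pV2 ?posrE ?mulr_gt0 ?exprn_gt0 //.
apply: (@le_trans _ _ (Q ^+ 3)); first by rewrite ler_eXnr // ltW.
by rewrite ler_peMr // exprn_ge0 // ltW.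
Qed.

Lemma varpi_close : (alpha_val%:E <= v (varpi - 1)%R)%E.
Proof.
have p2r : pi2 ^+ r != 0 by rewrite expf_neq0.
have -> : varpi = (1 - lt_ratio) ^+ r.
  rewrite /varpi; have -> : alpha ^+ (q ^ 3 * (r * (q + 1))) = (pi2 ^+ q) ^+ r.
    by rewrite -halpha -!exprM; congr (_ ^+ _); lia.
  have pi1E : pi1 = - 1 * (pi2 ^+ q * (1 - lt_ratio)).
    by have := lt_pi_scale 1; rewrite expr1n !mulr1 => ->; ring.
  rewrite -{1}pi1_pow pi1E exprMn sign_pchar mul1r exprMn mulrAC divff ?mul1r //.
  by rewrite expf_neq0 // expf_neq0.
rewrite -[X in _ - X](expr1n _ r); apply: valn_congX.
- apply: valnB_ge; rewrite ?valn1 //; apply: le_trans v_lt_ratio.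
  by rewrite lee_fin ltW // alpha_val_gt0.
- by rewrite valn1.
by rewrite addrAC subrr sub0r valnN v_lt_ratio.
Qed.

End Uniformizers.

(** * Normalized equations and lifting of points *)

Section Normalized.
Variables (R : realType) (C : closedFieldType) (v : valuation R C) (q : nat).
Variables (pi pi2 alpha : C).
Hypotheses (q1 : (1 < q)%N) (Cq : [pchar C].-nat q) (v_pi : v pi = 1%:E).
Hypothesis hpi2 : lt_generator q pi pi2.
Hypothesis halpha : alpha ^+ (q ^ 2 * (q + 1)) = pi2.

Local Notation r := q.-1.
Local Notation m := (q.-1 ^ 2 * (q + 1))%N.
Local Notation varpi := (varpi q pi alpha).
Local Notation alpha_val := (alpha_val R q).
Let qr : q = r.+1. Proof. by rewrite prednK // ltnW. Qed.
Let r0 : (0 < r)%N. Proof. by case: (q) q1 => [|[]]. Qed.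
Let q0 : (0 < q)%N. Proof. exact: ltnW. Qed.
Let m0 : (0 < m)%N. Proof. by rewrite muln_gt0 expn_gt0 r0 addn1. Qed.

(** In the coordinates u = alpha ^ (q ^ 3 (q - 1)) U, X1 = alpha ^ (q ^ 4) A,
    Y1 = alpha ^ (q ^ 2) B, X2 = alpha ^ (q ^ 2) x, Y2 = alpha y, every
    defining equation becomes one with unit coefficients, up to terms divisible
    by a positive power of alpha. The coordinates X2 and Y1 have the same
    valuation, so norm_X serves for both. *)
Definition norm_A (U z : C) :=
  alpha ^+ (q ^ 3 * m) * z ^+ (q ^ 2) + U * z ^+ q + varpi * z.
Definition norm_X (U z : C) :=
  z ^+ (q ^ 2) + U * z ^+ q + alpha ^+ (q ^ 2 * m) * (varpi * z).
Definition norm_Y (U z : C) :=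
  z ^+ (q ^ 2) + alpha ^+ (q * m) * (U * z ^+ q)
  + alpha ^+ ((q ^ 2 + q + 1) * m) * (varpi * z).
Definition norm_mu (A B x y : C) :=
  alpha ^+ (q * m) * (A * y ^+ q) - alpha ^+ ((q ^ 2 + q + 1) * m) * (A ^+ q * y)
  - x ^+ q * B + x * B ^+ q.

Lemma pi_u_normA U z :
  pi_u q pi (alpha ^+ (q ^ 3 * r) * U) (alpha ^+ (q ^ 4) * z) =
  alpha ^+ (q ^ 3 * (r * (q + 1)) + q ^ 4) * norm_A U z.
Proof.
have e1 : alpha ^+ (q ^ 4 * q ^ 2) =
    alpha ^+ (q ^ 3 * (r * (q + 1)) + q ^ 4) * alpha ^+ (q ^ 3 * m).
  by rewrite -exprD; congr (_ ^+ _); rewrite [in LHS]qr [in RHS]qr /=; lia.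
have e2 : alpha ^+ (q ^ 3 * r) * alpha ^+ (q ^ 4 * q) =
    alpha ^+ (q ^ 3 * (r * (q + 1)) + q ^ 4).
  by rewrite -exprD; congr (_ ^+ _); rewrite [in LHS]qr [in RHS]qr /=; lia.
rewrite /pi_u /norm_A [in pi * _](varpiE q1 hpi2 halpha) !exprMn -!exprM e1.
rewrite mulrACA e2 exprD; ring.
Qed.

Lemma pi_u_normX U z :
  pi_u q pi (alpha ^+ (q ^ 3 * r) * U) (alpha ^+ (q ^ 2) * z) =
  alpha ^+ (q ^ 4) * norm_X U z.
Proof.
have e1 : alpha ^+ (q ^ 2 * q ^ 2) = alpha ^+ (q ^ 4).
  by congr (_ ^+ _); lia.
have e2 : alpha ^+ (q ^ 3 * r) * alpha ^+ (q ^ 2 * q) = alpha ^+ (q ^ 4).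
  by rewrite -exprD; congr (_ ^+ _); rewrite [in LHS]qr [in RHS]qr /=; lia.
have e3 : alpha ^+ (q ^ 3 * (r * (q + 1))) * alpha ^+ (q ^ 2) =
    alpha ^+ (q ^ 4) * alpha ^+ (q ^ 2 * m).
  by rewrite -!exprD; congr (_ ^+ _); rewrite [in LHS]qr [in RHS]qr /=; lia.
rewrite /pi_u /norm_X [in pi * _](varpiE q1 hpi2 halpha) !exprMn -!exprM e1.
rewrite mulrACA e2 [_ * varpi * _]mulrACA e3; ring.
Qed.

Lemma pi_u_normY U z :
  pi_u q pi (alpha ^+ (q ^ 3 * r) * U) (alpha * z) =
  alpha ^+ (q ^ 2) * norm_Y U z.
Proof.
have e2 : alpha ^+ (q ^ 3 * r) * alpha ^+ q =
    alpha ^+ (q ^ 2) * alpha ^+ (q * m).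
  by rewrite -!exprD; congr (_ ^+ _); rewrite [in LHS]qr [in RHS]qr /=; lia.
have e3 : alpha ^+ (q ^ 3 * (r * (q + 1))) * alpha =
    alpha ^+ (q ^ 2) * alpha ^+ ((q ^ 2 + q + 1) * m).
  by rewrite -exprSr -exprD; congr (_ ^+ _); rewrite [in LHS]qr [in RHS]qr /=; lia.
rewrite /pi_u /norm_Y [in pi * _](varpiE q1 hpi2 halpha) !exprMn.
rewrite mulrACA e2 [_ * varpi * _]mulrACA e3; ring.
Qed.

Lemma mu2_norm U A B x y :
  let P := Triple (alpha ^+ (q ^ 3 * r) * U) (alpha ^+ (q ^ 2) * x) (alpha * y) in
  norm_X U x = A -> norm_Y U y = B -> mu2 q pi P = pi2 * norm_mu A B x y.
Proof.
move=> P xA yB; rewrite /mu2 /tX1 /tY1 /= pi_u_normX pi_u_normY xA yB.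
have e1 : alpha ^+ (q ^ 4) * alpha ^+ q = pi2 * alpha ^+ (q * m).
  by rewrite -halpha -!exprD; congr (_ ^+ _); rewrite [in LHS]qr [in RHS]qr /=; lia.
have e2 : alpha ^+ (q ^ 4 * q) * alpha = pi2 * alpha ^+ ((q ^ 2 + q + 1) * m).
  by rewrite -halpha -exprSr -exprD; congr (_ ^+ _); rewrite [in LHS]qr [in RHS]qr /=; lia.
have e3 : alpha ^+ (q ^ 2 * q) * alpha ^+ (q ^ 2) = pi2.
  by rewrite -halpha -exprD; congr (_ ^+ _); lia.
rewrite /norm_mu !exprMn -!exprM mulrACA e1 [_ * A ^+ q * _]mulrACA e2.
rewrite [_ * x ^+ q * _]mulrACA e3 [_ * x * _]mulrACA [alpha ^+ _ * alpha ^+ (_ * q)]mulrC e3.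
ring.
Qed.

Local Notation O := (integer v).
Local Notation k := (residue_field v).
Local Notation res := (@integer_res R C v).

Lemma trinomial_monic (a b c : C) :
  ('X^(q ^ 2) + (a *: 'X^q + b *: 'X + c%:P)) \is monic /\
  size ('X^(q ^ 2) + (a *: 'X^q + b *: 'X + c%:P)) = (q ^ 2).+1.
Proof.
have sz : (size (a *: 'X^q + b *: 'X + c%:P)%R < size ('X^(q ^ 2) : {poly C}))%N.
  rewrite size_polyXn ltnS; apply: leq_trans (size_polyD _ _) _.
  rewrite geq_max (leq_trans (size_polyC_leq1 _)) ?expn_gt0 ?q0 // andbT.
  apply: leq_trans (size_polyD _ _) _; rewrite geq_max.
  rewrite (leq_trans (size_scale_leq _ _)) ?size_polyXn; last by nia.
  by rewrite (leq_trans (size_scale_leq _ _)) ?size_polyX //; nia.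
by rewrite monicE lead_coefDl // lead_coefXn eqxx size_polyDl // size_polyXn.
Qed.

(** Over an algebraically closed field an approximate root of a monic polynomial is
    near an exact one, even where the reduction is inseparable. *)
Lemma trinomial_root (a b c z : O) :
  res (z ^+ (q ^ 2) + a * z ^+ q + b * z + c) = 0 ->
  exists2 z' : O, z' ^+ (q ^ 2) + a * z' ^+ q + b * z' + c = 0 & res z' = res z.
Proof.
move=> /res_eq0 H; have [Pm sP] := trinomial_monic (val a) (val b) (val c).
have PE (w : C) : ('X^(q ^ 2) + (val a *: 'X^q + val b *: 'X + (val c)%:P)).[w] =
    w ^+ (q ^ 2) + val a * w ^+ q + val b * w + val c by rewrite !hornerE.
have [|w rw zw] := @exists_close_root _ _ v _ (val z) 0 Pm.
  by move: H; rewrite !(rmorphD, rmorphM, rmorphXn) /= PE mul0rn.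
have w0 : (0 <= v w)%E.
  rewrite -[w](subKr (val z)); apply: valnB_ge; first exact: integer_ge0.
  exact: ltW.
have [z' z'w] := mk_integer w0; exists z'; last first.
  by apply/res_eq; rewrite z'w -opprB valnN.
apply: val_inj; rewrite !(rmorphD, rmorphM, rmorphXn, rmorph0) /= z'w.
by move: rw; rewrite rootE PE => /eqP.
Qed.

Lemma residue_pchar : [pchar k].-nat q.
Proof.
apply: sub_in_pnat Cq => p _; rewrite !inE => /andP[pp /eqP p0]; rewrite pp /=.
apply/eqP; rewrite -(rmorph_nat res); apply/res_eq0.
by rewrite rmorph_nat p0 valn0 ltry.
Qed.

Let va := v_alpha q1 v_pi hpi2 halpha.
Let av0 : 0 < alpha_val := alpha_val_gt0 R q1.

(** Adding to Y2 a multiple of the torsion point Y1 by an element of the field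
    with q elements moves mu2 by the corresponding torsion point of the
    Lubin-Tate group, so that a value of mu2 close to pi2 can be corrected to
    pi2 itself. *)
Lemma correct_mu2 (P : triple C) (M : O) :
  pi_u q pi (tu P) (tX1 q pi P) = 0 -> pi_u q pi (tu P) (tY1 q pi P) = 0 ->
  mu2 q pi P = pi2 * val M -> res M = 1 ->
  exists c, [/\ (0 <= v c)%E, c ^+ q = c &
    mu2 q pi (Triple (tu P) (tX2 P) (tY2 P + c * tY1 q pi P)) = pi2].
Proof.
move=> X0 Y0 PM M1; have mP := mu2_torsion Cq X0 Y0.
have m0' := moore_torsion Cq X0 Y0; set m1 := moore _ _ _ in mP m0'.
have [pi1_0 /eqP pi1n0] := hpi2; set pi1 := lt_pi q pi pi2 in pi1_0 pi1n0.
have fixed a : lt_pi q pi a = 0 -> (a / pi1) ^+ q = a / pi1.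
  move=> /eqP; rewrite /lt_pi subr_eq0 => /eqP aq.
  move/eqP: pi1_0; rewrite /lt_pi subr_eq0 => /eqP pq.
  rewrite exprMn exprVn -aq -pq invfM mulrACA divff ?mul1r //.
  by apply/eqP => p0; move: (v_pi); rewrite p0 valn0.
pose rho := lt_ratio q pi pi2.
have rho0 : (0 < v rho)%E.
  by apply: lt_le_trans (v_lt_ratio q1 v_pi hpi2); rewrite lte_fin.
have vr1 : v (rho - 1) = 0%E.
  by rewrite -(valn1 v) -(valnN v 1) addrC; apply: valnD_gtr; rewrite valnN valn1.
have p2n0 : pi2 != 0 by apply/eqP => p0; move: (v_pi2 q1 v_pi hpi2); rewrite p0 valn0.
have pi1E : pi1 = pi2 ^+ q * (rho - 1).
  have := lt_pi_scale q1 hpi2 1.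
  by rewrite expr1n !mulr1.
have m1E : m1 = pi2 ^+ q * (rho * val M - val M ^+ q).
  by rewrite -mP PM (lt_pi_scale q1 hpi2).
(* The ratio of two nonzero roots of pi z = z ^ q is fixed by Frobenius, and
   here it is close to 1. *)
have c1 : m1 / pi1 = 1.
  apply/eqP; rewrite -subr_eq0; apply/eqP; apply: contrapT => /eqP cn1.
  have cq : (m1 / pi1 - 1) ^+ q = m1 / pi1 - 1.
    by rewrite (exprB_pchar Cq) expr1n fixed.
  have := valn_expr_fixed v q1 cq cn1.
  have -> : m1 / pi1 - 1 = (rho * (val M - 1) - (val M ^+ q - 1)) / (rho - 1).
    rewrite m1E pi1E; field.
    by rewrite (valn_neq0 vr1) expf_neq0.
  rewrite valnM (valnV_fin vr1) oppr0 adde0.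
  have M1' : (0 < v (val M - 1)%R)%E by apply/(res_eq M 1); rewrite rmorph1.
  suff : (0 < v (rho * (val M - 1) - (val M ^+ q - 1))%R)%E by move=> + v0; rewrite v0 ltxx.
  apply: valnB_gt; first by rewrite valnM adde_gt0.
  rewrite -rmorphXn; apply/(res_eq (M ^+ q) 1).
  by rewrite rmorphXn /= M1 rmorph1 expr1n.
have m1pi1 : m1 = pi1 by rewrite -[LHS](divfK pi1n0) c1 mul1r.
pose c := (pi2 - mu2 q pi P) / pi1.
have cq : c ^+ q = c by apply: fixed; rewrite (lt_piB _ Cq) mP -/pi1 m1pi1 subrr.
exists c; split=> //.
  have [->|c0] := eqVneq c 0; first by rewrite valn0 leey.
  by rewrite (valn_expr_fixed v q1 cq c0).
rewrite /mu2 /tX1 /tY1 /= -/(tX1 q pi P) (pi_uD _ Cq) pi_uZ // -/(tY1 q pi P) Y0.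
rewrite mulr0 addr0 (exprDn_pchar _ _ Cq) exprMn cq.
have := divfK pi1n0 (pi2 - mu2 q pi P); rewrite -/c -{1}m1pi1 /m1 /moore => /eqP.
rewrite eq_sym subr_eq => /eqP ->; rewrite /mu2; ring.
Qed.

(** Every point of the reduced curve lifts: choose X1 with the residue it has to
    have, let the torsion equation of X1 define u, and find X2, Y1 and Y2 as
    roots near their prescribed residues. *)
Lemma lift_point (x y : O) :
  - res x ^+ q * res y ^+ (q ^ 2) + res x * res y ^+ (q ^ 3) = 1 ->
  exists (P : triple C) (x' y' : O), [/\ in_Y31e1 q pi v pi2 P,
    tX2 P = alpha ^+ (q ^ 2) * val x', tY2 P = alpha * val y',
    res x' = res x & res y' = res y].
Proof.
move=> xy; have kq := residue_pchar.
have [t tE] : {t : O | val t = alpha} by apply: mk_integer; rewrite va lee_fin ltW.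
have t0 n : (0 < n)%N -> res t ^+ n = 0.
  move=> n0; suff -> : res t = 0 by rewrite expr0n gtn_eqF.
  by apply/res_eq0; rewrite tE va lte_fin.
have t0X n (z : k) : (0 < n)%N -> res t ^+ (n * m) * z = 0.
  by move=> n0; rewrite t0 ?mul0r // muln_gt0 n0 m0.
have [w wE] : {w : O | val w = varpi}.
  by apply: mk_integer; rewrite (v_varpi q1 v_pi hpi2 halpha).
have y0 : res y != 0.
  apply: contraTneq (oner_neq0 k) => y0; rewrite -xy y0 !expr0n !gtn_eqF ?expn_gt0 ?q0 //.
  by rewrite !mulr0 addr0 eqxx.
have vy0 : v (val y) = 0%E by apply/res_neq0.
have [yi yiE] : {yi : O | val yi = (val y)^-1}.
  by apply: mk_integer; rewrite valnV ?vy0 ?oppe0 // (valn_neq0 vy0).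
have yyi : y * yi = 1.
  by apply: val_inj; rewrite rmorphM rmorph1 /= yiE divff // (valn_neq0 vy0).
pose Z := y ^+ (q ^ 3); pose A := - yi ^+ (q ^ 3).
have ZA : Z * A = -1 by rewrite mulrN -exprMn yyi expr1n.
have ZE : res Z = res y ^+ (q ^ 3) by rewrite rmorphXn.
clearbody Z A => {yi yiE yyi}.
(* The torsion equation norm_A U A = 0, solved for U. *)
pose U := - (w * A + t ^+ (q ^ 3 * m) * A ^+ (q ^ 2)) * (- Z) ^+ q.
have w1 : res w = 1.
  rewrite -(rmorph1 res); apply/res_eq; rewrite wE rmorph1.
  by apply: lt_le_trans (varpi_close q1 Cq v_pi hpi2 halpha); rewrite lte_fin.
have nA : t ^+ (q ^ 3 * m) * A ^+ (q ^ 2) + U * A ^+ q + w * A = 0.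
  have AZ : (- Z) ^+ q * A ^+ q = 1 by rewrite -exprMn mulNr ZA opprK expr1n.
  by rewrite -mulrA AZ; ring.
have resU : res U = - res Z ^+ r.
  rewrite rmorphM rmorphN rmorphD !rmorphM /=.
  rewrite [integer_res (t ^+ _)]rmorphXn /= t0X ?expn_gt0 ?q0 //.
  rewrite w1 addr0 mul1r rmorphXn rmorphN /=.
  have -> : (- res Z) ^+ q = - res Z ^+ q.
    by have := exprB_pchar kq 0 (res Z); rewrite expr0n gtn_eqF // !sub0r.
  rewrite [in _ ^+ q]qr exprS mulrNN mulrA -rmorphM [A * Z]mulrC ZA.
  by rewrite rmorphN rmorph1 mulN1r.
clearbody U.
have Zq : res Z * res Z ^+ r = res Z ^+ q by rewrite -exprS -qr.
have [x' x'E x'x] : exists2 x' : O,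
    x' ^+ (q ^ 2) + U * x' ^+ q + t ^+ (q ^ 2 * m) * w * x' + - A = 0 & res x' = res x.
  apply: trinomial_root; rewrite !(rmorphD, rmorphM, rmorphN, rmorphXn) /=.
  rewrite -!mulrA t0X ?expn_gt0 ?q0 // addr0 resU.
  have xyq : - res x ^+ (q ^ 2) * res Z + res x ^+ q * (res Z * res Z ^+ r) = 1.
    rewrite Zq ZE -[RHS](expr1n _ q) -xy (exprDn_pchar _ _ kq) !exprMn.
    rewrite -!exprM -(expnSr q 2).
    have -> : (- res x ^+ q) ^+ q = - res x ^+ (q ^ 2).
      by have := exprB_pchar kq 0 (res x ^+ q);
         rewrite expr0n gtn_eqF // !sub0r -exprM.
    by [].
  have rZA : res Z * res A = -1 by rewrite -rmorphM ZA rmorphN rmorph1.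
  rewrite -[res A]mul1r -[X in X * res A]xyq.
  have -> : - ((- res x ^+ (q ^ 2) * res Z + res x ^+ q * (res Z * res Z ^+ r)) *
    res A) = (res Z * res A) * (res x ^+ (q ^ 2) - res x ^+ q * res Z ^+ r) by ring.
  by rewrite rZA; ring.
have [B BE By] : exists2 B : O,
    B ^+ (q ^ 2) + U * B ^+ q + t ^+ (q ^ 2 * m) * w * B + 0 = 0 &
    res B = res (y ^+ (q ^ 2)).
  apply: trinomial_root; rewrite !(rmorphD, rmorphM, rmorphN, rmorphXn) /=.
  rewrite -!mulrA t0X ?expn_gt0 ?q0 // addr0 rmorph0 addr0 resU.
  rewrite -!exprM -(expnSr q 2) -ZE mulNr mulrC Zq ZE -exprM.
  by rewrite -expnSr -expnD subrr.
have [y' y'E y'y] : exists2 y' : O,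
    y' ^+ (q ^ 2) + t ^+ (q * m) * U * y' ^+ q
      + t ^+ ((q ^ 2 + q + 1) * m) * w * y' + - B = 0 & res y' = res y.
  apply: trinomial_root; rewrite !(rmorphD, rmorphM, rmorphN, rmorphXn) /=.
  rewrite -!mulrA !t0X ?addn1 // !addr0 By.
  by rewrite rmorphXn /= subrr.
pose u := alpha ^+ (q ^ 3 * r) * val U.
pose P0 := Triple u (alpha ^+ (q ^ 2) * val x') (alpha * val y').
have nXA : norm_X (val U) (val x') = val A.
  have /eqP := congr1 val x'E.
  rewrite !(rmorphD, rmorphM, rmorphN, rmorphXn, rmorph0) /= tE wE.
  rewrite subr_eq add0r => /eqP <-.
  by rewrite /norm_X; ring.
have nXB : norm_X (val U) (val B) = 0.
  have := congr1 val BE.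
  rewrite !(rmorphD, rmorphM, rmorphN, rmorphXn, rmorph0) /= tE wE addr0 => <-.
  by rewrite /norm_X; ring.
have nYB : norm_Y (val U) (val y') = val B.
  have /eqP := congr1 val y'E.
  rewrite !(rmorphD, rmorphM, rmorphN, rmorphXn, rmorph0) /= tE wE.
  rewrite subr_eq add0r => /eqP <-.
  by rewrite /norm_Y; ring.
have nAA : norm_A (val U) (val A) = 0.
  have := congr1 val nA.
  rewrite !(rmorphD, rmorphM, rmorphN, rmorphXn, rmorph0) /= tE wE => <-.
  by rewrite /norm_A; ring.
have X1E : tX1 q pi P0 = alpha ^+ (q ^ 4) * val A by rewrite /tX1 pi_u_normX nXA.
have Y1E : tY1 q pi P0 = alpha ^+ (q ^ 2) * val B by rewrite /tY1 pi_u_normY nYB.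
have X10 : pi_u q pi u (tX1 q pi P0) = 0 by rewrite X1E pi_u_normA nAA mulr0.
have Y10 : pi_u q pi u (tY1 q pi P0) = 0 by rewrite Y1E pi_u_normX nXB mulr0.
pose M := t ^+ (q * m) * (A * y' ^+ q) - t ^+ ((q ^ 2 + q + 1) * m) * (A ^+ q * y')
  - x' ^+ q * B + x' * B ^+ q.
have M1 : res M = 1.
  rewrite !(rmorphD, rmorphM, rmorphN, rmorphXn) /=.
  rewrite !t0X ?addn1 // subr0 add0r.
  by rewrite By x'x -xy !rmorphXn /= -exprM -expnSr mulNr.
have P0M : mu2 q pi P0 = pi2 * val M.
  rewrite (mu2_norm nXA nYB); congr (_ * _).
  by rewrite /norm_mu /M !(rmorphD, rmorphM, rmorphN, rmorphXn, rmorph0) /= tE.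
have [c [c0 cq cP]] := correct_mu2 X10 Y10 P0M M1.
have [c' c'E] := mk_integer c0.
have q20 : (0 < (q ^ 2).-1)%N by nia.
(* The correction of Y2 is divisible by alpha, so it keeps the residue of y'. *)
pose y2 := y' + c' * t ^+ (q ^ 2).-1 * B.
have y2E : tY2 P0 + c * tY1 q pi P0 = alpha * val y2.
  rewrite Y1E -[tY2 P0]/(alpha * val y') /y2.
  rewrite !(rmorphD, rmorphM, rmorphN, rmorphXn, rmorph0) /= tE c'E mulrDr.
  congr (_ + _).
  have -> : alpha ^+ (q ^ 2) = alpha * alpha ^+ (q ^ 2).-1.
    by rewrite -exprS prednK // expn_gt0 q0.
  ring.
pose P := Triple u (alpha ^+ (q ^ 2) * val x') (alpha * val y2).
exists P, x', y2; split=> //; last first.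
  by rewrite /y2 !(rmorphD, rmorphM, rmorphXn) /= t0 // mulr0 mul0r addr0.
have P_X0 : pi_u q pi u (tX1 q pi P) = 0 by [].
have P_Y1 : tY1 q pi P = tY1 q pi P0.
  rewrite {1}/tY1 /= -/u -y2E (pi_uD _ Cq) pi_uZ // -/(tY1 q pi P0).
  by rewrite Y10 mulr0 addr0.
have rZ0 : res Z != 0 by rewrite ZE expf_neq0.
have vU : v (val U) = 0%E.
  by apply/res_neq0; rewrite resU oppr_eq0 expf_neq0.
have vB : v (val B) = 0%E.
  by apply/res_neq0; rewrite By rmorphXn expf_neq0.
have vA : v (val A) = 0%E.
  apply/res_neq0; have : res Z * res A != 0.
    by rewrite -rmorphM ZA rmorphN rmorph1 oppr_eq0 oner_eq0.
  by rewrite mulf_eq0 negb_or => /andP[].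
have vx : v (val x') = 0%E.
  apply/res_neq0; rewrite x'x; apply: contraTneq (oner_neq0 k) => x0.
  by rewrite -xy x0 expr0n gtn_eqF // oppr0 !mul0r addr0 eqxx.
have vy : v (val y2) = 0%E.
  apply/res_neq0.
  by rewrite /y2 !(rmorphD, rmorphM, rmorphXn) /= t0 // mulr0 mul0r addr0 y'y.
have vM n z : v z = 0%E -> v (alpha ^+ n * z) = (alpha_val *+ n)%:E.
  by move=> z0; rewrite valnM z0 adde0 (valnX_fin n va).
split; split.
- by rewrite vM // lte_fin pmulrn_rgt0 // muln_gt0 expn_gt0 q0.
- exact: P_X0.
- by rewrite -/(tY1 q pi P) P_Y1.
- by rewrite /P -y2E.
- by rewrite vM // alpha_val_u.
- by rewrite -[tX1 _ _ _]/(tX1 q pi P0) X1E vM // alpha_val_X1.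
- by rewrite vM // alpha_val_X2.
- by rewrite P_Y1 Y1E vM // alpha_val_X2.
by rewrite -[tY2 P]/(alpha * val y2) -[alpha]expr1 vM // mulr1n div1r.
Qed.

End Normalized.

(** * Functions on the affinoid modulo alpha *)

Section Coordinates.
Variables (R : realType) (C : closedFieldType) (v : valuation R C) (q : nat).
Variables (pi pi2 alpha : C).
Hypotheses (q1 : (1 < q)%N) (Cq : [pchar C].-nat q) (v_pi : v pi = 1%:E).
Hypothesis hpi2 : lt_generator q pi pi2.
Hypothesis halpha : alpha ^+ (q ^ 2 * (q + 1)) = pi2.

Local Notation r := q.-1.
Local Notation m := (q.-1 ^ 2 * (q + 1))%N.
Local Notation varpi := (varpi q pi alpha).
Local Notation alpha_val := (alpha_val R q).
Local Notation Y := (Y31e1 q pi v pi2).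
Local Notation O := (integer v).
Let qr : q = r.+1. Proof. by rewrite prednK // ltnW. Qed.
Let r0 : (0 < r)%N. Proof. by case: (q) q1 => [|[]]. Qed.
Let q0 : (0 < q)%N. Proof. exact: ltnW. Qed.
Let m0 : (0 < m)%N. Proof. by rewrite muln_gt0 expn_gt0 r0 addn1. Qed.
Let va := v_alpha q1 v_pi hpi2 halpha.
Let av0 : 0 < alpha_val := alpha_val_gt0 R q1.
Let an0 n : alpha ^+ n != 0. Proof. by rewrite expf_neq0 // (valn_neq0 va). Qed.

Definition unit_scale : seq C :=
  [:: alpha ^+ (q ^ 3 * r); alpha ^+ (q ^ 4); alpha ^+ (q ^ 2); alpha ^+ (q ^ 2);
      alpha].

Definition gen_scale (i : 'I_10) : C :=
  (unit_scale ++ [seq z^-1 | z <- unit_scale])`_i.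

Lemma v_gen_scale i : v (gen_scale i) = (Y31e1_wgt q R i)%:E.
Proof.
rewrite /gen_scale /Y31e1_wgt.
have vX n : v (alpha ^+ n) = (alpha_val *+ n)%:E := valnX_fin n va.
have va1 : v alpha = (1 / (q%:R ^+ 3 * (q%:R ^+ 2 - 1)))%:E by rewrite va /alpha_val.
case: i => [[|[|[|[|[|[|[|[|[|[|i]]]]]]]]]] //= _]; try apply: valnV_fin;
  by rewrite ?vX ?alpha_val_u ?alpha_val_X1 ?alpha_val_X2 ?va1.
Qed.

Definition unit_coord (i : 'I_10) : pts Y -> C :=
  fun P => (gen_scale i)^-1 * Y31e1_gen i P.

Lemma unit_coord_ge0 i : analytic_ge 0 (unit_coord i).
Proof.
rewrite -(addNr (Y31e1_wgt q R i)); apply: analytic_geZ; last first.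
  exact: (@analytic_ge_gen _ _ _ Y).
by rewrite (valnV_fin (v_gen_scale i)).
Qed.

Definition coordU (P : pts Y) : C := (alpha ^+ (q ^ 3 * r))^-1 * tu (sval P).
Definition coordA (P : pts Y) : C := (alpha ^+ (q ^ 4))^-1 * tX1 q pi (sval P).
Definition coordx (P : pts Y) : C := (alpha ^+ (q ^ 2))^-1 * tX2 (sval P).
Definition coordB (P : pts Y) : C := (alpha ^+ (q ^ 2))^-1 * tY1 q pi (sval P).
Definition coordy (P : pts Y) : C := alpha^-1 * tY2 (sval P).

Definition coords := [:: coordU; coordA; coordx; coordB; coordy].

Lemma unit_coordE (i : 'I_10) :
  unit_coord i = nth (fun=> 0) (coords ++ [seq fun P => (f P)^-1 | f <- coords]) i.
Proof.
apply/funext => P.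
case: i => [[|[|[|[|[|[|[|[|[|[|i]]]]]]]]]] //= lt_i];
  by rewrite /unit_coord /gen_scale /Y31e1_gen /= ?invfM.
Qed.

Lemma coords_ge0 (i : nat) : (i < 5)%N ->
  analytic_ge 0 (nth (fun=> 0) coords i) /\
  analytic_ge 0 (fun P => (nth (fun=> 0) coords i P)^-1).
Proof.
move=> i5; have i10 : (i < 10)%N by apply: leq_trans i5 _.
have i10' : (i + 5 < 10)%N by rewrite -[10%N]/(5 + 5)%N ltn_add2r.
have := unit_coord_ge0 (Ordinal i10); have := unit_coord_ge0 (Ordinal i10').
rewrite !unit_coordE !nth_cat [size coords]/= i5 ltnNge leq_addl addnK.
by rewrite (nth_map (fun=> 0) (fun=> 0)).
Qed.

Lemma v_coords (i : nat) P : (i < 5)%N -> v (nth (fun=> 0) coords i P) = 0%E.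
Proof.
have vc (c z : C) (w : R) : v c = w%:E -> v z = w%:E -> v (c^-1 * z) = 0%E.
  by move=> cw zw; rewrite (valnM_fin (valnV_fin cw) zw) addNr.
have vX n : v (alpha ^+ n) = (alpha_val *+ n)%:E := valnX_fin n va.
case: P => P HP; have [_ [u_ X1_ X2_ Y1_ Y2_]] := HP.
case: i => [|[|[|[|[|i]]]]] //= _; [apply: vc u_|apply: vc X1_|apply: vc X2_|
  apply: vc Y1_|apply: vc Y2_]; rewrite ?vX ?alpha_val_u ?alpha_val_X1 ?alpha_val_X2 //.
Qed.

Section Relations.
Variable P : pts Y.
Local Notation U := (coordU P).
Local Notation A := (coordA P).
Local Notation x := (coordx P).
Local Notation B := (coordB P).
Local Notation y := (coordy P).

Lemma tripleE : sval P =
  Triple (alpha ^+ (q ^ 3 * r) * U) (alpha ^+ (q ^ 2) * x) (alpha * y).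
Proof.
rewrite /coordU /coordx /coordy !mulVKf ?(valn_neq0 va) //.
by case: (sval P).
Qed.

Lemma rel_X : norm_X q pi alpha U x = A.
Proof.
by rewrite /coordA tripleE /tX1 /= (pi_u_normX q1 Cq hpi2 halpha) mulKf.
Qed.

Lemma rel_Y : norm_Y q pi alpha U y = B.
Proof.
by rewrite /coordB tripleE /tY1 /= (pi_u_normY q1 Cq hpi2 halpha) mulKf.
Qed.

Let HP : lt_curve q pi v pi2 (sval P). Proof. by case: (svalP P). Qed.

Lemma rel_A : norm_A q pi alpha U A = 0.
Proof.
case: HP => _ + _ _; rewrite -[pi_u q pi _ (tX2 _)]/(tX1 q pi (sval P)).
rewrite -[tX1 _ _ _](mulVKf (an0 (q ^ 4))) -/A.
rewrite -[tu _](mulVKf (an0 (q ^ 3 * r))) -/U (pi_u_normA q1 Cq hpi2 halpha).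
by move/eqP; rewrite mulf_eq0 (negPf (an0 _)) => /eqP.
Qed.

Lemma rel_B : norm_X q pi alpha U B = 0.
Proof.
case: HP => _ _ + _; rewrite -[pi_u q pi _ (tY2 _)]/(tY1 q pi (sval P)).
rewrite -[tY1 _ _ _](mulVKf (an0 (q ^ 2))) -/B.
rewrite -[tu _](mulVKf (an0 (q ^ 3 * r))) -/U (pi_u_normX q1 Cq hpi2 halpha).
by move/eqP; rewrite mulf_eq0 (negPf (an0 _)) => /eqP.
Qed.

Lemma rel_mu : norm_mu q alpha A B x y = 1.
Proof.
case: HP => _ _ _; rewrite tripleE (mu2_norm q1 Cq hpi2 halpha rel_X rel_Y).
have p2n0 : pi2 != 0 by apply/eqP => p0; move: (v_pi2 q1 v_pi hpi2); rewrite p0 valn0.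
by move/(canRL (mulKf p2n0)); rewrite mulVf.
Qed.

Lemma coord_neq0 : [/\ U != 0, A != 0, x != 0, B != 0 & y != 0].
Proof.
by split; [exact: valn_neq0 (@v_coords 0 P isT)|exact: valn_neq0 (@v_coords 1 P isT)
  |exact: valn_neq0 (@v_coords 2 P isT)|exact: valn_neq0 (@v_coords 3 P isT)
  |exact: valn_neq0 (@v_coords 4 P isT)].
Qed.

Lemma rel_UA : U * A ^+ r + 1 =
  - (varpi - 1) - alpha ^+ (q ^ 3 * m) * A ^+ (q ^ 2).-1.
Proof.
have [_ + _ _ _] := coord_neq0; have := rel_A; rewrite /norm_A.
move: (coordU P) (coordA P) => U A + An0.
have -> : A ^+ (q ^ 2) = A ^+ (q ^ 2).-1 * A.
  by rewrite -exprSr prednK // expn_gt0 q0.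
have -> : A ^+ q = A ^+ r * A by rewrite -exprSr -qr.
rewrite !mulrA -!mulrDl => /eqP; rewrite mulf_eq0 (negPf An0) orbF => /eqP.
move=> E; apply/eqP; rewrite -subr_eq0 -E; apply/eqP; ring.
Qed.

Lemma rel_UB : U + B ^+ (q * r) =
  - (alpha ^+ (q ^ 2 * m) * (varpi * (B^-1) ^+ r)).
Proof.
have [_ _ _ + _] := coord_neq0; have := rel_B; rewrite /norm_X.
move: (coordU P) (coordB P) => U B + Bn0.
have -> : B ^+ (q ^ 2) = B ^+ (q * r) * B ^+ q.
  by rewrite -exprD; congr (_ ^+ _); rewrite [in RHS]qr [in LHS]qr /=; lia.
have -> : varpi * B = varpi * B^-1 ^+ r * B ^+ q.
  have -> : B ^+ q = B ^+ r * B by rewrite -exprSr -qr.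
  by rewrite -mulrA [B^-1 ^+ _ * _]mulrA -exprMn mulVf // expr1n mul1r.
rewrite !mulrA -!mulrDl => /eqP; rewrite mulf_eq0 (negPf (expf_neq0 _ Bn0)) orbF => /eqP.
move=> E; apply/eqP; rewrite -subr_eq0 -E; apply/eqP; ring.
Qed.

Lemma rel_Ax : A - (x ^+ (q ^ 2) + U * x ^+ q) = alpha ^+ (q ^ 2 * m) * (varpi * x).
Proof. by rewrite -rel_X /norm_X; ring. Qed.

Lemma rel_By : B - y ^+ (q ^ 2) =
  alpha ^+ (q * m) * (U * y ^+ q) + alpha ^+ ((q ^ 2 + q + 1) * m) * (varpi * y).
Proof. by rewrite -rel_Y /norm_Y; ring. Qed.

Lemma rel_xB : - x ^+ q * B + x * B ^+ q - 1 =
  alpha ^+ ((q ^ 2 + q + 1) * m) * (A ^+ q * y) - alpha ^+ (q * m) * (A * y ^+ q).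
Proof. by rewrite -rel_mu /norm_mu; ring. Qed.

End Relations.

Lemma coordx_int P : coordx P \in valn_int v.
Proof. by rewrite unfold_in (@v_coords 2 P). Qed.
Lemma coordy_int P : coordy P \in valn_int v.
Proof. by rewrite unfold_in (@v_coords 4 P). Qed.

Definition xO P : O := Integer (coordx_int P).
Definition yO P : O := Integer (coordy_int P).

(** The function on the affinoid defined by a polynomial in x (the outer
    variable) and y with integral coefficients. *)
Definition evalf (p : {poly {poly O}}) : pts Y -> C :=
  fun P => val p.[(xO P)%:P].[yO P].

Lemma evalfD p1 p2 : evalf (p1 + p2) = evalf p1 + evalf p2.
Proof. by apply/funext => P; rewrite /evalf !hornerD rmorphD. Qed.
Lemma evalfM p1 p2 : evalf (p1 * p2) = evalf p1 * evalf p2.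
Proof. by apply/funext => P; rewrite /evalf !hornerM rmorphM. Qed.
Lemma evalfN p : evalf (- p) = - evalf p.
Proof. by apply/funext => P; rewrite /evalf !hornerN rmorphN. Qed.
Lemma evalfX : evalf 'X = coordx.
Proof. by apply/funext => P; rewrite /evalf hornerX hornerC. Qed.
Lemma evalfY : evalf ('X%:P) = coordy.
Proof. by apply/funext => P; rewrite /evalf hornerC hornerX. Qed.
Lemma evalfC (c : O) : evalf (c%:P%:P) = fun=> val c.
Proof. by apply/funext => P; rewrite /evalf !hornerC. Qed.
Lemma evalf0 : evalf 0 = 0.
Proof. by apply/funext => P; rewrite /evalf !horner0 rmorph0. Qed.
Lemma evalf1 : evalf 1 = 1.
Proof. by rewrite (evalfC 1); apply/funext => P; rewrite rmorph1. Qed.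
Lemma evalf_exp p n : evalf (p ^+ n) = evalf p ^+ n.
Proof. by elim: n => [|n IH]; rewrite ?evalf1 // !exprS evalfM IH. Qed.

Lemma coordx_ge0 : analytic_ge 0 coordx. Proof. by case: (@coords_ge0 2). Qed.
Lemma coordy_ge0 : analytic_ge 0 coordy. Proof. by case: (@coords_ge0 4). Qed.
Lemma coordyV_ge0 : analytic_ge 0 (fun P => (coordy P)^-1).
Proof. by case: (@coords_ge0 4). Qed.

Lemma evalf_ge0 p : analytic_ge 0 (evalf p).
Proof.
elim/poly_ind: p => [|p c IH]; first by rewrite evalf0; apply: analytic_ge0.
rewrite evalfD evalfM evalfX; apply: analytic_geD.
  by apply: analytic_geMl => //; apply: coordx_ge0.
elim/poly_ind: c => [|c d IHc].
  by rewrite evalf0; apply: analytic_ge0.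
rewrite polyCD polyCM evalfD evalfM evalfY evalfC; apply: analytic_geD.
  by apply: analytic_geMl => //; apply: coordy_ge0.
by apply: analytic_ge_cst; apply: integer_ge0.
Qed.

(** Congruence modulo alpha, for the norm given by convergent expansions in the
    generators. *)
Definition cong (f g : pts Y -> C) : Prop := analytic_ge alpha_val (f - g).
Definition approx (f : pts Y -> C) : Prop := exists p, cong f (evalf p).

Lemma cong_refl f : cong f f.
Proof. by rewrite /cong subrr; apply: analytic_ge0. Qed.
Lemma cong_sym f g : cong f g -> cong g f.
Proof. by rewrite /cong => fg; rewrite -opprB; apply: analytic_geN. Qed.
Lemma cong_trans f g h : cong f g -> cong g h -> cong f h.
Proof. by move=> fg gh; rewrite /cong -[f - h](subrKA g); apply: analytic_geD. Qed.
Lemma cong_mulr f g h : analytic_ge 0 h -> cong f g -> cong (f * h) (g * h).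
Proof. by rewrite /cong -mulrBl mulrC => h0; apply: analytic_geMl. Qed.
Lemma cong_mul f f' g g' : analytic_ge 0 f' -> analytic_ge 0 g ->
  cong f f' -> cong g g' -> cong (f * g) (f' * g').
Proof.
move=> f0 g0 ff gg; apply: (@cong_trans _ (f' * g)); first exact: cong_mulr.
by rewrite ![f' * _]mulrC; apply: cong_mulr.
Qed.
Lemma cong_add f f' g g' : cong f f' -> cong g g' -> cong (f + g) (f' + g').
Proof. by rewrite /cong opprD addrACA; apply: analytic_geD. Qed.

Lemma approx_cong f g : cong f g -> approx g -> approx f.
Proof. by move=> fg [p gp]; exists p; apply: cong_trans gp. Qed.

Lemma approx_ge0 f : approx f -> analytic_ge 0 f.
Proof.
case=> p fp; rewrite -[f](subrK (evalf p)); apply: analytic_geD; last exact: evalf_ge0.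
by apply: analytic_geW fp; apply: ltW.
Qed.

Lemma approxD f g : approx f -> approx g -> approx (f + g).
Proof.
by move=> [p fp] [p' gp]; exists (p + p'); rewrite evalfD; apply: cong_add.
Qed.

Lemma approxM f g : approx f -> approx g -> approx (f * g).
Proof.
move=> [p fp] ag; have [p' gp] := ag; exists (p * p'); rewrite evalfM.
by apply: cong_mul => //; [apply: evalf_ge0 | apply: approx_ge0].
Qed.

Lemma approxX f n : approx f -> approx (f ^+ n).
Proof.
move=> af; elim: n => [|n IH]; last by rewrite exprS; apply: approxM.
by exists 1; rewrite evalf1; apply: cong_refl.
Qed.

Lemma approxN f : approx f -> approx (- f).
Proof.
move=> [p fp]; exists (- p); rewrite evalfN /cong -opprD.
by apply: analytic_geN; rewrite -/(cong _ _).
Qed.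

(** The difference of the inverse of f and g is that inverse times 1 - f g. *)
Lemma approxV (f g : pts Y -> C) :
  (forall P, f P != 0) -> analytic_ge 0 (fun P => (f P)^-1) ->
  approx g -> cong (f * g) 1 -> approx (fun P => (f P)^-1).
Proof.
move=> f0 fV ag fg; apply: approx_cong ag; apply: cong_sym.
have := cong_mulr fV fg; rewrite mul1r.
suff -> : f * g * (fun P => (f P)^-1) = g by [].
by apply/funext => P; rewrite !fctE mulrAC divff // mul1r.
Qed.

Let mq j : (0 < q ^ j * m)%N. Proof. by rewrite muln_gt0 expn_gt0 q0 m0. Qed.
Let mq1 : (0 < q * m)%N. Proof. by rewrite muln_gt0 q0 m0. Qed.
Let m5 : (0 < (q ^ 2 + q + 1) * m)%N. Proof. by rewrite muln_gt0 m0 addn1. Qed.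

Lemma alpha_cong n (f : pts Y -> C) : (0 < n)%N -> analytic_ge 0 f ->
  analytic_ge alpha_val (fun P => alpha ^+ n * f P).
Proof.
move=> n0 f0; rewrite -[alpha_val]addr0; apply: analytic_geZ => //.
by rewrite (valnX_fin n va) lee_fin -{1}[alpha_val]mulr1n ler_pMn2l.
Qed.

Let varpi_ge0 (f : pts Y -> C) : analytic_ge 0 f -> analytic_ge 0 (fun P => varpi * f P).
Proof.
move=> f0; have := @analytic_geZ _ _ _ _ 0 0 varpi _ _ f0; rewrite addr0; apply.
by rewrite (v_varpi q1 v_pi hpi2 halpha).
Qed.

Lemma coordU_ge0 : analytic_ge 0 coordU. Proof. by case: (@coords_ge0 0). Qed.
Lemma coordA_ge0 : analytic_ge 0 coordA. Proof. by case: (@coords_ge0 1). Qed.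

Lemma approx_x : approx coordx.
Proof. by exists 'X; rewrite evalfX; apply: cong_refl. Qed.

Lemma approx_y : approx coordy.
Proof. by exists 'X%:P; rewrite evalfY; apply: cong_refl. Qed.

Lemma cong_B : cong coordB (coordy ^+ (q ^ 2)).
Proof.
rewrite /cong; have -> : coordB - coordy ^+ (q ^ 2) =
    (fun P => alpha ^+ (q * m) * (coordU * coordy ^+ q) P) +
    (fun P => alpha ^+ ((q ^ 2 + q + 1) * m) * (varpi * coordy P)).
  by apply/funext => P; rewrite !fctE; apply: rel_By.
apply: analytic_geD; apply: alpha_cong; rewrite ?mq1 ?m5 //.
  by apply: analytic_geMl; [apply: coordU_ge0|apply: analytic_geX; apply: coordy_ge0].
by apply: varpi_ge0; apply: coordy_ge0.
Qed.

Lemma cong_U : cong coordU (- coordB ^+ (q * r)).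
Proof.
rewrite /cong opprK; have -> : coordU + coordB ^+ (q * r) =
    - (fun P => alpha ^+ (q ^ 2 * m) * (varpi * ((fun P => (coordB P)^-1) ^+ r) P)).
  by apply/funext => P; rewrite !fctE; apply: rel_UB.
apply: analytic_geN; apply: alpha_cong; first exact: mq.
by apply: varpi_ge0; apply: analytic_geX; case: (@coords_ge0 3).
Qed.

Lemma cong_A : cong coordA (coordx ^+ (q ^ 2) + coordU * coordx ^+ q).
Proof.
rewrite /cong; have -> : coordA - (coordx ^+ (q ^ 2) + coordU * coordx ^+ q) =
    (fun P => alpha ^+ (q ^ 2 * m) * (varpi * coordx P)).
  by apply/funext => P; rewrite !fctE; apply: rel_Ax.
apply: alpha_cong; first exact: mq.
by apply: varpi_ge0; apply: coordx_ge0.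
Qed.

Lemma cong_UA : cong (coordU * coordA ^+ r) (-1).
Proof.
rewrite /cong opprK; have -> : coordU * coordA ^+ r + 1 = - (fun=> varpi - 1) -
    (fun P => alpha ^+ (q ^ 3 * m) * (coordA ^+ (q ^ 2).-1) P).
  by apply/funext => P; rewrite !fctE; apply: rel_UA.
apply: analytic_geB.
  apply: analytic_geN; apply: analytic_ge_cst.
  exact: varpi_close q1 Cq v_pi hpi2 halpha.
apply: alpha_cong; first exact: mq.
by apply: analytic_geX; apply: coordA_ge0.
Qed.

(** The equation mu2 = pi2 modulo alpha. *)
Lemma cong_xB : cong (- coordx ^+ q * coordB + coordx * coordB ^+ q) 1.
Proof.
rewrite /cong; have -> : - coordx ^+ q * coordB + coordx * coordB ^+ q - 1 =
    (fun P => alpha ^+ ((q ^ 2 + q + 1) * m) * (coordA ^+ q * coordy) P) -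
    (fun P => alpha ^+ (q * m) * (coordA * coordy ^+ q) P).
  by apply/funext => P; rewrite !fctE; apply: rel_xB.
apply: analytic_geB; apply: alpha_cong; rewrite ?mq1 ?m5 //.
  by apply: analytic_geMl; [apply: analytic_geX; apply: coordA_ge0|apply: coordy_ge0].
by apply: analytic_geMl; [apply: coordA_ge0|apply: analytic_geX; apply: coordy_ge0].
Qed.

Lemma approx_B : approx coordB.
Proof. by apply: approx_cong cong_B _; apply/approxX/approx_y. Qed.

Lemma approx_U : approx coordU.
Proof. by apply: approx_cong cong_U _; apply/approxN/approxX/approx_B. Qed.

Lemma approx_A : approx coordA.
Proof.
apply: approx_cong cong_A _; apply: approxD; first exact/approxX/approx_x.
by apply: approxM; [apply: approx_U|apply/approxX/approx_x].
Qed.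

Lemma approx_invB : approx (fun P => (coordB P)^-1).
Proof.
apply: (@approxV _ (- coordx ^+ q + coordx * coordB ^+ r)).
- by move=> P; case: (coord_neq0 P).
- by case: (@coords_ge0 3).
- apply: approxD; first exact/approxN/approxX/approx_x.
  by apply: approxM; [apply: approx_x|apply/approxX/approx_B].
suff -> : coordB * (- coordx ^+ q + coordx * coordB ^+ r) =
    - coordx ^+ q * coordB + coordx * coordB ^+ q by exact: cong_xB.
have -> : coordB ^+ q = coordB ^+ r * coordB by rewrite -exprSr -qr.
by ring.
Qed.

Lemma approx_invx : approx (fun P => (coordx P)^-1).
Proof.
apply: (@approxV _ (- coordx ^+ r * coordB + coordB ^+ q)).
- by move=> P; case: (coord_neq0 P).
- by case: (@coords_ge0 2).
- apply: approxD; last exact/approxX/approx_B.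
  by apply: approxM; [apply/approxN/approxX/approx_x|apply: approx_B].
suff -> : coordx * (- coordx ^+ r * coordB + coordB ^+ q) =
    - coordx ^+ q * coordB + coordx * coordB ^+ q by exact: cong_xB.
have -> : coordx ^+ q = coordx ^+ r * coordx by rewrite -exprSr -qr.
by ring.
Qed.

Lemma approx_invy : approx (fun P => (coordy P)^-1).
Proof.
pose g := - coordx ^+ q + coordx * coordB ^+ r.
have ag : approx g.
  apply: approxD; first exact/approxN/approxX/approx_x.
  by apply: approxM; [apply: approx_x|apply/approxX/approx_B].
apply: (@approxV _ (coordy ^+ (q ^ 2).-1 * g)).
- by move=> P; case: (coord_neq0 P).
- by case: (@coords_ge0 4).
- by apply: approxM => //; apply/approxX/approx_y.
have -> : coordy * (coordy ^+ (q ^ 2).-1 * g) = coordy ^+ (q ^ 2) * g.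
  by rewrite mulrA -exprS prednK // expn_gt0 q0.
apply: (cong_trans _ cong_xB).
suff <- : coordB * g = - coordx ^+ q * coordB + coordx * coordB ^+ q.
  by apply: cong_mulr; [apply: approx_ge0|apply/cong_sym/cong_B].
have -> : coordB ^+ q = coordB ^+ r * coordB by rewrite -exprSr -qr.
by rewrite /g; ring.
Qed.

Lemma approx_invU : approx (fun P => (coordU P)^-1).
Proof.
apply: (@approxV _ (- coordA ^+ r)).
- by move=> P; case: (coord_neq0 P).
- by case: (@coords_ge0 0).
- exact/approxN/approxX/approx_A.
by rewrite /cong mulrN -opprD; apply: analytic_geN; have := cong_UA; rewrite /cong opprK.
Qed.

Lemma approx_invA : approx (fun P => (coordA P)^-1).
Proof.
apply: (@approxV _ (- (coordU * coordA ^+ r.-1))).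
- by move=> P; case: (coord_neq0 P).
- by case: (@coords_ge0 1).
- by apply: approxN; apply: approxM; [apply: approx_U|apply/approxX/approx_A].
have -> : coordA * - (coordU * coordA ^+ r.-1) = - (coordU * coordA ^+ r).
  have -> : coordA ^+ r = coordA * coordA ^+ r.-1 by rewrite -exprS prednK.
  by ring.
by rewrite /cong -opprD; apply: analytic_geN; have := cong_UA; rewrite /cong opprK.
Qed.

(** Modulo alpha every generator is a polynomial in x and y, hence so is every
    function bounded by 1. *)
Lemma approx_all (f : pts Y -> C) : analytic_ge 0 f -> approx f.
Proof.
move=> /(analytic_ge_trunc alpha_val)[a [N [a0 fa]]]; apply: approx_cong fa _.
apply: (tate_psum_ind (Y := Y) v_gen_scale) a0 => [c c0|f1 f2|f1 f2|i].
- have [b <-] := mk_integer c0; exists b%:P%:P; rewrite evalfC; exact: cong_refl.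
- exact: approxD.
- exact: approxM.
rewrite -/(unit_coord i) unit_coordE.
case: i => [[|[|[|[|[|[|[|[|[|[|i]]]]]]]]]] //= _].
- exact: approx_U.
- exact: approx_A.
- exact: approx_x.
- exact: approx_B.
- exact: approx_y.
- exact: approx_invU.
- exact: approx_invA.
- exact: approx_invx.
- exact: approx_invB.
- exact: approx_invy.
Qed.

Local Notation k := (residue_field v).
Local Notation res := (@integer_res R C v).
Let kq := residue_pchar v Cq.

Lemma point_of_curve (x y : k) : on_curve q x y ->
  exists P, res (xO P) = x /\ res (yO P) = y.
Proof.
rewrite -[x]integer_resK -[y]integer_resK => xy.
have [P [x' [y' [HP PX PY xx yy]]]] := lift_point q1 Cq v_pi hpi2 halpha xy.
exists (exist _ P HP); rewrite -xx -yy; split; congr (res _); apply: val_inj.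
  by rewrite /= /coordx /= PX mulKf.
by rewrite /= /coordy /= PY mulKf // (valn_neq0 va).
Qed.

Lemma evalf_point p P :
  (0 < v (evalf p P))%E <-> (red2 p).[(res (xO P))%:P].[res (yO P)] = 0.
Proof. by rewrite horner_red2 /evalf; apply: iff_sym; apply: res_eq0. Qed.

Lemma evalf_curve : analytic_ge alpha_val (evalf (curve_eq q O)).
Proof.
have congX f g n : analytic_ge 0 f -> analytic_ge 0 g -> cong f g ->
    cong (f ^+ n) (g ^+ n).
  move=> f0 g0 fg; elim: n => [|n IH]; first exact: cong_refl.
  by rewrite !exprS; apply: cong_mul => //; apply: analytic_geX.
have xq0 : analytic_ge 0 (coordx ^+ q) by apply/analytic_geX/coordx_ge0.
have -> : evalf (curve_eq q O) =
    - coordx ^+ q * coordy ^+ (q ^ 2) + coordx * (coordy ^+ (q ^ 2)) ^+ q - 1.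
  rewrite /curve_eq !(evalfD, evalfN, evalfM, evalf1, evalf_exp, evalfX).
  by rewrite !rmorphXn !evalf_exp evalfY -exprM -expnSr.
apply: cong_trans (cong_xB); apply: cong_sym; apply: cong_add.
  by rewrite ![- _ ^+ q * _]mulrC; apply: cong_mulr; [apply: analytic_geN|apply: cong_B].
rewrite ![coordx * _]mulrC; apply: cong_mulr; first exact: coordx_ge0.
apply: congX cong_B; first by case: (@coords_ge0 3).
by apply/analytic_geX/coordy_ge0.
Qed.

Lemma evalfZ c p : evalf (c%:P%:P * p) = fun P => val c * evalf p P.
Proof. by rewrite evalfM evalfC. Qed.

(** * The supremum norm *)

(** The supremum norm controls the residue norm, up to the size of alpha: modulo
    the equation of the curve, and up to a power of the unit y, a polynomial has a
    representative of degree less than q in x, whose largest coefficient is detected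
    at some point. *)
Lemma sup_norm_step (f : pts Y -> C) (eta : R) : analytic_ge 0 f ->
  (forall P, (eta%:E <= v (f P))%E) -> analytic_ge (Order.min eta alpha_val) f.
Proof.
move=> f0 feta; set s := Order.min eta alpha_val.
have [p fp] := approx_all f0; have [N [Q [T [pE sT]]]] := curve_eq_division q1 p.
have se : s <= alpha_val by rewrite ge_min lexx orbT.
pose e := coordy ^+ N * (f - evalf p) + evalf Q * evalf (curve_eq q O).
have e_ev : analytic_ge alpha_val e.
  apply: analytic_geD; apply: analytic_geMl => //.
  - by apply/analytic_geX/coordy_ge0.
  - exact: evalf_ge0.
  - exact: evalf_curve.
have fE : coordy ^+ N * f = evalf T + e.
  have : evalf (('X^N)%:P * p) = coordy ^+ N * evalf p.
    by rewrite evalfM rmorphXn evalf_exp evalfY.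
  rewrite pE evalfD evalfM => pE'.
  by rewrite /e mulrBr -pE'; ring.
suff Ts : analytic_ge s (evalf T).
  have -> : f = ((fun P => (coordy P)^-1) ^+ N) * (evalf T + e).
    rewrite -fE mulrA -exprMn; apply/funext => P; rewrite !fctE mulVf ?expr1n ?mul1r //.
    by case: (coord_neq0 P).
  apply: analytic_geMl; first by apply/analytic_geX/coordyV_ge0.
  by apply: analytic_geD => //; apply: analytic_geW e_ev.
have [->|T0] := eqVneq T 0; first by rewrite evalf0; apply: analytic_ge0.
have [c [T' [c0 TE T'0 sT'T]]] := primitive_part T0; rewrite TE evalfZ.
suff cs : (s%:E <= v (val c))%E.
  by rewrite -[s]addr0; apply: analytic_geZ => //; apply: evalf_ge0.
have [x [y [xy T'xy]]] : exists x y, on_curve q x y /\ (red2 T').[x%:P].[y] <> 0.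
  apply: contrapT => nxy; move/eqP: T'0; apply.
  have sT' : (size (red2 T') <= q)%N.
    exact: leq_trans (size_poly _ _) (leq_trans sT'T sT).
  apply: (small_vanish q1 kq sT') => x y xy; apply: contrapT => Txy.
  by apply: nxy; exists x, y.
have [P [xP yP]] := point_of_curve xy.
have T'P : v (evalf T' P) = 0%E.
  apply/eqP; rewrite eq_le (analytic_ge_bound P (evalf_ge0 T')) andbT leNgt.
  by apply/negP => /evalf_point; rewrite xP yP.
have -> : v (val c) = v (evalf T P) by rewrite TE evalfZ valnM T'P adde0.
have -> : evalf T P = coordy P ^+ N * f P - e P.
  have := congr1 (fun g => g P) fE; rewrite !fctE => ->; ring.
apply: valnB_ge.
  rewrite valnM (valnX_fin (r := 0) N) ?mul0rn ?add0e; last exact: (@v_coords 4 P).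
  by apply: le_trans (feta P); rewrite lee_fin ge_min lexx.
by apply: le_trans (analytic_ge_bound P e_ev); rewrite lee_fin.
Qed.

(** Each application of sup_norm_step to a multiple of f by a power of alpha
    improves the bound on the expansion of f by the valuation of alpha. *)
Lemma sup_norm_ge0 (f : pts Y -> C) :
  analytic f -> (forall P, (0 <= v (f P))%E) -> analytic_ge 0 f.
Proof.
case=> B fB f0; have [n /(_ n (leqnn n)) nB] := archi_mulrn (- B) av0.
have {nB fB} : analytic_ge (- (alpha_val *+ n)) f.
  by apply: analytic_geW fB; rewrite lerNl.
elim: n => [|n IH] fn; first by rewrite -(oppr0) -(mulr0n alpha_val).
apply: IH; pose g P := alpha ^+ n.+1 * f P.
have vn : v (alpha ^+ n.+1) = (alpha_val *+ n.+1)%:E := valnX_fin n.+1 va.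
have g0 : analytic_ge 0 g.
  by rewrite -(subrr (alpha_val *+ n.+1)); apply: analytic_geZ; rewrite ?vn.
have : analytic_ge (Order.min (alpha_val *+ n.+1) alpha_val) g.
  apply: sup_norm_step g0 _ => P; rewrite /g valnM vn.
  by rewrite leeDl.
have -> : Order.min (alpha_val *+ n.+1) alpha_val = alpha_val.
  by apply/min_idPr; rewrite -{1}[alpha_val]mulr1n ler_pMn2l.
move=> /(@analytic_geZ _ _ _ _ alpha_val (- (alpha_val *+ n.+1)) (alpha ^+ n.+1)^-1).
rewrite (valnV_fin vn) lexx => /(_ isT); rewrite mulrS opprD addrAC addNr add0r.
suff -> : (fun P => (alpha ^+ n.+1)^-1 * g P) = f by [].
by apply/funext => P; rewrite /g mulKf.
Qed.

Lemma power_bounded_approx (f : pts Y -> C) : power_bounded f -> approx f.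
Proof.
move=> fb; apply/approx_all/sup_norm_ge0 => [|P]; first by case: fb.
exact: power_bounded_value.
Qed.

Lemma red2_0_small p : red2 p = 0 -> exists2 s, 0 < s & analytic_ge s (evalf p).
Proof.
have [->|p0] := eqVneq p 0.
  by exists 1 => //; rewrite evalf0; apply: analytic_ge0.
have [c [p' [_ -> p'0 _]]] := primitive_part p0.
rewrite rmorphM /= => /eqP; rewrite mulf_eq0 (negPf p'0) orbF.
rewrite /red2 map_polyC /= map_polyC /= !polyC_eq0 => /eqP/res_eq0/valn_gt0_ge[s s0 sc].
exists s => //; rewrite evalfZ -[s]addr0; apply: analytic_geZ => //.
exact: evalf_ge0.
Qed.

(** Every point of the reduced curve comes from a point of the affinoid, where
    the value of a topologically nilpotent function is small. *)
Lemma evalf_nilpotent p :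
  top_nilpotent (evalf p) <-> exists s : {poly {poly k}}, red2 p = s * curve_eq q k.
Proof.
split=> [pn|[s ps]].
  apply: (curve_nullstellensatz q1 kq) => x y /point_of_curve[P [<- <-]].
  by apply/evalf_point/top_nilpotent_value.
have [s' s'E] := red2_surj s.
have [|t t0 ht] := @red2_0_small (p - s' * curve_eq q O).
  by apply: red2_curve_congr; rewrite s'E.
have -> : evalf p = evalf (p - s' * curve_eq q O) + evalf s' * evalf (curve_eq q O).
  by rewrite -evalfM -evalfD subrK.
apply: top_nilpotentD; first exact: top_nilpotent_ge ht.
apply: (top_nilpotent_ge av0); apply: analytic_geMl; first exact: evalf_ge0.
exact: evalf_curve.
Qed.

End Coordinates.

(** * Conjugation by inertia *)

Section Conjugation.
Variables (R : realType) (C : fieldType) (v : valuation R C) (q : nat).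
Variables (pi pi2 : C) (sigma : {rmorphism C -> C}).
Hypothesis sigma_bij : bijective sigma.
Hypothesis sigma_val : forall x, v (sigma x) = v x.
Hypothesis sigma_pi : sigma pi = pi.
Hypothesis sigma_pi2 : sigma pi2 = pi2.
Hypothesis sigma_res : forall z, (0 <= v z)%E -> (0 < v (sigma z - z)%R)%E.

Local Notation Y := (Y31e1 q pi v pi2).
Implicit Types (f g : pts Y -> C) (P : pts Y) (B : R).

Lemma sigma_pi_u u z : sigma (pi_u q pi u z) = pi_u q pi (sigma u) (sigma z).
Proof. by rewrite /pi_u !(rmorphD, rmorphM, rmorphXn) sigma_pi. Qed.

Lemma sigma_tX1 (T : triple C) :
  sigma (tX1 q pi T) = tX1 q pi (map_triple sigma T).
Proof. exact: sigma_pi_u. Qed.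

Lemma sigma_tY1 (T : triple C) :
  sigma (tY1 q pi T) = tY1 q pi (map_triple sigma T).
Proof. exact: sigma_pi_u. Qed.

Lemma in_Y31e1_conj (T : triple C) :
  in_Y31e1 q pi v pi2 (map_triple sigma T) -> in_Y31e1 q pi v pi2 T.
Proof.
have inj := fmorph_inj sigma.
case=> -[u0 X0 Y0 mu] [vu vX1 vX2 vY1 vY2].
split; split.
- by rewrite -sigma_val.
- by apply: inj; rewrite !sigma_pi_u rmorph0.
- by apply: inj; rewrite !sigma_pi_u rmorph0.
- apply: inj; rewrite sigma_pi2 -{}mu /mu2 -!sigma_tX1 -!sigma_tY1 /=.
  by rewrite !(rmorphD, rmorphN, rmorphM, rmorphXn).
- by rewrite -sigma_val.
- by rewrite -sigma_val sigma_tX1.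
- by rewrite -sigma_val.
- by rewrite -sigma_val sigma_tY1.
by rewrite -sigma_val.
Qed.

Lemma point_conj_ex P : exists P', point_conj sigma P P'.
Proof.
have [s _ sK] := sigma_bij; have eP : map_triple sigma (map_triple s (sval P)) = sval P.
  by rewrite /map_triple /= !sK; case: (sval P).
have HP : in_Y31e1 q pi v pi2 (map_triple s (sval P)).
  by apply: in_Y31e1_conj; rewrite eP; apply: (svalP P).
by exists (exist _ _ HP).
Qed.

Lemma point_conj_inj P P1 P2 :
  point_conj sigma P P1 -> point_conj sigma P P2 -> P1 = P2.
Proof.
rewrite /point_conj => E1 E2.
have {E1 E2} : map_triple sigma (sval P1) = map_triple sigma (sval P2) by rewrite E1.
case: P1 P2 => [[u1 x1 y1] H1] [[u2 x2 y2] H2]; rewrite /map_triple /=.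
move=> [] /fmorph_inj u /fmorph_inj x /fmorph_inj y; move: H1; rewrite u x y => H1.
by congr exist; apply: Prop_irrelevance.
Qed.

Definition conj_point P : pts Y := sval (cid (point_conj_ex P)).

Lemma conj_pointP P : point_conj sigma P (conj_point P).
Proof. exact: svalP (cid (point_conj_ex P)). Qed.

(** Moving the coefficients of f by sigma while fixing the coordinates amounts to
    evaluating f at the conjugate point and applying sigma to the value. *)
Definition conj_fun f : pts Y -> C := fun P => sigma (f (conj_point P)).

Lemma conj_funP f : function_conj sigma f (conj_fun f).
Proof.
by move=> P P' PP'; rewrite /conj_fun (point_conj_inj (conj_pointP P) PP').
Qed.

Lemma conj_gen (i : 'I_10) P :
  Y31e1_gen i P = sigma (Y31e1_gen i (conj_point P)).
Proof.
have := conj_pointP P; rewrite /point_conj => E.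
rewrite /Y31e1_gen -E; move: (sval (conj_point P)) => T {E}.
by case: i => [[|[|[|[|[|[|[|[|[|[|i]]]]]]]]]] //= _];
  rewrite ?fmorphV -?sigma_tX1 -?sigma_tY1.
Qed.

(** An expansion of f yields one of f^sigma by applying sigma to the coefficients,
    which keeps their valuations. *)
Lemma analytic_ge_conj B f : analytic_ge B f -> analytic_ge B (conj_fun f).
Proof.
case=> a [a0 aB af]; exists (sigma \o a); split.
- move=> A; have [N NP] := a0 A; exists N => m /NP.
  by rewrite /= sigma_val.
- by move=> m; rewrite /= sigma_val.
move=> P A; have [N NP] := af (conj_point P) A; exists N => n /NP.
suff -> : tate_psum (sigma \o a) n P = sigma (tate_psum a n (conj_point P)).
  by rewrite /conj_fun -rmorphB sigma_val.
rewrite /tate_psum rmorph_sum; apply: eq_bigr => m _ /=.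
rewrite rmorphM rmorph_prod; congr (_ * _); apply: eq_bigr => i _.
by rewrite rmorphXn; congr (_ ^+ _); apply: conj_gen.
Qed.

Lemma conj_funX f n : conj_fun (f ^+ n) = conj_fun f ^+ n.
Proof. by apply/funext => P; rewrite /conj_fun !exprfctE rmorphXn. Qed.

Lemma conj_funB f g : conj_fun (f - g) = conj_fun f - conj_fun g.
Proof. by apply/funext => P; rewrite /conj_fun !fctE rmorphB. Qed.

Lemma conj_funM f g : conj_fun (f * g) = conj_fun f * conj_fun g.
Proof. by apply/funext => P; rewrite /conj_fun !fctE rmorphM. Qed.

Lemma conj_fun1 : conj_fun 1 = 1.
Proof. by apply/funext => P; rewrite /conj_fun rmorph1. Qed.

Lemma power_bounded_conj f : power_bounded f -> power_bounded (conj_fun f).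
Proof.
case=> -[A fA] [B fB]; split; first by exists A; apply: analytic_ge_conj.
by exists B => n; rewrite -conj_funX; apply: analytic_ge_conj.
Qed.

Lemma top_nilpotent_conj f : top_nilpotent f -> top_nilpotent (conj_fun f).
Proof.
case=> -[A fA] fB; split; first by exists A; apply: analytic_ge_conj.
move=> B; have [N NP] := fB B; exists N => n /NP fn.
by rewrite -conj_funX; apply: analytic_ge_conj.
Qed.

Definition conj_red (h : reduction Y) : reduction Y :=
  reduce (conj_fun (val (repr h))).

Lemma conj_redE f : power_bounded f -> conj_red (reduce f) = reduce (conj_fun f).
Proof.
move=> fb; have rb : power_bounded (val (repr (reduce f))).
  by apply/asboolP; apply: (valP (repr (reduce f))).
apply/reduce_eq; try exact: power_bounded_conj.
rewrite -conj_funB; apply/top_nilpotent_conj/reduce_eq => //.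
by rewrite reduceE reprK.
Qed.

Fact conj_red_zmod : zmod_morphism conj_red.
Proof.
move=> h1 h2; have [f fb <-] := reduce_surj h1; have [g gb <-] := reduce_surj h2.
have fg : power_bounded (f - g) by apply: power_boundedD => //; apply: power_boundedN.
rewrite -reduceB // !conj_redE // conj_funB reduceB //; exact: power_bounded_conj.
Qed.

Fact conj_red_monoid : monoid_morphism conj_red.
Proof.
split=> [|h1 h2].
  rewrite -reduce1 conj_redE ?conj_fun1 //.
  by apply: power_bounded_cst; rewrite valn1.
have [f fb <-] := reduce_surj h1; have [g gb <-] := reduce_surj h2.
have fg : power_bounded (f * g) by apply: power_boundedM.
rewrite -reduceM // !conj_redE // conj_funM reduceM //; exact: power_bounded_conj.
Qed.

HB.instance Definition _ := GRing.isZmodMorphism.Build _ _ conj_red conj_red_zmod.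
HB.instance Definition _ := GRing.isMonoidMorphism.Build _ _ conj_red conj_red_monoid.

(** Since sigma is trivial on the residue field, f^sigma takes at P the same
    residue as f at the conjugate point. *)
Lemma conj_red_action : reduction_action sigma (conj_red : {rmorphism _ -> _}).
Proof.
split; first exact: point_conj_ex.
  move=> P P' PP' h; have [f fb <-] := reduce_surj h.
  have f0 := power_bounded_value P' fb.
  rewrite /= conj_redE // !reduced_pointE //; last exact: power_bounded_conj.
  rewrite (conj_funP f PP'); apply/residue_eq; rewrite ?sigma_val //.
  exact: sigma_res.
move=> f fb; exists (conj_fun f); split; first exact: power_bounded_conj.
  exact: conj_funP.
exact: conj_redE.
Qed.

Lemma conj_red_scalar c : conj_red (reduction_scalar Y c) = reduction_scalar Y c.
Proof.
rewrite -[c]integer_resK -residueE; have c0 := integer_ge0 (repr c).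
have sc0 : (0 <= v (sigma (val (repr c))))%E by rewrite sigma_val.
rewrite {1}reduction_scalarE // conj_redE; last exact: power_bounded_cst.
rewrite -[conj_fun _]/(fun=> sigma (val (repr c))) -reduction_scalarE //.
by congr (reduction_scalar _ _); apply/residue_eq => //; apply: sigma_res.
Qed.

End Conjugation.

(** * The presentation and the action *)

Section SwapCurve.
Variables (R : realType) (K : fieldType) (v : valuation R K) (q : nat).
Local Notation k := (residue_field v).

Lemma swap_reduced_equation :
  swapXY (reduced_equation q v) = curve_eq q k.
Proof. exact: swap_curve_eq. Qed.

End SwapCurve.

Lemma factor_rmorphism (A B D : pzRingType)
    (f : {rmorphism A -> B}) (g : {rmorphism A -> D}) :
  (forall b, exists a, f a = b) -> (forall a, f a = 0 -> g a = 0) ->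
  exists h : {rmorphism B -> D}, forall a, h (f a) = g a.
Proof.
move=> /choice[s fs] ker; pose h b := g (s b).
have hf a : h (f a) = g a.
  by apply/eqP; rewrite -subr_eq0 -rmorphB ker // rmorphB fs subrr.
have hB : zmod_morphism h by move=> x y; rewrite -{1}(fs x) -{1}(fs y) -rmorphB hf rmorphB.
have h1 : monoid_morphism h.
  split=> [|x y]; first by rewrite -(rmorph1 f) hf rmorph1.
  by rewrite -{1}(fs x) -{1}(fs y) -rmorphM hf rmorphM.
pose hA : {rmorphism B -> D} := HB.pack h (GRing.isZmodMorphism.Build B D h hB)
  (GRing.isMonoidMorphism.Build B D h h1).
by exists hA.
Qed.

Section Presentation.
Variables (R : realType) (C : closedFieldType) (v : valuation R C) (q : nat).
Variables (pi pi2 alpha : C).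
Hypotheses (q1 : (1 < q)%N) (Cq : [pchar C].-nat q) (v_pi : v pi = 1%:E).
Hypothesis hpi2 : lt_generator q pi pi2.
Hypothesis halpha : alpha ^+ (q ^ 2 * (q + 1)) = pi2.

Local Notation Y := (Y31e1 q pi v pi2).
Local Notation O := (integer v).
Local Notation k := (residue_field v).
Local Notation evalf := (@evalf R C v q pi pi2 alpha q1 v_pi hpi2 halpha).

Lemma x_coordE : x_coord alpha = coordx alpha :> (pts Y -> C).
Proof. by apply/funext => P; rewrite /x_coord /coordx mulrC. Qed.
Lemma y_coordE : y_coord alpha = coordy alpha :> (pts Y -> C).
Proof. by apply/funext => P; rewrite /y_coord /coordy mulrC. Qed.

Let evalf_pb p : power_bounded (evalf p).
Proof. exact/power_bounded_ge0/evalf_ge0. Qed.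

Definition evalf_red (p : {poly {poly O}}) : reduction Y := reduce (evalf p).

Fact evalf_red_zmod : zmod_morphism evalf_red.
Proof. by move=> p p'; rewrite /evalf_red evalfD evalfN reduceB. Qed.
Fact evalf_red_monoid : monoid_morphism evalf_red.
Proof.
split=> [|p p']; first by rewrite /evalf_red evalf1 reduce1.
by rewrite /evalf_red evalfM reduceM.
Qed.
HB.instance Definition _ := GRing.isZmodMorphism.Build _ _ evalf_red evalf_red_zmod.
HB.instance Definition _ := GRing.isMonoidMorphism.Build _ _ evalf_red evalf_red_monoid.

Lemma evalf_red_eq0 p : evalf_red p = 0 <-> top_nilpotent (evalf p).
Proof.
rewrite -(rmorph0 evalf_red) /evalf_red.
have -> : evalf p = evalf p - evalf 0 by rewrite evalf0 subr0.
by rewrite reduce_eq // evalf0 !subr0.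
Qed.

Lemma reduction_presentation :
  plane_presentation (reduce (x_coord alpha : pts Y -> C))
    (reduce (y_coord alpha : pts Y -> C)) (reduced_equation q v).
Proof.
pose f : {rmorphism {poly {poly O}} -> {poly {poly k}}} := swapXY \o @red2 R C v.
have fsurj p : exists p', f p' = p.
  have [p' pE] := red2_surj (swapXY p); exists p'.
  by rewrite /f /= pE swapXYK.
have ker p : f p = 0 -> evalf_red p = 0.
  move=> /(congr1 swapXY); rewrite /f /= swapXYK rmorph0 => fp.
  apply/evalf_red_eq0; have [s s0 hs] := red2_0_small q1 v_pi hpi2 halpha fp.
  exact: top_nilpotent_ge hs.
have [Phi PhiE] := factor_rmorphism fsurj ker; exists Phi; split.
- move=> c; have [a <-] : exists a : O, integer_res a = c.
    by exists (repr c); apply: integer_resK.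
  have := PhiE a%:P%:P; rewrite /f /= swap_red2C => ->.
  by rewrite /evalf_red evalfC -residueE reduction_scalarE ?integer_ge0.
- have := PhiE ('X : {poly {poly O}}); rewrite /f /= swap_red2X => ->.
  by rewrite /evalf_red evalfX x_coordE.
- have := PhiE ('X%:P : {poly {poly O}}); rewrite /f /= swap_red2Y => ->.
  by rewrite /evalf_red evalfY y_coordE.
- move=> h; have [g gb <-] := reduce_surj h.
  have [p gp] := power_bounded_approx q1 Cq v_pi hpi2 halpha gb.
  exists (f p); rewrite PhiE; apply/esym/reduce_eq => //.
  exact: top_nilpotent_ge (alpha_val_gt0 R q1) gp.
move=> p; have [p' pE] := fsurj p; rewrite -{1}pE PhiE evalf_red_eq0.
have p'E : red2 p' = swapXY p by rewrite -pE /f /= swapXYK.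
rewrite evalf_nilpotent // p'E.
exact: (swap_multiple p (swap_reduced_equation v q)).
Qed.

End Presentation.

Theorem lemma4p5 (R : realType) (p q : nat) (F : fieldType) (C : closedFieldType)
    (iota : {rmorphism F -> C}) (v : valuation R C) (pi : F)
    (hF : local_field p q (valn_comp iota v) pi)
    (hC : completed_algebraic_closure iota v)
    (pi2 alpha zeta : C) (sigma : {rmorphism C -> C})
    (hpi2 : lt_generator q (iota pi) pi2)
    (halpha : alpha ^+ (q ^ 2 * (q + 1)) = pi2)
    (hsigma : inertia iota v sigma)
    (hsigma_pi2 : sigma pi2 = pi2)
    (hzeta : zeta ^+ (q ^ 2 * (q + 1)) = 1)
    (hsigma_alpha : sigma alpha = zeta * alpha) :
  let Y := Y31e1 q (iota pi) v pi2 in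
  let x : reduction Y := reduce (x_coord (v := v) alpha) in
  let y : reduction Y := reduce (y_coord (v := v) alpha) in
  [/\ power_bounded (x_coord alpha : pts Y -> C),
      power_bounded (y_coord alpha : pts Y -> C),
      plane_presentation x y (reduced_equation q v)
    & exists tau : {rmorphism reduction Y -> reduction Y},
        [/\ reduction_action sigma tau,
            forall c, tau (reduction_scalar Y c) = reduction_scalar Y c,
            tau x = reduction_scalar Y (residue v zeta ^- (q ^ 2)) * x
          & tau y = reduction_scalar Y (residue v zeta)^-1 * y]].
Proof.
move=> Y x y; have [_ q1 _ _] := local_field_finite hF.
have Cq := local_field_pchar hF; have vpi := v_pi hF.
have xb : power_bounded (x_coord alpha : pts Y -> C).
  by rewrite x_coordE; apply/power_bounded_ge0/coordx_ge0.
have yb : power_bounded (y_coord alpha : pts Y -> C).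
  by rewrite y_coordE; apply/power_bounded_ge0/coordy_ge0.
split=> //; first exact: reduction_presentation.
have sigma_bij : bijective sigma by case: hsigma.
have sigma_val := inertia_val hF hsigma.
have sigma_pi : sigma (iota pi) = iota pi := inertia_base hsigma pi.
have sigma_res := inertia_residue hF hC hsigma.
pose tau : {rmorphism reduction Y -> reduction Y} :=
  conj_red sigma_bij sigma_val sigma_pi hsigma_pi2.
have n0 : (0 < q ^ 2 * (q + 1))%N by rewrite muln_gt0 expn_gt0 addn1 ltnW.
have vz : v zeta = 0%E by apply: (valn_pow_eq0 n0); rewrite hzeta valn1.
have vzV n : v (zeta ^- n) = 0%E.
  by have := valnV_fin (valnX_fin n vz); rewrite mul0rn oppr0.
(* A coordinate divided by a power of alpha is multiplied by the inverse of the
   same power of zeta, since sigma fixes the coordinate itself. *)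
have conjZ (c : triple C -> C) n : (forall T, sigma (c T) = c (map_triple sigma T)) ->
    let f : pts Y -> C := fun P => c (sval P) / alpha ^+ n in power_bounded f ->
    tau (reduce f) = reduction_scalar Y (residue v (zeta ^- n)) * reduce f.
  move=> cs f fb; rewrite /tau /= conj_redE // reduction_scalarE ?vzV //.
  rewrite -reduceM //; last by apply: power_bounded_cst; rewrite vzV.
  congr reduce; apply/funext => P; rewrite /conj_fun /f fmorph_div cs.
  rewrite (conj_pointP _ _ _ _ P) rmorphXn hsigma_alpha exprMn invfM !fctE.
  by rewrite mulrCA.
exists tau; split.
- exact: conj_red_action.
- exact: conj_red_scalar.
- rewrite -residueX ?vz // -residueV; last by rewrite (valnX_fin _ vz) mul0rn.
  exact: (conjZ (@tX2 C) _ _ xb).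
rewrite -residueV // -[zeta]expr1; apply: (conjZ (@tY2 C) 1%N) => //.
Qed.
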